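(* Let $\ell\ge 2$ be an integer and let $f\in C^{\ell}(\mathbb{R})$ be nonlinear of order $\ell$. Let $\Omega\subset\mathbb{R}^2$ be open, with points denoted $(t,x)$, and let $u\in C^0(\Omega)$, $g\in L^\infty(\Omega)$ be such that \[ \partial_t u+\partial_x\big(f(u)\big)=g\qquad\text{in }\mathcal{D}'(\Omega). \] Then for $\mathcal{L}^2$-a.e. $(t,x)\in\Omega$ it holds \[ \limsup_{y\to x}\frac{|u(t,y)-u(t,x)|}{|y-x|^{1/\ell}}=0 . \]
   Context: Nonlinearity: let $I\subset\mathbb{R}$ be an interval. A function $f:I\to\mathbb{R}$ differentiable at $v\in I$ is called nonlinear of order $\ell>1$ with constant $c>0$ at $v$ if there exists $\delta>0$ such that for every $h$ with $v+h\in I$ and $|h|<\delta$ one has $|f(v+h)-f(v)-f'(v)h|\ge c|h|^{\ell}$. The function $f:\mathbb{R}\to\mathbb{R}$ is called nonlinear of order $\ell$ if for every $v\in\mathbb{R}$ it is nonlinear of order $\ell$ at $v$ with some constant $c>0$ (possibly depending on $v$). The equation holds in $\mathcal{D}'(\Omega)$, i.e. $\iint_\Omega \big(u\,\partial_t\varphi+f(u)\,\partial_x\varphi+g\,\varphi\big)\,dt\,dx=0$ for all $\varphi\in C_c^\infty(\Omega)$. $\mathcal{L}^2$ denotes the Lebesgue measure on $\mathbb{R}^2$. In the limsup, $y\ne x$ and $(t,y)\in\Omega$. *)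

(* Defs.v *)
From HB Require Import structures.
From mathcomp Require Import all_boot all_order all_algebra.
From mathcomp Require Import all_classical all_reals all_analysis.
Set Implicit Arguments.
Unset Strict Implicit.
Unset Printing Implicit Defensive.

Import Order.TTheory GRing.Theory Num.Theory.
Import numFieldNormedType.Exports.

Local Open Scope classical_set_scope.
Local Open Scope ring_scope.

Definition of_class_C (R : realType) (n : nat) (f : R -> R) : Prop :=
  (forall k x, (k < n)%N -> derivable (derive1n k f) x 1) /\
  continuous (derive1n n f).

Definition nonlinear_at (R : realType) (l : nat) (c : R) (f : R -> R) (v : R)
    : Prop :=
  derivable f v 1 /\
  exists2 delta : R, 0 < delta &
    forall h : R, `|h| < delta ->
      c * `|h| ^+ l <= `|f (v + h) - f v - derive1 f v * h|.

Definition nonlinear (R : realType) (l : nat) (f : R -> R) : Prop :=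
  forall v : R, exists2 c : R, 0 < c & nonlinear_at l c f v.

(* Points of the plane are pairs (t, x), so the first coordinate is time. *)
Definition dt (R : realType) (phi : R * R -> R) (z : R * R) : R :=
  'D_((1, 0) : R * R) phi z.

Definition dx (R : realType) (phi : R * R -> R) (z : R * R) : R :=
  'D_((0, 1) : R * R) phi z.

Fixpoint of_class_C2 (R : realType) (n : nat) (phi : R * R -> R) : Prop :=
  if n is m.+1 then
    [/\ continuous phi,
        forall z, derivable phi z ((1, 0) : R * R),
        forall z, derivable phi z ((0, 1) : R * R),
        of_class_C2 m (dt phi) & of_class_C2 m (dx phi)]
  else continuous phi.

(* Elements of C_c^oo(Omega) are represented by their extensions by zero to
   the whole plane. *)
Definition test_function (R : realType) (Omega : set (R * R))
    (phi : R * R -> R) : Prop :=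
  [/\ forall n, of_class_C2 n phi,
      compact (closure [set z | phi z != 0]) &
      closure [set z | phi z != 0] `<=` Omega].

Notation leb2 R := (@lebesgue_measure R \x @lebesgue_measure R)%E.

(* Only the values of g on D matter: g is replaced by its extension by zero. *)
Definition Linfty (R : realType) (D : set (R * R)) (g : R * R -> R) : Prop :=
  (g \_ D) \in Lfun (leb2 R) +oo%E.

Definition weak_solution (R : realType) (Omega : set (R * R)) (f : R -> R)
    (u g : R * R -> R) : Prop :=
  forall phi : R * R -> R, test_function Omega phi ->
    (\int[leb2 R]_(z in Omega)
       (u z * dt phi z + f (u z) * dx phi z + g z * phi z)%:E = 0)%E.

(* The limsup is over y -> x with y != x and (t, y) in Omega, and takes its
   value in the extended reals. *)
Definition limsup_quotient (R : realType) (Omega : set (R * R)) (l : nat)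
    (u : R * R -> R) (z : R * R) : \bar R :=
  limf_esup
    (fun y : R => (`|u (z.1, y) - u z| / `|y - z.2| `^ (l%:R^-1))%:E)
    (within [set y | Omega (z.1, y)] (z.2)^').

(* Main.v *)
(* Let U be a primitive of u in x and V a primitive of f(u) in t. Testing with
   smoothed indicators turns the equation into a balance on rectangles: the outflow
   of (u, f(u)) is the integral of g. Along a characteristic x' = f'(u), which
   exists by Peano's theorem, convexity of f makes the balance over thin strips on
   either side one-sided, so u is Lipschitz along it. Characteristics carrying
   different values must collide unless they start far enough apart; hence
   |u(t,y) - u(t,x)|^2 <= C |y - x| where f'' is bounded away from 0, and
   |u(t,y) - v|^l <= C |y - x| when u(t,x) = v and f is nonlinear of order l at v.

   Where f''(u) <> 0, the first bound improves to o(|y - x|) at the points (t,x)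
   around which g is nearly constant on most of every small box of size r x r^2
   sheared by the characteristic direction, because a constant source shifts all
   characteristics alike. Such boxes engulf one another, so Vitali's covering
   argument shows that almost every point is of this kind. The zeros of f'' are
   isolated, hence countable; if v is one of them, then for every t almost every
   point x of the slice {u(t,.) = v} is a density point of it, so a point y near x
   is at distance o(|y - x|) from the slice, and the second bound concludes. *)
Require Import Defs.
From HB Require Import structures.
From mathcomp Require Import all_boot all_order all_algebra.
From mathcomp Require Import all_classical all_reals all_analysis.
From mathcomp Require Import measurable_realfun ess_sup_inf.
From mathcomp Require Import zify ring lra.
Set Implicit Arguments.
Unset Strict Implicit.
Unset Printing Implicit Defensive.

Import Order.TTheory GRing.Theory Num.Theory.
Import numFieldNormedType.Exports.

Local Open Scope classical_set_scope.
Local Open Scope ring_scope.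

(** * Real induction and Dini derivatives *)

(** The obstacle is that [u] is merely continuous, so characteristics are not unique and only the
    comparison of two of them gives information. If they carry values at distance [d] and approach
    each other, they would meet after a time of order [(x2 - x1) / d], and they cannot meet while
    the values differ. A source bounded by [M] lets the gap survive for a time of order [d / M],
    whence [d ^ 2 <= C (x2 - x1)]. A source within a small [e'] of a constant lets it survive for a
    time of order [d / e'], so that [C] becomes as small as desired. Over a time [r] a
    characteristic changes its value and slope by [O(r)], and leaves a straight line by [O(r ^ 2)];
    across a width [r ^ 2] the first bound gives [O(r)] again. This fixes the shape of the boxes.
    For an increment [a] one takes [r] of order [a] and strips of width of order [a ^ 2]; the part
    of the box with a bad source has measure [o(a ^ 3)], hence changes averages over a strip by
    [o(a)] only. The estimates are proved forward in time for values decreasing in [x]; the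
    reflection [(t, x) -> (-t, -x)] gives the others. *)

Lemma real_induction (R : realType) (a b : R) (P : R -> Prop) :
  P a ->
  (forall x, a <= x < b -> (forall y, a <= y <= x -> P y) ->
    exists2 d, 0 < d & forall y, x < y < x + d -> P y) ->
  (forall x, a < x <= b -> (forall y, a <= y < x -> P y) -> P x) ->
  forall x, a <= x <= b -> P x.
Proof.
move=> Pa Pstep Plim.
(* [S] is the set of points up to which [P] holds throughout. Its supremum lies in it by the limit
   hypothesis, and could be exceeded by the step hypothesis unless it is [b]. *)
pose S := [set x | a <= x <= b /\ forall y, a <= y <= x -> P y].
move=> x0 /andP[ax0 x0b]; have ab := le_trans ax0 x0b.
have Sa : S a.
  by split=> [|y /andP[? ?]]; [rewrite lexx | have -> : y = a by lra].
have Sub : has_sup S by split; [exists a | exists b => x [/andP[]]].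
pose s := sup S.
have as_ : a <= s by apply: ub_le_sup => //; case: Sub.
have sb : s <= b by apply: ge_sup; [exists a | move=> x [/andP[]]].
have Plt y : a <= y < s -> P y.
  move=> /andP[ay ys].
  have [z [zab zP] yz] := sup_adherent (eps := s - y) ltac:(lra) Sub.
  by apply: zP; rewrite ay/=; move: yz; rewrite -/s; lra.
have Ps : P s.
  have [->//|as'] := eqVneq s a.
  by apply: Plim => //; rewrite lt_neqAle eq_sym as' as_ sb.
have Ss : S s.
  split=> [|y /andP[ay ys]]; first by rewrite as_ sb.
  by have [->//|ys'] := eqVneq y s; apply: Plt; rewrite ay lt_neqAle ys' ys.
have [sb'|bs] := ltP s b; last first.
  by case: Ss => _; apply; rewrite ax0 (le_trans x0b).
have [d d0 dP] := Pstep s ltac:(lra) (proj2 Ss).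
pose s' := Num.min (s + d / 2) b.
have s's : s < s' by rewrite lt_min; apply/andP; split; lra.
have s'd : s' <= s + d / 2 by rewrite ge_min lexx.
have s'b : s' <= b by rewrite ge_min lexx orbT.
suff /(ub_le_sup Sub.2) : S s' by rewrite -/s; lra.
split=> [|y /andP[ay ys]]; first by lra.
have [ys''|sy] := leP y s; first by apply: (proj2 Ss); lra.
by apply: dP; lra.
Qed.

(** Continuity is replaced by the absence of upward jumps from the left, because the lemma is
    applied in [strip_le] to a function containing [- H], with [H] monotone and possibly
    discontinuous. *)
Lemma dini_le (R : realType) (phi : R -> R) (a b K : R) :
  a <= b ->
  (forall x, a < x <= b -> forall e, 0 < e ->
    exists2 d, 0 < d & forall y, a <= y -> x - d < y < x -> phi x <= phi y + e) ->
  (forall x, a <= x < b -> forall e, 0 < e ->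
    exists2 d, 0 < d &
      forall y, x < y < x + d -> y <= b -> phi y - phi x <= (K + e) * (y - x)) ->
  phi b - phi a <= K * (b - a).
Proof.
move=> ab Hl Hr.
suff H e : 0 < e -> phi b - phi a <= (K + e) * (b - a).
  apply/ler_addgt0Pr => e e0.
  have [->|ab'] := eqVneq a b; first by rewrite !subrr mulr0 add0r ltW.
  have ba : 0 < b - a by rewrite subr_gt0 lt_neqAle ab'.
  have := H (e / (b - a)) (divr_gt0 e0 ba).
  by rewrite mulrDl divfK ?gt_eqF.
move=> e0.
pose P x := phi x - phi a <= (K + e) * (x - a).
suff : P b by [].
apply: (@real_induction R a b P); rewrite /P.
- by rewrite !subrr mulr0.
- move=> x /andP[ax xb] Px; have [d d0 dP] := Hr x ltac:(lra) e e0.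
  have Px' := Px x ltac:(lra).
  pose d' := Num.min d (b - x).
  have d'd : d' <= d by rewrite ge_min lexx.
  have d'b : d' <= b - x by rewrite ge_min lexx orbT.
  exists d'; first by rewrite lt_min d0; lra.
  move=> y /andP[xy yd]; have := dP y ltac:(lra) ltac:(lra); lra.
- move=> x /andP[ax xb] Px; apply/ler_addgt0Pr => e' e'0.
  have [d d0 dP] := Hl x ltac:(lra) (e' / 2) ltac:(lra).
  pose c := Num.min d (Num.min (x - a) (e' / (2 * (`|K + e| + 1)))).
  have c1 : c <= d by rewrite ge_min lexx.
  have c2 : c <= x - a by rewrite !ge_min lexx orbT.
  have N0 : 0 <= `|K + e| by [].
  have k0 : 0 < 2 * (`|K + e| + 1) by lra.
  have c3 : c * (2 * (`|K + e| + 1)) <= e'.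
    by rewrite -ler_pdivlMr// !ge_min lexx !orbT.
  have c0 : 0 < c by rewrite !lt_min d0 divr_gt0// andbT; lra.
  have := dP (x - c / 2) ltac:(lra) ltac:(lra).
  have := Px (x - c / 2) ltac:(lra).
  have : - `|K + e| <= K + e by rewrite lerNl -normrN ler_norm.
  nra.
- by rewrite ab lexx.
Qed.

(** Differentiability as a first-order expansion with an explicit radius, so that increments can be
    compared by linear arithmetic. *)
Definition der (R : realType) (f : R -> R) (x d : R) : Prop :=
  forall e : R, 0 < e -> exists2 r : R, 0 < r &
    forall h, `|h| < r -> `|f (x + h) - f x - h * d| <= e * `|h|.

Lemma is_derive_der (R : realType) (f : R -> R) (x d : R) :
  is_derive x 1 f d -> der f x d.
Proof.
move=> Hd e e0.
have /derivable1_diffP/diff_locallyP[_] : derivable f x 1 by case: Hd.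
have dE h : 'd f x h = h * d.
  rewrite -[h in LHS]mulr1 -[h * 1]/(h *: 1) linearZ/= -deriveE.
    by rewrite (@derive_val _ _ _ _ _ _ _ Hd).
  by apply/derivable1_diffP; case: Hd.
move=> /eqaddoP H; have /nbhs_ballP[r/= r0 rP] := H e e0.
exists r => // h hr; have := rP h.
rewrite /ball/= sub0r normrN => /(_ hr); rewrite !fctE/= dE.
by rewrite [h + x]addrC opprD addrA.
Qed.

Lemma der_is_derive (R : realType) (f : R -> R) (x d : R) :
  der f x d -> is_derive x 1 f d.
Proof.
move=> H.
suff Hc : (fun h : R => h^-1 *: (f (h *: 1 + x) - f x)) @ 0^' --> d.
  by split; [apply/cvg_ex; exists d | apply/cvg_lim].
apply/cvgrPdist_le => e e0; have [r r0 rP] := H e e0.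
near=> h.
have hr : `|h| < r by near: h; apply: dnbhs0_lt.
have h0 : h != 0 by near: h; exact: nbhs_dnbhs_neq.
rewrite /GRing.scale/= mulr1 (addrC h) distrC.
rewrite -[d](mulKf h0) -mulrBr normrM normfV ler_pdivrMl ?normr_gt0//.
by rewrite (mulrC _ e); exact: rP.
Unshelve. all: by end_near. Qed.
(** * Peano's theorem *)

Definition cont2 (R : realType) (u : R -> R -> R) : Prop :=
  forall t x e : R, 0 < e -> exists2 d : R, 0 < d &
    forall t' x', `|t' - t| < d -> `|x' - x| < d -> `|u t' x' - u t x| < e.

Fixpoint euler (R : realType) (F : R -> R -> R) (t0 x0 h : R) (k : nat) : R :=
  if k is k'.+1 then
    euler F t0 x0 h k' + h * F (t0 + k'%:R * h) (euler F t0 x0 h k')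
  else x0.

(** Serves twice: with [c = 0] it makes the polygons Lipschitz, with [c] the slope at a limit point
    it gives the derivative of the limit. *)
Lemma euler_incr (R : realType) (F : R -> R -> R) (t0 x0 h c e : R) (i m : nat) :
  0 <= h ->
  (forall k, (i <= k < i + m)%N ->
     `|F (t0 + k%:R * h) (euler F t0 x0 h k) - c| <= e) ->
  `|euler F t0 x0 h (i + m) - euler F t0 x0 h i - c * (m%:R * h)|
    <= e * (m%:R * h).
Proof.
move=> h0; elim: m => [|m IH] H.
  by rewrite addn0 subrr !mul0r !mulr0 subrr normr0.
have {}IH := IH (fun k hk => H k ltac:(lia)).
rewrite addnS /=.
have := H (i + m)%N ltac:(lia).
set y := euler _ _ _ _ (i + m); set F' := F _ _ => HF.
rewrite -natr1 mulrDl !mulrDr mul1r.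
have -> : y + h * F' - euler F t0 x0 h i - (c * (m%:R * h) + c * h) =
  (y - euler F t0 x0 h i - c * (m%:R * h)) + h * (F' - c) by ring.
apply: (le_trans (ler_normD _ _)); apply: lerD => //.
by rewrite normrM ger0_norm// mulrC ler_wpM2r.
Qed.

(* Limits along an ultrafilter replace the Arzela-Ascoli extraction of a
   subsequence of the Euler polygons. *)
Lemma ultra_seq_cluster (R : realType) (U : set_system nat) (z : nat -> R) (a b : R) :
  UltraFilter U -> (forall n, a <= z n <= b) ->
  exists p : R, forall e : R, 0 < e -> U [set n | `|z n - p| < e].
Proof.
move=> UU zab.
have UP : ProperFilter U by exact: ultra_proper.
have FF : ProperFilter (z @ U) by exact: fmap_proper_filter.
have [|p [_ pcl]] := @segment_compact R a b (z @ U) FF.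
  rewrite nbhs_filterE /fmap/=; apply: filterS filterT => n _ /=.
  by rewrite in_itv/= zab.
exists p => e e0.
have [//|] := in_ultra_setVsetC [set n | `|z n - p| < e] UU.
move=> UC; exfalso.
have := pcl [set y | ~ (`|y - p| < e)] (ball p e).
case; [exact: UC | exact: nbhsx_ballx|].
by move=> y [] /= h; rewrite /ball/= distrC => /h.
Qed.

(** The polygons of step [1 / (n + 1)], read at the last node before [t], converge for every [t]
    along one ultrafilter; near [(t, g t)] all visited nodes have slope close to [F t (g t)]. The
    derivative is obtained in the strict form, with two free points [s] and [s'], which is stable
    under restriction and time reversal. *)
Lemma peano (R : realType) (F : R -> R -> R) (L t0 x0 : R) :
  cont2 F -> (forall t x, `|F t x| <= L) ->
  exists g : R -> R, [/\ g t0 = x0,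
    forall s s', t0 <= s <= s' -> `|g s' - g s| <= L * (s' - s) &
    forall t e : R, t0 <= t -> 0 < e -> exists2 d : R, 0 < d &
      forall s s', t0 <= s -> t - d < s -> s <= s' -> s' < t + d ->
        `|g s' - g s - F t (g t) * (s' - s)| <= e * (s' - s)].
Proof.
move=> Fc FL.
have L0 : 0 <= L by apply: le_trans (FL 0 0).
pose h n : R := n.+1%:R^-1.
have h0 n : 0 < h n by rewrite invr_gt0.
pose y n k := euler F t0 x0 (h n) k.
pose idx n t := Num.truncn ((t - t0) / h n).
have idxP n t : t0 <= t -> (idx n t)%:R * h n <= t - t0 < (idx n t)%:R * h n + h n.
  move=> tt0; have := truncn_itv (divr_ge0 (_ : 0 <= t - t0) (ltW (h0 n))).
  rewrite subr_ge0 => /(_ tt0); rewrite -/(idx n t).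
  by rewrite ler_pdivlMr// ltr_pdivrMr// -natr1 mulrDl mul1r.
have idx_le n s s' : s <= s' -> (idx n s <= idx n s')%N.
  by move=> ss'; apply: le_truncn; rewrite ler_pM2r ?invr_gt0// lerB.
have yL n i m : `|y n (i + m)%N - y n i| <= L * (m%:R * h n).
  have := @euler_incr R F t0 x0 (h n) 0 L i m (ltW (h0 n)).
  by rewrite mul0r subr0; apply => k _; rewrite subr0.
have [U [UU Uoo]] := @ultraFilterLemma nat \oo _.
have UF : Filter U by exact: filter_filter.
have hU (e : R) : 0 < e -> U [set n | h n < e].
  move=> e0; apply: Uoo; have := @cvg_harmonic R.
  move=> /cvgrPdist_lt /(_ e e0) []// N _ NP; exists N => // n /NP /=.
  by rewrite sub0r normrN gtr0_norm//; exact: h0.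
have /choice[g gP] : forall t, exists p : R, forall e : R, 0 < e ->
    U [set n | `|y n (idx n t) - p| < e].
  move=> t; apply: (@ultra_seq_cluster R U _ (x0 - L * `|t - t0|) (x0 + L * `|t - t0|)) => n.
  have [tt0|tt0] := ltP t t0.
    have -> : idx n t = 0%N.
      apply/truncn0Pn; rewrite -ltNge.
      by apply: lt_trans ltr01; rewrite pmulr_llt0 ?invr_gt0//; lra.
    have H1 : 0 <= L * `|t - t0| by apply: mulr_ge0.
    rewrite /y/=; lra.
  have := yL n 0%N (idx n t); rewrite add0n {2}/y/= ler_norml.
  have := idxP n t tt0 => /andP[H1 _].
  rewrite (@ger0_norm _ (t - t0)); last by lra.
  have := ler_wpM2l L0 H1; lra.
(* A slope bound satisfied between [s] and [s'] by almost all polygons, in the sense of [U], passes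
   to the limit; [eta] pays for the rounding of times to nodes and for the distance of the polygon
   to [g] at both ends. *)
have main (s s' c e : R) : 0 <= e -> t0 <= s -> s <= s' -> 
    U [set n | forall k, (idx n s <= k < idx n s')%N ->
      `|F (t0 + k%:R * h n) (y n k) - c| <= e] ->
    `|g s' - g s - c * (s' - s)| <= e * (s' - s).
  move=> e0 ts ss' HU; apply/ler_addgt0Pr => e1 e10.
  pose eta := e1 / (2 + `|c| + e).
  have D0 : 0 < 2 + `|c| + e by have : 0 <= `|c| by []; lra.
  have eta0 : 0 < eta by apply: divr_gt0.
  have etaE : eta * (2 + `|c| + e) = e1 by rewrite divfK// gt_eqF.
  have : U [set n | [/\ `|y n (idx n s) - g s| < eta,
     `|y n (idx n s') - g s'| < eta, h n < eta &
     forall k, (idx n s <= k < idx n s')%N ->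
      `|F (t0 + k%:R * h n) (y n k) - c| <= e]].
    apply: filterS (filterI (filterI (gP s _ eta0) (gP s' _ eta0))
      (filterI (hU _ eta0) HU)).
    by move=> n [[? ?] [? ?]].
  move=> /filter_ex[n [H1 H2 H3 H4]].
  have := @euler_incr R F t0 x0 (h n) c e (idx n s) (idx n s' - idx n s) (ltW (h0 n)).
  rewrite subnKC ?idx_le// => /(_ H4).
  rewrite -!/(y n _) natrB ?idx_le// mulrBl.
  have := idxP n s ts; have := idxP n s' (le_trans ts ss').
  set a' := _ * h n; set a := _ * h n => Ha' Ha H.
  have aa : `|(a' - a) - (s' - s)| <= eta by rewrite ler_norml; lra.
  have c0 : 0 <= `|c| by [].
  have -> : g s' - g s - c * (s' - s) =
    (y n (idx n s') - y n (idx n s) - c * (a' - a)) + c * ((a' - a) - (s' - s))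
    + (y n (idx n s) - g s) - (y n (idx n s') - g s') by ring.
  apply: (le_trans (ler_normB _ _)).
  apply: (@le_trans _ _ (e * (a' - a) + `|c| * eta + eta + eta)).
    apply: lerD (ltW H2); apply: (le_trans (ler_normD _ _)).
    apply: lerD (ltW H1); apply: (le_trans (ler_normD _ _)).
    by apply: lerD => //; rewrite normrM ler_wpM2l.
  have aa2 : a' - a <= s' - s + eta by lra.
  have := ler_wpM2l e0 aa2; lra.
exists g; split.
- apply/eqP; rewrite -subr_eq0 -normr_le0; apply/ler_addgt0Pr => e e0.
  have := gP t0 e e0 => /filter_ex[n /=].
  rewrite /idx subrr mul0r truncn0 /y/= distrC add0r; exact: ltW.
- move=> s s' /andP[ts ss'].
  have := main s s' 0 L L0 ts ss'; rewrite mul0r subr0; apply.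
  by apply: filterS filterT => n _ k _; rewrite subr0.
- move=> t e tt0 e0; have [d1 d10 d1P] := Fc t (g t) e e0.
  have L1 : 0 < 8 * (L + 1) by lra.
  (* The nodes in question are within time [4 * d] of the node before [t], so the polygon moves by
     at most [4 * L * d <= d1 / 2] from a point at distance less than [d1 / 4] of [g t]. *)
  pose d := d1 / (8 * (L + 1)).
  have d0 : 0 < d by apply: divr_gt0.
  have dE : d * (8 * (L + 1)) = d1 by rewrite divfK// gt_eqF.
  have Ld0 : 0 <= L * d by rewrite mulr_ge0// ltW.
  exists d => // s s' ts tds ss' sd.
  apply: main => //; first exact: ltW.
  have : U [set n | `|y n (idx n t) - g t| < d1 / 4 /\ h n < d].
    by apply: filterI; [apply: gP; lra | exact: hU].
  apply: filterS => n [H1 H2] k /andP[ik kj]; apply/ltW.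
  have tk1 : k%:R * h n <= s' - t0.
    have /andP[+ _] := idxP n s' (le_trans ts ss'); apply: le_trans.
    by rewrite ler_wpM2r ?(ltW (h0 n))// ler_nat ltnW.
  have tk2 : s - t0 - h n <= k%:R * h n.
    have /andP[_ H] := idxP n s ts.
    apply: (@le_trans _ _ ((idx n s)%:R * h n)); first by lra.
    by rewrite ler_wpM2r ?(ltW (h0 n))// ler_nat.
  apply: d1P; first by rewrite ltr_norml; lra.
  have Hk : `|y n k - y n (idx n t)| <= L * `|k%:R * h n - (idx n t)%:R * h n|.
    have [le1|le1] := leqP (idx n t) k.
      have := yL n (idx n t) (k - idx n t)%N; rewrite subnKC// natrB// mulrBl.
      by move=> /le_trans; apply; rewrite ler_wpM2l// ler_norm.
    have := yL n k (idx n t - k)%N; rewrite subnKC 1?ltnW// natrB 1?ltnW// mulrBl.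
    rewrite distrC (distrC (k%:R * _)).
    by move=> /le_trans; apply; rewrite ler_wpM2l// ler_norm.
  have Hd : `|k%:R * h n - (idx n t)%:R * h n| <= 4 * d.
    by have := idxP n t tt0; rewrite ler_norml; lra.
  have := ler_wpM2l L0 Hd => Hd'.
  have -> : y n k - g t = (y n k - y n (idx n t)) + (y n (idx n t) - g t) by ring.
  apply: (le_lt_trans (ler_normD _ _)); lra.
Qed.
(** * Characteristics and balance laws on rectangles *)

Lemma pos_le2 (R : realType) (a b : R) : 0 < a -> 0 < b ->
  exists r : R, [/\ 0 < r, r <= a & r <= b].
Proof.
by move=> a0 b0; exists (Num.min a b); split; rewrite ?lt_min ?a0 ?ge_min ?lexx ?orbT.
Qed.
Lemma pos_le_all (R : realType) (s : seq R) :
  all (fun x => 0 < x) s -> exists2 e : R, 0 < e & all (fun x => e <= x) s.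
Proof.
elim: s => [_|x s IH /= /andP[x0 /IH[e e0 es]]]; first by exists 1.
have [r [r0 rx re]] := pos_le2 x0 e0; exists r => //=; rewrite rx.
by apply: sub_all es => y; exact: le_trans.
Qed.

Lemma der_mvt (R : realType) (phi dphi : R -> R) (a b c e : R) :
  a <= b -> (forall y, a <= y <= b -> der phi y (dphi y)) ->
  (forall y, a <= y <= b -> `|dphi y - c| <= e) ->
  `|phi b - phi a - c * (b - a)| <= e * (b - a).
Proof.
move=> ab Hd Hc.
have [z|z|z] := @MVT_segment R phi dphi a b ab.
- rewrite in_itv/= => /andP[az zb].
  by apply: der_is_derive; apply: Hd; rewrite !ltW.
- apply: derivable_within_continuous => x; rewrite in_itv/= => xab.
  by have [] := der_is_derive (Hd x xab).
- rewrite in_itv/= => zab ->; rewrite -mulrBl normrM.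
  by rewrite (ger0_norm (_ : 0 <= b - a)) ?subr_ge0// ler_wpM2r ?subr_ge0// Hc.
Qed.

(** Real induction on the right end of the segment takes the place of a compactness argument. *)
Lemma cont2_tube (R : realType) (u : R -> R -> R) (a b t e : R) :
  cont2 u -> 0 < e -> a <= b ->
  exists2 d : R, 0 < d &
    forall t' x, `|t' - t| < d -> a <= x <= b -> `|u t' x - u t x| <= e.
Proof.
move=> uc e0 ab.
pose P y := exists2 d : R, 0 < d &
    forall t' x, `|t' - t| < d -> a <= x <= y -> `|u t' x - u t x| <= e.
have loc x : exists2 d : R, 0 < d & forall t' x',
    `|t' - t| < d -> `|x' - x| < d -> `|u t' x' - u t x'| <= e.
  have [d d0 dP] := uc t x (e / 2) ltac:(lra).
  exists d => // t' x' ht hx.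
  have H1 := dP t' x' ht hx; have H2 := dP t x' ltac:(by rewrite subrr normr0) hx.
  have -> : u t' x' - u t x' = (u t' x' - u t x) - (u t x' - u t x) by ring.
  by apply: (le_trans (ler_normB _ _)); lra.
apply: (@real_induction R a b P); rewrite /P.
- have [d d0 dP] := loc a; exists d => // t' x ht /andP[h1 h2].
  by apply: dP => //; rewrite (_ : x = a) ?subrr ?normr0//; lra.
- move=> x /andP[ax _] Px; have [d d0 dP] := loc x; exists d => // y /andP[xy yd].
  have [|d' d'0 d'P] := Px x; first by rewrite ax lexx.
  have [r [r0 rd rd']] := pos_le2 d0 d'0.
  exists r => // t' z ht /andP[az zy].
  have [zx|xz] := leP z x.
    by apply: d'P; rewrite ?az//; exact: lt_le_trans ht rd'.
  apply: dP; first exact: lt_le_trans ht rd.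
  by rewrite ger0_norm; lra.
- move=> x /andP[ax _] Px; have [d d0 dP] := loc x.
  have [r [r0 rd rd']] : exists r, [/\ 0 < r, r <= d & r <= x - a].
    by apply: pos_le2 => //; rewrite subr_gt0.
  have [|d' d'0 d'P] := Px (x - r / 2); first by lra.
  have [s [s0 sd sd']] := pos_le2 d0 d'0.
  exists s => // t' z ht /andP[az zy].
  have [zx|xz] := leP z (x - r / 2).
    by apply: d'P; rewrite ?az//; exact: lt_le_trans ht sd'.
  apply: dP; first exact: lt_le_trans ht sd.
  by rewrite ler0_norm; lra.
- by rewrite ab lexx.
Qed.

Definition rect_in (R : realType) (B : R -> R -> Prop) (t1 t2 a b : R) : Prop :=
  forall t x, t1 <= t <= t2 -> a <= x <= b -> B t x.

(* With [U] a primitive of [u] in [x] and [V] a primitive of [f u] in [t], this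
   is the outflow of the field [(u, f u)] through the boundary of the rectangle
   [t1, t2] x [a, b], i.e. the integral of [g] over that rectangle. *)
Definition excess (R : realType) (U V : R -> R -> R) (t1 t2 a b : R) : R :=
  (U t2 b - U t2 a) - (U t1 b - U t1 a) + (V t2 b - V t1 b) - (V t2 a - V t1 a).

(* The increments of [H] absorb the part of the rectangle where [g] is not in
   the interval [k1, k2]. *)
Definition balance (R : realType) (B : R -> R -> Prop) (U V : R -> R -> R)
    (k1 k2 : R) (H : R -> R) : Prop :=
  forall t1 t2 a b, t1 <= t2 -> a <= b -> rect_in B t1 t2 a b ->
    k1 * ((b - a) * (t2 - t1)) - (H t2 - H t1) <= excess U V t1 t2 a b
    <= k2 * ((b - a) * (t2 - t1)) + (H t2 - H t1).

(** Regularity only: the equation enters through [balance]. The primitives [U t] for different [t]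
    are unrelated, and so are the [V ^~ x]; this is harmless because [excess] uses increments of [U]
    in [x] and of [V] in [t] only. *)
Record conslaw (R : realType) (f f1 : R -> R) (u U V : R -> R -> R) : Prop := {
  cl_cont : cont2 u;
  cl_f : forall w, der f w (f1 w);
  cl_f1 : forall w e : R, 0 < e ->
    exists2 d : R, 0 < d & forall w', `|w' - w| < d -> `|f1 w' - f1 w| < e;
  cl_U : forall t x, der (U t) x (u t x);
  cl_V : forall t x, der (V ^~ x) t (f (u t x))
}.

Arguments cl_cont {R f f1 u U V} _ t x e _.
Arguments cl_f {R f f1 u U V} _ w e _.
Arguments cl_f1 {R f f1 u U V} _ w e _.
Arguments cl_U {R f f1 u U V} _ t x e _.
Arguments cl_V {R f f1 u U V} _ t x e _.

(** The equation [g' = f1 (u t (g t))] on a closed interval, one-sided at its ends, as a strict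
    derivative: [s] and [s'] may lie on the same side of [t]. *)
Definition is_char (R : realType) (f1 : R -> R) (u : R -> R -> R) (g : R -> R)
    (t1 t2 : R) : Prop :=
  forall t e : R, t1 <= t <= t2 -> 0 < e -> exists2 d : R, 0 < d &
    forall s s', t1 <= s -> t - d < s -> s <= s' -> s' < t + d -> s' <= t2 ->
      `|g s' - g s - f1 (u t (g t)) * (s' - s)| <= e * (s' - s).

Lemma derB (R : realType) (f g : R -> R) (x a b : R) :
  der f x a -> der g x b -> der (fun y => f y - g y) x (a - b).
Proof.
move=> Hf Hg e e0.
have [r r0 rP] := Hf (e / 2) ltac:(lra).
have [s s0 sP] := Hg (e / 2) ltac:(lra).
have [q [q0 qr qs]] := pos_le2 r0 s0.
exists q => // h hq.
have H1 := rP h (lt_le_trans hq qr); have H2 := sP h (lt_le_trans hq qs).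
have -> : f (x + h) - g (x + h) - (f x - g x) - h * (a - b) =
  (f (x + h) - f x - h * a) - (g (x + h) - g x - h * b) by ring.
by apply: (le_trans (ler_normB _ _)); lra.
Qed.

(** The bound is uniform in the nearby time [t'], which compensates for the arbitrary dependence of
    [U] on time. *)
Lemma primitive_local (R : realType) (f f1 : R -> R) (u U V : R -> R -> R) :
  conslaw f f1 u U V -> forall t x e : R, 0 < e ->
  exists2 d : R, 0 < d & forall t' a b,
    `|t' - t| < d -> `|a - x| < d -> `|b - x| < d ->
    `|U t' b - U t' a - u t x * (b - a)| <= e * `|b - a|.
Proof.
move=> cl t x e e0; have [d d0 dP] := cl_cont cl t x e e0.
exists d => // t' a b ht ha hb.
wlog ab : a b ha hb / a <= b => [W|].
  have [|ba] := leP a b; first exact: W.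
  have := W b a hb ha (ltW ba); rewrite (distrC a b).
  rewrite (_ : U t' b - U t' a - u t x * (b - a) =
    - (U t' a - U t' b - u t x * (a - b))); last by ring.
  by rewrite normrN.
rewrite (ger0_norm (_ : 0 <= b - a)) ?subr_ge0//.
apply: (@der_mvt R (U t') (u t')) => // [y _|y yab]; first exact: (cl_U cl).
apply/ltW; apply: dP => //; move: ha hb; rewrite !ltr_norml; lra.
Qed.

Arguments primitive_local {R f f1 u U V} _ t x e _.

Lemma primitive_tube (R : realType) (f f1 : R -> R) (u U V : R -> R -> R) :
  conslaw f f1 u U V -> forall t a b e : R, a <= b -> 0 < e ->
  exists2 d : R, 0 < d & forall t', `|t' - t| < d ->
    `|(U t' b - U t' a) - (U t b - U t a)| <= e * (b - a).
Proof.
move=> cl t a b e ab e0.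
have [d d0 dP] := @cont2_tube R u a b t e (cl_cont cl) e0 ab.
exists d => // t' ht.
have -> : U t' b - U t' a - (U t b - U t a) =
  (U t' b - U t b) - (U t' a - U t a) - 0 * (b - a) by ring.
apply: (@der_mvt R (fun y => U t' y - U t y) (fun y => u t' y - u t y)) => //.
  by move=> y _; apply: derB; exact: (cl_U cl).
by move=> y yab; rewrite subr0; apply: dP.
Qed.

Arguments primitive_tube {R f f1 u U V} _ t a b e _ _.

Lemma is_char_cont (R : realType) (f1 : R -> R) (u : R -> R -> R) (g : R -> R)
    (t1 t2 : R) : is_char f1 u g t1 t2 ->
  forall t e : R, t1 <= t <= t2 -> 0 < e -> exists2 d : R, 0 < d &
    forall s, t1 <= s <= t2 -> `|s - t| < d -> `|g s - g t| < e.
Proof.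
move=> Hg t e tt e0; have [d d0 dP] := Hg t 1 tt ltr01.
set c := f1 _ in dP.
have c0 : 0 <= `|c| by [].
have [r [r0 rd re]] : exists r, [/\ 0 < r, r <= d & r <= e / (2 * (`|c| + 1))].
  by apply: pos_le2 => //; apply: divr_gt0; lra.
have re' : r * (2 * (`|c| + 1)) <= e by rewrite -ler_pdivlMr//; lra.
have key s s' : t1 <= s -> s <= s' -> s' <= t2 -> t - r < s -> s' < t + r ->
    s' - s < r -> `|g s' - g s| < e.
  move=> h1 h2 h3 h4 h5 h6.
  have := dP s s' h1 ltac:(lra) h2 ltac:(lra) h3; rewrite mul1r => H.
  have -> : g s' - g s = (g s' - g s - c * (s' - s)) + c * (s' - s) by ring.
  apply: (le_lt_trans (ler_normD _ _)); rewrite normrM.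
  rewrite (ger0_norm (_ : 0 <= s' - s)) ?subr_ge0//.
  have : `|c| * (s' - s) <= `|c| * r by apply: ler_wpM2l => //; exact: ltW.
  lra.
exists r => // s st; rewrite ltr_norml => hs.
have [ts|ts] := leP t s; first by clear -key tt st hs ts r0; apply: key; lra.
by clear -key tt st hs ts r0; rewrite distrC; apply: key; lra.
Qed.

Arguments is_char_cont {R f1 u g t1 t2} _ t e _ _.

Lemma value_cont (R : realType) (f1 : R -> R) (u : R -> R -> R) (g : R -> R)
    (t1 t2 : R) : cont2 u -> is_char f1 u g t1 t2 ->
  forall t e : R, t1 <= t <= t2 -> 0 < e -> exists2 d : R, 0 < d &
    forall s, t1 <= s <= t2 -> `|s - t| < d -> `|u s (g s) - u t (g t)| < e.
Proof.
move=> uc Hg t e tt e0.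
have [d d0 dP] := uc t (g t) e e0.
have [d' d'0 d'P] := is_char_cont Hg t d tt d0.
have [r [r0 rd re]] := pos_le2 d0 d'0.
exists r => // s st hs; apply: dP; first exact: lt_le_trans hs rd.
by apply: d'P => //; exact: lt_le_trans hs re.
Qed.

Arguments value_cont {R f1 u g t1 t2} _ _ t e _ _.

(** With [w] and [w'] the values of [u] at the left and right ends of the strip following [g], the
    flux through fixed sides contributes [- (f w' - f w)] to the derivative of the strip integral,
    and the motion of the sides contributes [f1 w * (w' - w)]. The sum is minus the convexity gap in
    the last hypothesis, hence only the source can make the integral grow. *)
Lemma strip_le (R : realType) (f f1 : R -> R) (u U V : R -> R -> R)
    (B : R -> R -> Prop) (k1 k2 : R) (H g : R -> R) (t1 t2 b : R) :
  conslaw f f1 u U V -> balance B U V k1 k2 H ->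
  {homo H : x y / x <= y} -> is_char f1 u g t1 t2 -> t1 <= t2 -> 0 < b ->
  (forall t, t1 <= t <= t2 -> exists2 d : R, 0 < d &
    rect_in B t (t + d) (g t) (g t + b)) ->
  (forall t, t1 <= t <= t2 ->
    0 <= f (u t (g t + b)) - f (u t (g t))
         - f1 (u t (g t)) * (u t (g t + b) - u t (g t))) ->
  (U t2 (g t2 + b) - U t2 (g t2)) - (U t1 (g t1 + b) - U t1 (g t1))
    <= k2 * (b * (t2 - t1)) + (H t2 - H t1).
Proof.
move=> cl bal Hm Hg t12 b0 HB Hcvx.
pose psi t := (U t (g t + b) - U t (g t)) - H t.
suff : psi t2 - psi t1 <= (k2 * b) * (t2 - t1) by rewrite /psi; lra.
(* the increment of the strip integral, its two ends following g *)
have split_incr t : t1 <= t <= t2 -> forall e : R, 0 < e ->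
    exists2 d : R, 0 < d & forall s, t1 <= s <= t2 -> `|s - t| < d ->
    [/\ `|g s - g t| <= e,
        `|(U s (g t + b) - U s (g t)) - (U t (g t + b) - U t (g t))| <= e * b &
        `|(U s (g s + b) - U s (g s)) - (U s (g t + b) - U s (g t))
          - (u t (g t + b) - u t (g t)) * (g s - g t)| <= e * `|g s - g t|].
  move=> tt e e0.
  have [d1 d10 d1P] := primitive_local cl t (g t) (e / 2) ltac:(lra).
  have [d2 d20 d2P] := primitive_local cl t (g t + b) (e / 2) ltac:(lra).
  have [d3 d30 d3P] := primitive_tube cl t (g t) (g t + b) e ltac:(lra) e0.
  have [c1 [c10 c1d1 c1d2]] := pos_le2 d10 d20.
  have [c2 [c20 c2c1 c2e]] := pos_le2 c10 e0.
  have [d4 d40 d4P] := is_char_cont Hg t c2 tt c20.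
  have [c3 [c30 c3c1 c3d3]] := pos_le2 c10 d30.
  have [c4 [c40 c4c3 c4d4]] := pos_le2 c30 d40.
  exists c4 => // s st hs.
  have gs := d4P s st (lt_le_trans hs c4d4).
  have s1 := lt_le_trans hs (le_trans c4c3 c3c1); have g1 := lt_le_trans gs c2c1.
  split; first exact: le_trans (ltW gs) c2e.
    have := d3P s (lt_le_trans hs (le_trans c4c3 c3d3)); rewrite (_ : g t + b - g t = b)//; ring.
  have H1 := d1P s (g t) (g s) (lt_le_trans s1 c1d1) ltac:(by rewrite subrr normr0)
    (lt_le_trans g1 c1d1).
  have bb : g s + b - (g t + b) = g s - g t by ring.
  have := d2P s (g t + b) (g s + b) (lt_le_trans s1 c1d2) ltac:(by rewrite subrr normr0)
    ltac:(by rewrite bb (lt_le_trans g1)).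
  rewrite bb => H2.
  have -> : U s (g s + b) - U s (g s) - (U s (g t + b) - U s (g t)) -
    (u t (g t + b) - u t (g t)) * (g s - g t) =
    (U s (g s + b) - U s (g t + b) - u t (g t + b) * (g s - g t))
    - (U s (g s) - U s (g t) - u t (g t) * (g s - g t)) by ring.
  by apply: (le_trans (ler_normB _ _)); clear -H1 H2; lra.
(* No upward jump from the left: the strip integral is continuous in time and [- H] is
   nonincreasing. *)
apply: dini_le => //.
  move=> x /andP[tx xt] e e0.
  have xx : t1 <= x <= t2 by rewrite (ltW tx).
  pose Du := `|u x (g x + b) - u x (g x)|.
  have Du0 : 0 <= Du by rewrite /Du.
  have [e' [e'0 e'1 e'e]] : exists r, [/\ 0 < r, r <= 1 & r <= e / (b + Du + 1)].
    by apply: pos_le2 => //; apply: divr_gt0; lra.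
  have {}e'e : e' * (b + Du + 1) <= e by rewrite -ler_pdivlMr//; lra.
  have [d d0 dP] := split_incr x xx e' e'0.
  exists d => // y ty /andP[xy yx].
  have [] := dP y ltac:(by clear -ty yx xt; lra) ltac:(by clear -xy yx; rewrite ltr_norml; lra).
  set A := `|_ - _ - _ * _|; set G := `|g y - g x| => H1 H2 H3.
  have := Hm y x (ltW yx).
  have K : `|(u x (g x + b) - u x (g x)) * (g y - g x)| <= Du * e'.
    by rewrite normrM ler_wpM2l.
  have K2 : e' * G <= e' * 1 by rewrite ler_wpM2l ?(ltW e'0)//; exact: le_trans e'1.
  move: H2 K; rewrite ler_norml => /andP[H2 _]; rewrite ler_norml => /andP[K _].
  have := le_trans H3 K2; rewrite /A ler_norml => /andP[H4 _].
  rewrite /psi; clear -H2 K H4 e'e e'1 e'0 b0 Du0; lra.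
move=> x /andP[tx xt] e e0.
have xx : t1 <= x <= t2 by rewrite tx ltW.
set w := u x (g x); set w' := u x (g x + b).
pose N := 2 + `|w' - w| + `|f1 w|.
have N1 : 0 <= `|w' - w| by []. have N2 : 0 <= `|f1 w| by [].
have [e' [e'0 e'1 e'e]] : exists r, [/\ 0 < r, r <= 1 & r <= e / N].
  by apply: pos_le2 => //; apply: divr_gt0; rewrite /N; lra.
have {}e'e : e' * N <= e by rewrite -ler_pdivlMr// /N; lra.
have [d1 d10 d1P] := split_incr x xx e' e'0.
have [d2 d20 d2P] := Hg x e' xx e'0.
have [d3 d30 d3P] := cl_V cl x (g x) (e' / 2) ltac:(lra).
have [d4 d40 d4P] := cl_V cl x (g x + b) (e' / 2) ltac:(lra).
have [d5 d50 d5P] := HB x xx.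
have [c c0] := @pos_le_all R [:: d1; d2; d3; d4; d5] ltac:(by rewrite /= d10 d20 d30 d40 d50).
rewrite /= andbT => /and5P[cd1 cd2 cd3 cd4 cd5].
exists c => // y /andP[xy yx] yt.
have yx0 : 0 <= y - x by rewrite subr_ge0 ltW.
have nyx : `|y - x| = y - x by rewrite ger0_norm.
have yc : y - x < c by clear -yx; lra.
have ty : t1 <= y <= t2 by rewrite (le_trans tx (ltW xy)).
have [_ _] := d1P y ty ltac:(by rewrite nyx (lt_le_trans yc)); rewrite -/w -/w'.
have := d2P x y tx ltac:(by clear -d20; lra) (ltW xy) ltac:(by clear -yc cd2; lra) yt; rewrite -/w.
have := d3P (y - x) ltac:(by rewrite nyx (lt_le_trans yc)).
have := d4P (y - x) ltac:(by rewrite nyx (lt_le_trans yc)).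
rewrite (_ : x + (y - x) = y); last by ring.
rewrite nyx -/w -/w' => V1 V2 G1 U1.
have rin : rect_in B x y (g x) (g x + b).
  by move=> t z tt zz; apply: d5P => //; clear -tt yc cd5; lra.
have /andP[_] := bal x y (g x) (g x + b) (ltW xy) ltac:(by clear -b0; lra) rin.
rewrite (_ : g x + b - g x = b); last by ring.
rewrite /excess => EX.
have G2 : `|g y - g x| <= (`|f1 w| + 1) * (y - x).
  have -> : g y - g x = (g y - g x - f1 w * (y - x)) + f1 w * (y - x) by ring.
  apply: (le_trans (ler_normD _ _)); rewrite normrM nyx.
  have := ler_wpM2r yx0 e'1; move: G1; clear; lra.
have U2 : e' * `|g y - g x| <= e' * ((`|f1 w| + 1) * (y - x)).
  by rewrite ler_wpM2l// ltW.
have W : `|(w' - w) * (g y - g x - f1 w * (y - x))| <= `|w' - w| * (e' * (y - x)).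
  by rewrite normrM ler_wpM2l.
have CV := Hcvx x xx; rewrite -/w -/w' in CV.
have := mulr_ge0 yx0 CV => {}CV.
have EE := ler_wpM2r yx0 e'e.
move: V1 V2 U1 W; rewrite !ler_norml => /andP[V1 _] /andP[_ V2] /andP[_ U1] /andP[_ W].
rewrite /psi; rewrite /N in EE.
by clear -V1 V2 U1 W U2 CV EE EX G1 b0; lra.
Qed.

(** * Reflection in time and space *)

Lemma der_refl (R : realType) (phi : R -> R) (x d : R) :
  der phi (- x) d -> der (fun y => - phi (- y)) x d.
Proof.
move=> H e e0; have [r r0 rP] := H e e0; exists r => // h hr.
have := rP (- h); rewrite normrN => /(_ hr).
rewrite opprD (_ : - phi (- x - h) - - phi (- x) - h * d =
  - (phi (- x - h) - phi (- x) - - h * d)) ?normrN//; ring.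
Qed.

Definition even_refl (R : realType) (u : R -> R -> R) (t x : R) : R :=
  u (- t) (- x).

(** The sign keeps this a primitive of the reflected function, in [x] for [U] and in [t] for [V]. *)
Definition odd_refl (R : realType) (U : R -> R -> R) (t x : R) : R :=
  - U (- t) (- x).

Lemma cont2_refl (R : realType) (u : R -> R -> R) :
  cont2 u -> cont2 (even_refl u).
Proof.
move=> uc t x e e0; have [d d0 dP] := uc (- t) (- x) e e0; exists d => // t' x' ht hx.
by apply: dP; move: ht hx; rewrite !ltr_norml; lra.
Qed.

(* Reversing both variables reverses the sign of the source term, so that upper
   bounds along characteristics turn into lower bounds. *)
Lemma conslaw_refl (R : realType) (f f1 : R -> R) (u U V : R -> R -> R) :
  conslaw f f1 u U V ->
  conslaw f f1 (even_refl u) (odd_refl U) (odd_refl V).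
Proof.
move=> cl; split.
- by apply: cont2_refl; case: cl.
- by case: cl.
- by case: cl.
- by move=> t x; apply: der_refl; exact: cl_U cl _ _.
- by move=> t x; apply: (@der_refl _ (V ^~ (- x))); exact: cl_V cl _ _.
Qed.

Lemma balance_refl (R : realType) (B : R -> R -> Prop) (U V : R -> R -> R)
    (k1 k2 : R) (H : R -> R) :
  balance B U V k1 k2 H ->
  balance (fun t x => B (- t) (- x)) (odd_refl U) (odd_refl V) (- k2) (- k1)
    (fun t => - H (- t)).
Proof.
move=> bal t1 t2 a b t12 ab rin.
have := bal (- t2) (- t1) (- b) (- a) ltac:(lra) ltac:(lra).
have rin' : rect_in B (- t2) (- t1) (- b) (- a).
  move=> t x ht hx; have := rin (- t) (- x) ltac:(lra) ltac:(lra).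
  by rewrite !opprK.
move=> /(_ rin'); rewrite /excess /odd_refl => /andP[h1 h2].
apply/andP; split; lra.
Qed.

Lemma is_char_refl (R : realType) (f1 : R -> R) (u : R -> R -> R) (g : R -> R)
    (t1 t2 : R) : is_char f1 u g t1 t2 ->
  is_char f1 (even_refl u) (fun t => - g (- t)) (- t2) (- t1).
Proof.
move=> Hg t e ht e0.
have [d d0 dP] := Hg (- t) e ltac:(lra) e0.
exists d => // s s' h1 h2 h3 h4 h5.
have := dP (- s') (- s) ltac:(lra) ltac:(lra) ltac:(lra) ltac:(lra) ltac:(lra).
rewrite /even_refl !opprK (_ : - s + s' = s' - s); last by ring.
by congr (`|_| <= _); ring.
Qed.

Lemma is_char_sub (R : realType) (f1 : R -> R) (u : R -> R -> R) (g : R -> R)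
    (t1 t2 s1 s2 : R) : is_char f1 u g t1 t2 -> t1 <= s1 -> s2 <= t2 ->
  is_char f1 u g s1 s2.
Proof.
move=> Hg h1 h2 t e ht e0; have [d d0 dP] := Hg t e ltac:(lra) e0.
by exists d => // s s' ? ? ? ? ?; apply: dP => //; lra.
Qed.

Definition convex_on (R : realType) (J : R -> Prop) (f f1 : R -> R) : Prop :=
  forall a b, J a -> J b -> 0 <= f b - f a - f1 a * (b - a).

(** Dividing the strip inequality by the width [b] and letting [b] tend to 0 turns strip integrals
    into values on the characteristic. This is done on short time intervals, where one neighbourhood
    of a point of the curve contains the whole strip, and [dini_le] joins them. *)
Lemma char_lip_up (R : realType) (f f1 : R -> R) (u U V : R -> R -> R)
    (B : R -> R -> Prop) (J : R -> Prop) (k1 k2 : R) (g : R -> R) (t1 t2 : R) :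
  conslaw f f1 u U V -> balance B U V k1 k2 (fun=> 0) -> convex_on J f f1 ->
  is_char f1 u g t1 t2 -> t1 <= t2 ->
  (forall t, t1 <= t <= t2 -> exists2 d : R, 0 < d & forall t' x',
     `|t' - t| < d -> `|x' - g t| < d -> B t' x' /\ J (u t' x')) ->
  u t2 (g t2) - u t1 (g t1) <= k2 * (t2 - t1).
Proof.
move=> cl bal Jc Hg t12 Hloc.
apply: (@dini_le R (fun t => u t (g t))) => //.
  move=> x /andP[tx xt] e e0.
  have [d d0 dP] := value_cont (cl_cont cl) Hg x e ltac:(lra) e0.
  exists d => // y ty /andP[xy yx].
  by have := dP y ltac:(lra) ltac:(rewrite ltr_norml; lra); rewrite ltr_norml; lra.
move=> x /andP[tx xt] e e0.
have xx : t1 <= x <= t2 by rewrite tx ltW.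
have [d d0 dP] := Hloc x xx.
have dh : 0 < d / 2 by rewrite divr_gt0.
have [d' d'0 d'P] := is_char_cont Hg x (d / 2) xx dh.
have [r [r0 r1 r2]] := pos_le2 dh d'0.
exists r => // y /andP[xy yx] yt.
apply: (@le_trans _ _ (k2 * (y - x))); last first.
  by rewrite ler_wpM2r ?subr_ge0 ?(ltW xy)//; clear -e0; lra.
apply/ler_addgt0Pr => e2 e20.
have [d1 d10 d1P] := cl_U cl y (g y) (e2 / 2) ltac:(lra).
have [d2 d20 d2P] := cl_U cl x (g x) (e2 / 2) ltac:(lra).
have [c [c0 cd1 cd2]] := pos_le2 d10 d20.
have [c' [c'0 c'c c'd]] := pos_le2 c0 dh.
pose b := c' / 2; have b0 : 0 < b by rewrite divr_gt0.
have near t : x <= t <= y -> `|g t - g x| < d / 2 /\ `|t - x| < d / 2.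
  move=> ht; split.
    by clear -d'P ht tx yt yx r2; apply: d'P; [lra|rewrite ltr_norml; lra].
  by clear -ht yx r1 r0; rewrite ltr_norml; lra.
have HB t : x <= t <= y -> exists2 d3 : R, 0 < d3 & rect_in B t (t + d3) (g t) (g t + b).
  move=> ht; have [n1 n2] := near t ht.
  exists (d / 4); first by clear -d0; lra.
  move=> t' x' ht' hx'; move: n1 n2; rewrite !ltr_norml /b in hx' * => n1 n2.
  by apply: (dP t' x' _ _).1; rewrite ltr_norml; clear -n1 n2 ht' hx' c'd d0; lra.
have HC t : x <= t <= y -> 0 <= f (u t (g t + b)) - f (u t (g t)) -
    f1 (u t (g t)) * (u t (g t + b) - u t (g t)).
  move=> ht; have [n1 n2] := near t ht.
  have nt : `|t - x| < d by clear -n2 d0; lra.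
  apply: Jc; apply: (dP _ _ nt _).2; first by clear -n1 d0; lra.
  by move: n1; rewrite !ltr_norml /b; clear -c'0 c'd d0; lra.
have := @strip_le R f f1 u U V B k1 k2 (fun=> 0) g x y b cl bal
  (fun _ _ _ => lexx _) (is_char_sub Hg tx yt) (ltW xy) b0 HB HC.
rewrite subrr addr0 => P.
have nb : `|b| = b by rewrite gtr0_norm.
have := d1P b ltac:(by rewrite nb /b; clear -c'0 c'c cd1; lra).
have := d2P b ltac:(by rewrite nb /b; clear -c'0 c'c cd2; lra).
rewrite nb !ler_norml => /andP[_ H2] /andP[H1 _].
have : b * (u y (g y) - u x (g x)) <= b * (k2 * (y - x) + e2) by clear -P H1 H2; lra.
by rewrite ler_pM2l.
Qed.

(** The lower bound is the upper one for the reflected solution, whose strips to the right of a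
    characteristic are strips to the left of the original one. *)
Lemma char_lip (R : realType) (f f1 : R -> R) (u U V : R -> R -> R)
    (B : R -> R -> Prop) (J : R -> Prop) (k1 k2 : R) (g : R -> R) (t1 t2 : R) :
  conslaw f f1 u U V -> balance B U V k1 k2 (fun=> 0) -> convex_on J f f1 ->
  is_char f1 u g t1 t2 -> t1 <= t2 ->
  (forall t, t1 <= t <= t2 -> exists2 d : R, 0 < d & forall t' x',
     `|t' - t| < d -> `|x' - g t| < d -> B t' x' /\ J (u t' x')) ->
  k1 * (t2 - t1) <= u t2 (g t2) - u t1 (g t1) <= k2 * (t2 - t1).
Proof.
move=> cl bal Jc Hg t12 Hloc; apply/andP; split; last first.
  exact: (char_lip_up cl bal Jc Hg).
have bal' := balance_refl bal; rewrite oppr0 in bal'.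
have := char_lip_up (conslaw_refl cl) bal' Jc (is_char_refl Hg).
rewrite /even_refl !opprK => H.
suff : u t1 (g t1) - u t2 (g t2) <= - k1 * (- t1 + t2) by lra.
apply: H; first by lra.
move=> t ht; have [d d0 dP] := Hloc (- t) ltac:(lra); exists d => // t' x' h1 h2.
by apply: dP; move: h1 h2; rewrite !ltr_norml; lra.
Qed.

Definition strongly_increasing (R : realType) (f1 : R -> R) (m p q : R) : Prop :=
  forall a b, p < a -> a <= b -> b < q -> m * (b - a) <= f1 b - f1 a.

Lemma strongly_increasing_convex (R : realType) (f f1 : R -> R) (m p q : R) :
  0 <= m -> (forall w, der f w (f1 w)) -> strongly_increasing f1 m p q ->
  convex_on (fun w => p < w < q) f f1.
Proof.
move=> m0 fd Hm a b /andP[pa aq] /andP[pb bq].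
have mono x y : p < x -> x <= y -> y < q -> f1 x <= f1 y.
  move=> h1 h2 h3; have := Hm x y h1 h2 h3.
  have : 0 <= m * (y - x) by rewrite mulr_ge0// subr_ge0.
  lra.
(* Between [x] and [y] the derivative [f1] is within half its increment of the mean of its end
   values; the two halves of this estimate are the tangent inequalities at [x] and at [y]. *)
have bd x y : p < x -> y < q -> x <= y ->
    `|f y - f x - (f1 x + f1 y) / 2 * (y - x)| <= (f1 y - f1 x) / 2 * (y - x).
  move=> px yq xy; apply: (@der_mvt R f f1) => // z /andP[xz zy].
  have := mono x z px xz ltac:(lra); have := mono z y ltac:(lra) zy yq.
  by rewrite ler_norml; lra.
have [ab|/ltW ba] := leP a b.
  by have := bd a b pa bq ab; rewrite ler_norml; lra.
by have := bd b a pb aq ba; rewrite ler_norml; lra.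
Qed.

(** A bootstrap: the Lipschitz bound needs values in the range of convexity, and it is this bound
    that keeps them there. Real induction extends both together. *)
Lemma char_stay (R : realType) (f f1 : R -> R) (u U V : R -> R -> R)
    (B : R -> R -> Prop) (M p q : R) (g : R -> R) (t1 t2 : R) :
  conslaw f f1 u U V -> balance B U V (- M) M (fun=> 0) -> 0 <= M ->
  convex_on (fun w => p < w < q) f f1 ->
  is_char f1 u g t1 t2 ->
  (forall t, t1 <= t <= t2 -> exists2 d : R, 0 < d & forall t' x',
     `|t' - t| < d -> `|x' - g t| < d -> B t' x') ->
  p < u t1 (g t1) - M * (t2 - t1) -> u t1 (g t1) + M * (t2 - t1) < q ->
  forall t, t1 <= t <= t2 -> `|u t (g t) - u t1 (g t1)| <= M * (t - t1).
Proof.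
move=> cl bal M0 Jc Hg HB Hp Hq.
pose P t := `|u t (g t) - u t1 (g t1)| <= M * (t - t1).
apply: (@real_induction R t1 t2 P); rewrite /P.
- by rewrite !subrr mulr0 normr0.
- move=> x /andP[tx xt] Px.
  have xx : t1 <= x <= t2 by rewrite tx ltW.
  have Jx s : t1 <= s <= x -> p < u s (g s) < q.
    move=> hs; have := Px s hs.
    have : M * (s - t1) <= M * (t2 - t1) by rewrite ler_wpM2l//; lra.
    by rewrite ler_norml; lra.
  have Jx' := Jx x ltac:(lra).
  have [k [k0 k1 k2]] : exists r, [/\ 0 < r, r <= u x (g x) - p & r <= q - u x (g x)].
    by apply: pos_le2; lra.
  have [d d0 dP] := cl_cont cl x (g x) k k0.
  have dh : 0 < d / 2 by rewrite divr_gt0.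
  have [d' d'0 d'P] := is_char_cont Hg x (d / 2) xx dh.
  have [r [r0 r1 r2]] := pos_le2 dh d'0.
  have [r' [r'0 r'1 r'2]] : exists r', [/\ 0 < r', r' <= r & r' <= t2 - x].
    by apply: pos_le2 => //; rewrite subr_gt0.
  exists r' => // y /andP[xy yr].
  have HL t : x <= t <= y -> exists2 d : R, 0 < d & forall t' x',
     `|t' - t| < d -> `|x' - g t| < d -> B t' x' /\ p < u t' x' < q.
    move=> ht; have [d3 d30 d3P] := HB t ltac:(by clear -ht tx yr r'2; lra).
    have [r3 [r30 r31 r32]] := pos_le2 dh d30.
    exists r3 => // t' x' h1 h2; split.
      by apply: d3P; [exact: lt_le_trans h1 r32|exact: lt_le_trans h2 r32].
    have : `|u t' x' - u x (g x)| < k.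
      apply: dP; first by move: h1; rewrite !ltr_norml; clear -ht yr r'1 r1 r31 d0; lra.
      have := d'P t ltac:(by clear -ht tx yr r'2; lra)
        ltac:(by clear -ht yr r'1 r2 r'0; rewrite ltr_norml; lra).
      by move: h2; rewrite !ltr_norml; clear -r31; lra.
    by clear -k1 k2; rewrite ltr_norml; lra.
  have yt2 : y <= t2 by clear -yr r'2; lra.
  have := char_lip cl bal Jc (is_char_sub Hg tx yt2) (ltW xy) HL.
  have := Px x; rewrite lexx tx !ler_norml => /(_ isT); lra.
- move=> x /andP[tx xt] Px; apply/ler_addgt0Pr => e e0.
  have [d d0 dP] := value_cont (cl_cont cl) Hg x e ltac:(lra) e0.
  have [r [r0 r1 r2]] : exists r, [/\ 0 < r, r <= d & r <= x - t1].
    by apply: pos_le2; lra.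
  have := Px (x - r / 2) ltac:(lra).
  have := dP (x - r / 2) ltac:(lra) ltac:(rewrite ltr_norml; lra).
  have : M * (x - r / 2 - t1) <= M * (x - t1) by rewrite ler_wpM2l//; lra.
  rewrite !ler_norml !ltr_norml; lra.
Qed.

Lemma char_exists (R : realType) (f f1 : R -> R) (u U V : R -> R -> R) (L t0 x0 : R) :
  conslaw f f1 u U V -> (forall t x, `|f1 (u t x)| <= L) ->
  exists g : R -> R, [/\ g t0 = x0,
    forall s s', t0 <= s <= s' -> `|g s' - g s| <= L * (s' - s) &
    forall T, is_char f1 u g t0 T].
Proof.
move=> cl HL.
have Fc : cont2 (fun t x => f1 (u t x)).
  move=> t x e e0.
  have [d d0 dP] := cl_f1 cl (u t x) e e0.
  have [d' d'0 d'P] := cl_cont cl t x d d0.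
  by exists d' => // t' x' h1 h2; apply: dP; exact: d'P.
have [g [g0 gL gP]] := @peano R _ L t0 x0 Fc HL.
exists g; split=> // T t e /andP[tt _] e0.
have [d d0 dP] := gP t e tt e0; exists d => // s s' h1 h2 h3 h4 _.
exact: dP.
Qed.
(** * Hoelder bounds from colliding characteristics *)

Definition box (R : realType) (tc xc rho t x : R) : Prop :=
  `|t - tc| < rho /\ `|x - xc| < rho.

Lemma box_open (R : realType) (tc xc rho t x : R) : box tc xc rho t x ->
  exists2 d : R, 0 < d & forall t' x', `|t' - t| < d -> `|x' - x| < d ->
    box tc xc rho t' x'.
Proof.
move=> [h1 h2].
have [r [r0 r1 r2]] : exists r, [/\ 0 < r, r <= rho - `|t - tc| & r <= rho - `|x - xc|].
  by apply: pos_le2; lra.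
exists r => // t' x' h3 h4; split.
  rewrite (_ : t' - tc = (t' - t) + (t - tc)); last by ring.
  by apply: (le_lt_trans (ler_normD _ _)); lra.
rewrite (_ : x' - xc = (x' - x) + (x - xc)); last by ring.
by apply: (le_lt_trans (ler_normD _ _)); lra.
Qed.

Lemma char_incr (R : realType) (f1 : R -> R) (u : R -> R -> R) (g : R -> R)
    (t1 t2 c e : R) :
  is_char f1 u g t1 t2 -> t1 <= t2 ->
  (forall t, t1 <= t <= t2 -> `|f1 (u t (g t)) - c| <= e) ->
  `|g t2 - g t1 - c * (t2 - t1)| <= e * (t2 - t1).
Proof.
move=> Hg t12 Hc.
have up : (g t2) - (g t1) <= (c + e) * (t2 - t1).
  apply: dini_le => //.
    move=> x /andP[tx xt] e' e'0.
    have [d d0 dP] := is_char_cont Hg x e' ltac:(lra) e'0.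
    exists d => // y ty /andP[xy yx].
    by have := dP y ltac:(lra) ltac:(rewrite ltr_norml; lra); rewrite ltr_norml; lra.
  move=> x /andP[tx xt] e' e'0.
  have xx : t1 <= x <= t2 by lra.
  have [d d0 dP] := Hg x e' xx e'0; exists d => // y /andP[xy yx] yt.
  have := dP x y tx ltac:(lra) ltac:(lra) yx yt; rewrite ler_norml => /andP[_ H].
  have := Hc x xx; rewrite ler_norml => /andP[_ Hx].
  have := ler_wpM2r (_ : 0 <= y - x) Hx; rewrite subr_ge0 (ltW xy) => /(_ isT); lra.
have dn : (- g t2) - (- g t1) <= (- c + e) * (t2 - t1).
  apply: (@dini_le R (fun t => - g t)) => //.
    move=> x /andP[tx xt] e' e'0.
    have [d d0 dP] := is_char_cont Hg x e' ltac:(lra) e'0.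
    exists d => // y ty /andP[xy yx].
    by have := dP y ltac:(lra) ltac:(rewrite ltr_norml; lra); rewrite ltr_norml; lra.
  move=> x /andP[tx xt] e' e'0.
  have xx : t1 <= x <= t2 by lra.
  have [d d0 dP] := Hg x e' xx e'0; exists d => // y /andP[xy yx] yt.
  have := dP x y tx ltac:(lra) ltac:(lra) yx yt; rewrite ler_norml => /andP[H _].
  have := Hc x xx; rewrite ler_norml => /andP[Hx _].
  have := ler_wpM2r (_ : 0 <= y - x) Hx; rewrite subr_ge0 (ltW xy) => /(_ isT); lra.
rewrite ler_norml; lra.
Qed.

(* Where two characteristics meet, they carry the same value: as long as the
   values are apart and the left one is faster, the distance decreases but
   cannot vanish. *)
Lemma chars_ordered (R : realType) (f f1 : R -> R) (u U V : R -> R -> R)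
    (g1 g2 : R -> R) (t1 t2 m p q d : R) :
  conslaw f f1 u U V -> is_char f1 u g1 t1 t2 -> is_char f1 u g2 t1 t2 ->
  strongly_increasing f1 m p q -> 0 <= m -> 0 < d -> t1 <= t2 ->
  (forall t, t1 <= t <= t2 -> p < u t (g2 t) /\ u t (g1 t) < q) ->
  (forall t, t1 <= t <= t2 -> u t (g2 t) + d <= u t (g1 t)) ->
  g1 t1 < g2 t1 -> m * d * (t2 - t1) <= g2 t1 - g1 t1.
Proof.
move=> cl H1 H2 Hm m0 d0 t12 Hpq Hd g12.
have ct t : t1 <= t <= t2 -> forall e : R, 0 < e -> exists2 r : R, 0 < r &
    forall s, t1 <= s <= t2 -> `|s - t| < r ->
    `|(g2 s - g1 s) - (g2 t - g1 t)| < e.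
  move=> tt e e0.
  have [r1 r10 r1P] := is_char_cont H1 t (e / 2) tt ltac:(lra).
  have [r2 r20 r2P] := is_char_cont H2 t (e / 2) tt ltac:(lra).
  have [r [r0 ? ?]] := pos_le2 r10 r20.
  exists r => // s st hs.
  rewrite (_ : g2 s - g1 s - (g2 t - g1 t) = (g2 s - g2 t) - (g1 s - g1 t)); last by ring.
  apply: (le_lt_trans (ler_normB _ _)).
  by have := r1P s st ltac:(lra); have := r2P s st ltac:(lra); lra.
have pos : forall t, t1 <= t <= t2 -> 0 < g2 t - g1 t.
  apply: (@real_induction R t1 t2 (fun t => 0 < g2 t - g1 t)).
  - by rewrite subr_gt0.
  - move=> x xx Px; have Px' := Px x ltac:(lra).
    have [r r0 rP] := ct x ltac:(lra) _ Px'.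
    have [r' [r'0 hr1 hr2]] : exists r', [/\ 0 < r', r' <= r & r' <= t2 - x].
      by apply: pos_le2; lra.
    exists r' => // y yy; clear -rP yy hr1 hr2 xx.
    by have := rP y ltac:(lra) ltac:(rewrite ltr_norml; lra); rewrite ltr_norml; lra.
  - move=> x xx Px.
    have ne : g2 x - g1 x != 0.
      apply/eqP => E; have := Hd x ltac:(lra).
      by rewrite (_ : g2 x = g1 x); lra.
    rewrite lt_neqAle eq_sym ne /=; apply/ler_addgt0Pr => e e0.
    have [r r0 rP] := ct x ltac:(lra) _ e0.
    have [r' [r'0 ? ?]] : exists r', [/\ 0 < r', r' <= r & r' <= x - t1].
      by apply: pos_le2; lra.
    have := Px (x - r' / 2) ltac:(lra).
    by have := rP (x - r' / 2) ltac:(lra) ltac:(rewrite ltr_norml; lra);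
      rewrite ltr_norml; lra.
have := pos t2 ltac:(lra).
suff : (g2 t2 - g1 t2) - (g2 t1 - g1 t1) <= (- (m * d)) * (t2 - t1) by lra.
apply: (@dini_le R (fun t => g2 t - g1 t)) => //.
  move=> x xx e e0; have [r r0 rP] := ct x ltac:(lra) _ e0; exists r => // y ty yx.
  by have := rP y ltac:(lra) ltac:(rewrite ltr_norml; lra); rewrite ltr_norml; lra.
move=> x xx e e0.
have xx' : t1 <= x <= t2 by lra.
have [r1 r10 r1P] := H1 x (e / 2) xx' ltac:(lra).
have [r2 r20 r2P] := H2 x (e / 2) xx' ltac:(lra).
have [r [r0 rr1 rr2]] := pos_le2 r10 r20.
exists r => // y yy yt.
have [tx xy yr] : [/\ t1 <= x, x <= y & y < x + r] by clear -xx' yy; split; lra.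
have := r1P x y tx ltac:(by clear -r10; lra) xy ltac:(by clear -yr rr1; lra) yt.
have := r2P x y tx ltac:(by clear -r20; lra) xy ltac:(by clear -yr rr2; lra) yt.
rewrite !ler_norml => /andP[_ E2] /andP[E1 _].
have [P1 P2] := Hpq x xx'; have D := Hd x xx'.
have S := Hm _ _ P1 (_ : u x (g2 x) <= u x (g1 x)) P2.
have {}S := S ltac:(by clear -D d0; lra).
have S2 : m * d <= f1 (u x (g1 x)) - f1 (u x (g2 x)).
  by apply: le_trans S; rewrite ler_wpM2l//; clear -D; lra.
have yx0 : 0 <= y - x by rewrite subr_ge0.
by have := ler_wpM2r yx0 S2; clear -E1 E2; lra.
Qed.

Lemma char_in_box (R : realType) (tc xc rho t0 x0 T L : R) (g : R -> R) :
  `|t0 - tc| <= rho / 2 -> `|x0 - xc| <= rho / 2 -> 0 <= L -> 0 <= T ->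
  T * (L + 1) < rho / 2 -> g t0 = x0 ->
  (forall s s', t0 <= s <= s' -> `|g s' - g s| <= L * (s' - s)) ->
  forall t, t0 <= t <= t0 + T -> box tc xc rho t (g t).
Proof.
move=> h1 h2 L0 T0 hT g0 gL t ht.
have H := gL t0 t ltac:(lra).
have H2 : L * (t - t0) <= L * T by rewrite ler_wpM2l//; lra.
have H3 : 0 <= L * T by rewrite mulr_ge0.
move: h1 h2 H; rewrite g0 !ler_norml => h1 h2 H.
by split; rewrite ltr_norml; lra.
Qed.

(** During the time [T = d / (4 * M)] each value moves by at most [d / 4], so the gap stays above
    [d / 2] and the characteristics approach at speed at least [m * d / 2]. As they cannot meet,
    [m * (d / 2) * T <= x2 - x1]. The bound on [d * (L + 1)] keeps them in the box until then. *)
Lemma collide (R : realType) (f f1 : R -> R) (u U V : R -> R -> R)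
    (tc xc rho M L m p q t x1 x2 : R) :
  conslaw f f1 u U V -> balance (box tc xc rho) U V (- M) M (fun=> 0) -> 0 < M ->
  (forall t x, `|f1 (u t x)| <= L) -> 0 <= m -> strongly_increasing f1 m p q ->
  `|t - tc| <= rho / 2 -> `|x1 - xc| <= rho / 2 -> `|x2 - xc| <= rho / 2 ->
  x1 < x2 -> u t x2 < u t x1 ->
  let d := u t x1 - u t x2 in
  p < u t x2 - d / 4 -> u t x1 + d / 4 < q -> d * (L + 1) < 2 * M * rho ->
  m * d ^+ 2 <= 8 * M * (x2 - x1).
Proof.
move=> cl bal M0 HL m0 Hm ht h1 h2 x12 w12 d Hp Hq HdL.
have L0 : 0 <= L by apply: le_trans (HL 0 0).
have d0 : 0 < d by rewrite /d; lra.
pose T := d / (4 * M).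
have T0 : 0 < T by apply: divr_gt0; lra.
have TE : M * T = d / 4 by rewrite /T; field; lra.
have TL : T * (L + 1) < rho / 2.
  rewrite -(ltr_pM2l M0) mulrA TE.
  lra.
have [g1 [g10 g1L g1c]] := char_exists t x1 cl HL.
have [g2 [g20 g2L g2c]] := char_exists t x2 cl HL.
have B1 := char_in_box ht h1 L0 (ltW T0) TL g10 g1L.
have B2 := char_in_box ht h2 L0 (ltW T0) TL g20 g2L.
have Jc := strongly_increasing_convex m0 (cl_f cl) Hm.
have TT : t + T - t = T by ring.
have st1 := @char_stay R f f1 u U V _ M p q g1 t (t + T) cl bal (ltW M0) Jc (g1c _)
  (fun s hs => box_open (B1 s hs)).
rewrite g10 TT TE in st1; have {}st1 := st1 ltac:(by clear -Hp w12; rewrite /d in Hp *; lra) ltac:(by clear -Hq; lra).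
have st2 := @char_stay R f f1 u U V _ M p q g2 t (t + T) cl bal (ltW M0) Jc (g2c _)
  (fun s hs => box_open (B2 s hs)).
rewrite g20 TT TE in st2; have {}st2 := st2 ltac:(by clear -Hp; lra) ltac:(by clear -Hq w12; rewrite /d in Hq *; lra).
have bnd s : t <= s <= t + T -> M * (s - t) <= d / 4.
  by move=> hs; rewrite -TE ler_pM2l//; lra.
have := @chars_ordered R f f1 u U V g1 g2 t (t + T) m p q (d / 2) cl
  (g1c _) (g2c _) Hm m0.
rewrite g10 g20 TT => H.
have {}H : m * (d / 2) * T <= x2 - x1.
  apply: H => //; [by rewrite divr_gt0|by clear -T0; lra| |].
  - move=> s hs; have := st1 s hs; have := st2 s hs; have := bnd s hs.
    rewrite !ler_norml; clear -Hp Hq; lra.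
  - move=> s hs; have := st1 s hs; have := st2 s hs; have := bnd s hs.
    rewrite !ler_norml /d; clear; lra.
have := ler_wpM2l (_ : 0 <= 8 * M) H.
rewrite mulr_ge0 ?(ltW M0)// => /(_ isT); apply: le_trans.
rewrite (_ : 8 * M * (m * (d / 2) * T) = 4 * m * d * (M * T)); last by field.
by rewrite TE expr2 le_eqVlt; apply/orP; left; apply/eqP; field.
Qed.

Lemma holder_between (R : realType) (f f1 : R -> R) (u U V : R -> R -> R)
    (tc xc rho M L m p q t x1 x2 : R) :
  conslaw f f1 u U V -> balance (box tc xc rho) U V (- M) M (fun=> 0) -> 0 < M ->
  (forall t x, `|f1 (u t x)| <= L) -> 0 <= m -> strongly_increasing f1 m p q ->
  `|t - tc| <= rho / 2 -> `|x1 - xc| <= rho / 2 -> `|x2 - xc| <= rho / 2 ->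
  let d := `|u t x1 - u t x2| in
  p < u t x1 - d / 4 -> p < u t x2 - d / 4 ->
  u t x1 + d / 4 < q -> u t x2 + d / 4 < q -> d * (L + 1) < 2 * M * rho ->
  m * d ^+ 2 <= 8 * M * `|x1 - x2|.
Proof.
move=> cl bal M0 HL m0 Hm ht.
wlog x12 : x1 x2 / x1 <= x2 => [W|].
  have [|/ltW ba] := leP x1 x2; first exact: W.
  move=> h1 h2 /= a b c d; rewrite (distrC x1) (distrC (u t x1)).
  by apply: W => //; rewrite (distrC (u t x2)).
move=> h1 h2 /=.
have [->|nx] := eqVneq x1 x2; first by rewrite !subrr !normr0 expr0n/= !mulr0.
have {nx}x12 : x1 < x2 by rewrite lt_neqAle nx.
have [->|nw] := eqVneq (u t x1) (u t x2).
  by rewrite subrr normr0 expr0n/= !mulr0 => *; rewrite !mulr_ge0// ltW.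
have -> : `|x1 - x2| = x2 - x1 by rewrite distrC gtr0_norm// subr_gt0.
have [w12|w12] := ltP (u t x2) (u t x1).
  rewrite gtr0_norm ?subr_gt0// => p1 p2 q1 q2 HdL.
  exact: (collide cl bal M0 HL m0 Hm ht h1 h2).
have {nw}w12 : u t x1 < u t x2 by rewrite lt_neqAle nw.
rewrite distrC gtr0_norm ?subr_gt0// => p1 p2 q1 q2 HdL.
(* For values increasing in [x] the characteristics collide backward in time; the reflection
   exchanges the order of the points and makes this a forward collision. *)
have bal' := balance_refl bal; rewrite oppr0 opprK in bal'.
have {}bal' : balance (box (- tc) (- xc) rho) (odd_refl U) (odd_refl V) (- M) M (fun=> 0).
  move=> t1 t2 a b h3 h4 h5; apply: bal' => // s y hs hy.
  have [] := h5 s y hs hy; rewrite !opprK => e1 e2.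
  split; first by rewrite -normrN opprB addrC opprK.
  by rewrite -normrN opprB addrC opprK.
have := @collide R f f1 _ _ _ (- tc) (- xc) rho M L m p q (- t) (- x2) (- x1)
  (conslaw_refl cl) bal' M0.
rewrite /even_refl !opprK; rewrite (_ : - x1 + x2 = x2 - x1); last by ring.
apply => //.
- by rewrite -normrN opprD !opprK.
- by rewrite -normrN opprD !opprK.
- by rewrite -normrN opprD !opprK.
- by rewrite ltrN2.
Qed.
(** The values of [u] stay within [de] of [c] while convexity holds within [2 * de]: increments are
    below [2 * de], and the quarter of an increment lost along characteristics still fits.
    [cs_small] keeps the characteristics used in [cs_holder] inside the box. The function [u] is
    controlled on the whole plane, the equation only in the box. *)
Record convex_sol (R : realType) (tc xc rho M L m m2 c de : R) (f f1 : R -> R)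
    (u U V : R -> R -> R) : Prop := {
  cs_cl : conslaw f f1 u U V;
  cs_bal : balance (box tc xc rho) U V (- M) M (fun=> 0);
  cs_M : 0 < M;
  cs_rho : 0 < rho;
  cs_m : 0 < m;
  cs_L : forall t x, `|f1 (u t x)| <= L;
  cs_inc : strongly_increasing f1 m (c - 2 * de) (c + 2 * de);
  cs_lip : forall a b, c - 2 * de < a < c + 2 * de -> c - 2 * de < b < c + 2 * de ->
    `|f1 a - f1 b| <= m2 * `|a - b|;
  cs_u : forall t x, `|u t x - c| < de;
  cs_small : de * (L + 1) <= M * rho
}.

Lemma box_refl (R : realType) (tc xc rho t x : R) :
  box tc xc rho (- t) (- x) -> box (- tc) (- xc) rho t x.
Proof.
by move=> [h1 h2]; split; rewrite -normrN opprB addrC.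
Qed.

Lemma balance_sub (R : realType) (B B' : R -> R -> Prop) (U V : R -> R -> R)
    (k1 k2 : R) (H : R -> R) :
  (forall t x, B t x -> B' t x) -> balance B' U V k1 k2 H -> balance B U V k1 k2 H.
Proof.
move=> BB bal t1 t2 a b h1 h2 rin; apply: bal => // t x ht hx.
by apply: BB; exact: rin.
Qed.

Lemma convex_sol_refl (R : realType) (tc xc rho M L m m2 c de : R) (f f1 : R -> R)
    (u U V : R -> R -> R) :
  convex_sol tc xc rho M L m m2 c de f f1 u U V ->
  convex_sol (- tc) (- xc) rho M L m m2 c de f f1
    (even_refl u) (odd_refl U) (odd_refl V).
Proof.
move=> cs; split; try by case: cs.
- exact: conslaw_refl (cs_cl cs).
- have := balance_refl (cs_bal cs); rewrite oppr0 opprK; apply: balance_sub => t x.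
  move=> h; rewrite -[tc]opprK -[xc]opprK; apply: box_refl; rewrite !opprK//.
- by move=> t x; apply: (cs_L cs).
- by move=> t x; apply: (cs_u cs).
Qed.

Section convex_sol_theory.
Variables (R : realType) (tc xc rho M L m m2 c de : R) (f f1 : R -> R).
Variables (u U V : R -> R -> R).
Hypothesis cs : convex_sol tc xc rho M L m m2 c de f f1 u U V.

Lemma cs_range t x : c - 2 * de < u t x < c + 2 * de.
Proof. by have := cs_u cs t x; rewrite ltr_norml; lra. Qed.

Lemma cs_L_ge0 : 0 <= L.
Proof. by apply: le_trans (cs_L cs 0 0). Qed.

Lemma cs_convex : convex_on (fun w => c - 2 * de < w < c + 2 * de) f f1.
Proof.
exact: strongly_increasing_convex (ltW (cs_m cs)) (cl_f (cs_cl cs)) (cs_inc cs).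
Qed.

Lemma cs_holder t x1 x2 :
  `|t - tc| <= rho / 2 -> `|x1 - xc| <= rho / 2 -> `|x2 - xc| <= rho / 2 ->
  m * `|u t x1 - u t x2| ^+ 2 <= 8 * M * `|x1 - x2|.
Proof.
move=> ht h1 h2.
have d2 : `|u t x1 - u t x2| < 2 * de.
  have := cs_u cs t x1; have := cs_u cs t x2.
  rewrite (_ : u t x1 - u t x2 = (u t x1 - c) - (u t x2 - c)); last by ring.
  by move=> a b; apply: (le_lt_trans (ler_normB _ _)); lra.
have := cs_u cs t x1; have := cs_u cs t x2; rewrite !ltr_norml => a b.
apply: (@holder_between R f f1 u U V tc xc rho M L m (c - 2 * de) (c + 2 * de)) => //;
  [exact: cs_cl cs|exact: cs_bal cs|exact: cs_M cs|exact: cs_L cs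
  |exact: ltW (cs_m cs)|exact: cs_inc cs| | | | |]; try lra.
have := cs_small cs.
have := cs_L_ge0 => L0.
have : `|u t x1 - u t x2| * (L + 1) < 2 * de * (L + 1) by rewrite ltr_pM2r//; lra.
lra.
Qed.

Lemma cs_char_lip g t1 t2 : is_char f1 u g t1 t2 -> t1 <= t2 ->
  (forall t, t1 <= t <= t2 -> box tc xc rho t (g t)) ->
  `|u t2 (g t2) - u t1 (g t1)| <= M * (t2 - t1).
Proof.
move=> Hg t12 HB.
have := char_lip (cs_cl cs) (cs_bal cs) cs_convex Hg t12.
rewrite mulNr -ler_norml; apply => t ht.
have [d d0 dP] := box_open (HB t ht); exists d => // t' x' h1 h2.
split; [exact: dP | exact: cs_range].
Qed.

(** Follow a characteristic from [(t0, x0)] up to time [t]: the value changes by at most [M * r], so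
    the curve leaves the straight line by at most [m2 * M * r ^ 2]. The remaining horizontal
    distance [(1 + m2 * M) * r ^ 2] costs [O(r)] by [cs_holder]. *)
Lemma cs_spacetime_fwd t0 x0 t x r : `|t0 - tc| <= rho / 4 -> `|x0 - xc| <= rho / 4 ->
  r * (L + 1) < rho / 8 -> r <= 1 -> t0 <= t -> t - t0 <= r ->
  `|x - x0 - f1 (u t0 x0) * (t - t0)| <= r ^+ 2 -> 0 <= m2 ->
  `|u t x - u t0 x0| <= (M + 1 + 8 * M * (1 + m2 * M) / m) * r.
Proof.
move=> ht0 hx0 hr r1 t0t tr hx m20.
have L0 := cs_L_ge0; have M0 := cs_M cs; have m0 := cs_m cs; have rho0 := cs_rho cs.
have r0 : 0 <= r by lra.
have rL : 0 <= r * L by rewrite mulr_ge0.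
have [g [g0 gL gc]] := char_exists t0 x0 (cs_cl cs) (cs_L cs).
have B : forall s, t0 <= s <= t0 + r -> box tc xc rho s (g s).
  by apply: (char_in_box _ _ L0 r0 _ g0 gL); lra.
have lip s : t0 <= s <= t -> `|u s (g s) - u t0 x0| <= M * r.
  move=> hs; rewrite -g0.
  apply: le_trans (cs_char_lip (gc s) (andP hs).1 _) _.
    by move=> y hy; apply: B; clear -cs hy hs tr; lra.
  by rewrite ler_pM2l//; clear -cs hs tr; lra.
have gt : `|g t - x0 - f1 (u t0 x0) * (t - t0)| <= m2 * (M * r) * (t - t0).
  rewrite -{1}g0; apply: (char_incr (gc t)) => // s hs.
  apply: (le_trans (cs_lip cs (cs_range _ _) (cs_range _ _))).
  by rewrite ler_wpM2l// lip.
have gt2 : m2 * (M * r) * (t - t0) <= m2 * M * r ^+ 2.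
  rewrite expr2 !mulrA ler_wpM2l// !mulr_ge0//; lra.
have xg : `|x - g t| <= (1 + m2 * M) * r ^+ 2.
  rewrite (_ : x - g t = (x - x0 - f1 (u t0 x0) * (t - t0)) -
    (g t - x0 - f1 (u t0 x0) * (t - t0))); last by ring.
  by apply: (le_trans (ler_normB _ _)); clear -cs hx gt gt2; lra.
have gt3 : `|g t - x0| <= L * r.
  have := gL t0 t; rewrite g0 lexx t0t => /(_ isT) /le_trans; apply.
  by rewrite ler_wpM2l.
have x3 : `|x - x0| <= r ^+ 2 + L * r.
  rewrite (_ : x - x0 = (x - x0 - f1 (u t0 x0) * (t - t0)) + f1 (u t0 x0) * (t - t0));
    last by ring.
  apply: (le_trans (ler_normD _ _)); apply: lerD => //.
  rewrite normrM (ger0_norm (_ : 0 <= t - t0)) ?subr_ge0//.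
  by rewrite ler_pM// ?subr_ge0//; exact: (cs_L cs).
have r2 : r ^+ 2 <= r by rewrite expr2 ler_piMl.
have H := @cs_holder t x (g t).
have {}H : m * `|u t x - u t (g t)| ^+ 2 <= 8 * M * `|x - g t|.
  by apply: H; move: ht0 hx0 gt3 x3; rewrite !ler_norml; clear -cs r2 hr tr t0t r0 rL rho0; lra.
pose K := 8 * M * (1 + m2 * M) / m.
have K0 : 0 <= K.
  by rewrite divr_ge0 ?(ltW m0)// !mulr_ge0 ?addr_ge0 ?mulr_ge0// ltW.
have {}H : `|u t x - u t (g t)| ^+ 2 <= K * r ^+ 2.
  rewrite /K mulrAC ler_pdivlMr// mulrC (le_trans H)//.
  by rewrite -!mulrA ler_wpM2l ?ler_wpM2l// ltW.
(* From [K <= (K + 1) ^ 2], which spares a square root in the constant. *)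
have {}H : `|u t x - u t (g t)| <= (K + 1) * r.
  rewrite -(@ler_pXn2r _ 2)// ?nnegrE ?mulr_ge0//; last by lra.
  apply: (le_trans H); rewrite exprMn ler_wpM2r ?sqr_ge0//.
  by rewrite expr2; have := mulr_ge0 K0 K0; move: K0; clear -cs; lra.
rewrite (_ : u t x - u t0 x0 = (u t x - u t (g t)) + (u t (g t) - u t0 x0)); last by ring.
apply: (le_trans (ler_normD _ _)).
by have := lip t ltac:(by rewrite t0t lexx); rewrite -/K; move: H; clear -cs; lra.
Qed.

End convex_sol_theory.

Lemma cs_spacetime (R : realType) (tc xc rho M L m m2 c de : R) (f f1 : R -> R)
    (u U V : R -> R -> R) (t0 x0 t x r : R) :
  convex_sol tc xc rho M L m m2 c de f f1 u U V ->
  `|t0 - tc| <= rho / 4 -> `|x0 - xc| <= rho / 4 ->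
  r * (L + 1) < rho / 8 -> r <= 1 -> `|t - t0| <= r ->
  `|x - x0 - f1 (u t0 x0) * (t - t0)| <= r ^+ 2 -> 0 <= m2 ->
  `|u t x - u t0 x0| <= (M + 1 + 8 * M * (1 + m2 * M) / m) * r.
Proof.
move=> cs ht hx hr r1 tr xr m20.
have [t0t|/ltW tt0] := leP t0 t.
  by apply: (cs_spacetime_fwd cs) => //; move: tr; rewrite ler_norml; lra.
have := @cs_spacetime_fwd _ _ _ _ _ _ _ _ _ _ _ _ _ _ _ (convex_sol_refl cs)
  (- t0) (- x0) (- t) (- x) r.
rewrite /even_refl !opprK; apply => //.
- by rewrite -normrN opprD !opprK.
- by rewrite -normrN opprD !opprK.
- by lra.
- by move: tr; rewrite ler_norml; lra.
- rewrite -normrN (_ : - (- x + x0 - f1 (u t0 x0) * (- t + t0)) =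
    x - x0 - f1 (u t0 x0) * (t - t0))//; ring.
Qed.

(** Unlike in [char_lip_up], the width cannot tend to 0, because the increment of [H] is not
    proportional to [b]. The strip integral is therefore replaced by [b] times the value on the
    curve, at the price of the oscillation [w] at each end. *)
Lemma strip_avg_up (R : realType) (f f1 : R -> R) (u U V : R -> R -> R) (J : R -> Prop)
    (B : R -> R -> Prop) (k1 k2 : R) (H g : R -> R) (t1 t2 b w : R) :
  conslaw f f1 u U V -> balance B U V k1 k2 H ->
  {homo H : x y / x <= y} -> is_char f1 u g t1 t2 -> t1 <= t2 -> 0 < b ->
  (forall t, t1 <= t <= t2 -> exists2 d : R, 0 < d & forall t' x',
     `|t' - t| < d -> `|x' - g t| < b + d -> B t' x') ->
  convex_on J f f1 -> (forall t x, J (u t x)) ->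
  (forall t, t1 <= t <= t2 -> forall x, `|x - g t| <= b ->
    `|u t x - u t (g t)| <= w) ->
  b * (u t2 (g t2) - u t1 (g t1)) <= b * (k2 * (t2 - t1) + 2 * w) + (H t2 - H t1).
Proof.
move=> cl bal Hm Hg t12 b0 HB Jc HJ Hw.
have HB' t : t1 <= t <= t2 -> exists2 d : R, 0 < d & rect_in B t (t + d) (g t) (g t + b).
  move=> /HB[d d0 dP]; exists (d / 2); first by lra.
  by move=> t' x' ht hx; apply: dP; rewrite ltr_norml; lra.
have HC t : t1 <= t <= t2 ->
    0 <= f (u t (g t + b)) - f (u t (g t))
         - f1 (u t (g t)) * (u t (g t + b) - u t (g t)) by move=> _; apply: Jc.
have S := strip_le cl bal Hm Hg t12 b0 HB' HC.
have est t : t1 <= t <= t2 ->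
    `|U t (g t + b) - U t (g t) - u t (g t) * (g t + b - g t)| <= w * (g t + b - g t).
  move=> ht; apply: (@der_mvt R (U t) (u t)); first by lra.
    by move=> y _; exact: (cl_U cl).
  by move=> y hy; apply: Hw => //; rewrite ler_norml; lra.
have := est t1 ltac:(lra); have := est t2 ltac:(lra).
rewrite !ler_norml; lra.
Qed.

Lemma strip_avg (R : realType) (f f1 : R -> R) (u U V : R -> R -> R) (J : R -> Prop)
    (B : R -> R -> Prop) (k1 k2 : R) (H g : R -> R) (t1 t2 b w : R) :
  conslaw f f1 u U V -> balance B U V k1 k2 H ->
  {homo H : x y / x <= y} -> is_char f1 u g t1 t2 -> t1 <= t2 -> 0 < b ->
  (forall t, t1 <= t <= t2 -> exists2 d : R, 0 < d & forall t' x',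
     `|t' - t| < d -> `|x' - g t| < b + d -> B t' x') ->
  convex_on J f f1 -> (forall t x, J (u t x)) ->
  (forall t, t1 <= t <= t2 -> forall x, `|x - g t| <= b ->
    `|u t x - u t (g t)| <= w) ->
  b * (k1 * (t2 - t1) - 2 * w) - (H t2 - H t1) <= b * (u t2 (g t2) - u t1 (g t1))
  <= b * (k2 * (t2 - t1) + 2 * w) + (H t2 - H t1).
Proof.
move=> cl bal Hm Hg t12 b0 HB Jc HJ Hw; apply/andP; split; last first.
  exact: strip_avg_up cl bal Hm Hg t12 b0 HB Jc HJ Hw.
have := @strip_avg_up R f f1 _ _ _ J _ _ _ _ _ (- t2) (- t1) b w (conslaw_refl cl)
  (balance_refl bal) _ (is_char_refl Hg) _ b0 _ Jc.
rewrite /even_refl !opprK => P.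
suff : b * (u t1 (g t1) - u t2 (g t2)) <=
  b * (- k1 * (- t1 + t2) + 2 * w) + (- H t1 + H t2) by lra.
apply: P => //.
- by move=> x y xy; rewrite lerN2; apply: Hm; rewrite lerN2.
- by rewrite lerN2.
- move=> t ht; have [d d0 dP] := HB (- t) ltac:(lra); exists d => // t' x' h1 h2.
  by apply: dP; move: h1 h2; rewrite !ltr_norml; lra.
- move=> t ht x hx; rewrite opprK; apply: Hw; first by lra.
  by move: hx; rewrite !ler_norml; lra.
Qed.
(** * Little-o increments where the source is nearly constant *)

(* Of length [r] along the characteristic direction [(1, lam)] and of width [r ^ 2]
   across it: [u] varies by [O(r)] on such a set, so that its slope [f' (u)] does
   not move characteristics out of a comparable one. *)
Definition sheared (R : realType) (t0 x0 lam r t x : R) : Prop :=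
  `|t - t0| < r /\ `|x - x0 - lam * (t - t0)| < r ^+ 2.

(* Up to a proportion [eta] of the sheared box, the source lies within [e] of a
   constant [q]. *)
Definition asymp_balance (R : realType) (U V : R -> R -> R) (t0 x0 lam : R) : Prop :=
  forall e : R, 0 < e -> exists q : R, forall eta : R, 0 < eta ->
  exists2 r0 : R, 0 < r0 & forall r, 0 < r < r0 -> exists H : R -> R,
  [/\ {homo H : x y / x <= y}, forall s s', H s' - H s <= eta * r ^+ 3 &
      balance (sheared t0 x0 lam r) U V (q - e) (q + e) H].

Lemma asymp_balance_refl (R : realType) (U V : R -> R -> R) (t0 x0 lam : R) :
  asymp_balance U V t0 x0 lam ->
  asymp_balance (odd_refl U) (odd_refl V) (- t0) (- x0) lam.
Proof.
move=> D e e0; have [q qP] := D e e0; exists (- q) => eta eta0.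
have [r0 r00 rP] := qP eta eta0; exists r0 => // r hr.
have [H [H1 H2 H3]] := rP r hr; exists (fun t => - H (- t)); split.
- by move=> x y xy; rewrite lerN2; apply: H1; rewrite lerN2.
- by move=> s s'; have := H2 (- s') (- s); rewrite opprK addrC.
- rewrite (_ : - q - e = - (q + e)); last by ring.
  rewrite (_ : - q + e = - (q - e)); last by ring.
  apply: balance_sub (balance_refl H3) => t x [h1 h2]; split.
    by move: h1; rewrite -normrN opprD !opprK.
  rewrite -normrN (_ : - (- x - x0 - lam * (- t - t0)) = x - - x0 - lam * (t - - t0))//.
  ring.
Qed.

(** Along the curve from [(t0, y)] the value stays within [a + M * T] of [u t0 x0], hence the slope
    within [m2 * (a + M * T)] of the axis of the sheared box. The bound by [r ^ 2] then says that
    curve and strip remain in that box, and [8 * M * b <= m * w ^ 2] that the oscillation across the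
    strip is at most [w]. *)
Lemma char_drift (R : realType) (tc xc rho M L m m2 c de : R) (f f1 : R -> R)
    (u U V : R -> R -> R) (t0 x0 y a T b r h w k1 k2 D : R) (H : R -> R) :
  convex_sol tc xc rho M L m m2 c de f f1 u U V -> 0 <= m2 ->
  `|t0 - tc| <= rho / 4 -> `|x0 - xc| <= rho / 4 ->
  `|y - x0| <= h -> `|u t0 y - u t0 x0| <= a -> 0 <= T -> 0 < b -> 0 <= w ->
  h <= rho / 16 -> b <= rho / 16 -> T * (L + 1) <= rho / 16 ->
  8 * M * b <= m * w ^+ 2 ->
  T < r -> m2 * (a + M * T) * T + h + b < r ^+ 2 ->
  {homo H : x y / x <= y} -> (forall s s', H s' - H s <= D) ->
  balance (sheared t0 x0 (f1 (u t0 x0)) r) U V k1 k2 H ->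
  exists g : R -> R, [/\ g t0 = y, is_char f1 u g t0 (t0 + T) &
    forall s, t0 <= s <= t0 + T ->
      b * (k1 * (s - t0) - 2 * w) - D <= b * (u s (g s) - u t0 y)
      <= b * (k2 * (s - t0) + 2 * w) + D].
Proof.
move=> cs m20 ht0 hx0 yx uy T0 b0 w0 h_rho b_rho TL bw Tr r2 H1 H2 H3.
set lam := f1 (u t0 x0) in H3 *.
have L0 := cs_L_ge0 cs; have M0 := cs_M cs; have m0 := cs_m cs; have rho0 := cs_rho cs.
have TL0 : 0 <= T * L by rewrite mulr_ge0.
have a0 : 0 <= a by apply: le_trans uy.
have [g [g0 gL gc]] := char_exists t0 y (cs_cl cs) (cs_L cs).
exists g; split => // s hs.
have gy t : t0 <= t <= t0 + T -> `|g t - x0| <= rho / 8.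
  move=> ht; have Hg := gL t0 t ltac:(by case/andP: ht => ->; rewrite lexx).
  rewrite g0 in Hg.
  have Hg2 : L * (t - t0) <= L * T by rewrite ler_wpM2l//; clear -ht; lra.
  rewrite (_ : g t - x0 = (g t - y) + (y - x0)); last by ring.
  apply: (le_trans (ler_normD _ _)); clear -Hg Hg2 TL yx h_rho T0; lra.
have Bx t : t0 <= t <= t0 + T -> box tc xc rho t (g t).
  move=> ht; have := gy t ht; move: ht0 hx0; rewrite !ler_norml.
  by move=> e1 e2 e3; split; rewrite ltr_norml; clear -e1 e2 e3 rho0 TL TL0 ht; lra.
have lip t : t0 <= t <= t0 + T -> `|u t (g t) - u t0 x0| <= a + M * T.
  move=> ht.
  have := @cs_char_lip _ _ _ _ _ _ _ _ _ _ _ _ _ _ _ cs g t0 t (gc t)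
    ltac:(by case/andP: ht).
  rewrite g0 => Hl.
  have {}Hl : `|u t (g t) - u t0 y| <= M * (t - t0).
    by apply: Hl => z hz; apply: Bx; clear -hz ht; lra.
  have Hl2 : M * (t - t0) <= M * T by rewrite ler_pM2l//; clear -ht; lra.
  rewrite (_ : u t (g t) - u t0 x0 = (u t (g t) - u t0 y) + (u t0 y - u t0 x0));
    last by ring.
  by apply: (le_trans (ler_normD _ _)); clear -Hl Hl2 uy; lra.
have A0 : 0 <= m2 * (a + M * T).
  by apply: mulr_ge0 => //; apply: addr_ge0 => //; apply: mulr_ge0 => //; exact: ltW.
have dev t : t0 <= t <= t0 + T ->
    `|g t - x0 - lam * (t - t0)| <= m2 * (a + M * T) * T + h.
  move=> ht.
  have Hg : `|g t - g t0 - lam * (t - t0)| <= m2 * (a + M * T) * (t - t0).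
    apply: (char_incr (gc t)); first by case/andP: ht.
    move=> z hz; apply: (le_trans (cs_lip cs (cs_range cs _ _) (cs_range cs _ _))).
    by rewrite ler_wpM2l// lip//; clear -ht hz; lra.
  have Hg2 : m2 * (a + M * T) * (t - t0) <= m2 * (a + M * T) * T.
    by apply: ler_wpM2l => //; clear -ht; lra.
  rewrite (_ : g t - x0 - lam * (t - t0) = (g t - g t0 - lam * (t - t0)) + (y - x0));
    last by rewrite g0; ring.
  by apply: (le_trans (ler_normD _ _)); clear -Hg Hg2 yx; lra.
have HB t : t0 <= t <= s -> exists2 d : R, 0 < d & forall t' x',
   `|t' - t| < d -> `|x' - g t| < b + d -> sheared t0 x0 lam r t' x'.
  move=> ht.
  have := dev t ltac:(clear -hs ht; lra); set dd := _ + h => Hd.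
  have del0 : 0 < r ^+ 2 - (dd + b) by rewrite subr_gt0.
  have la0 : 0 <= `|lam| by [].
  have [z [z0 z1 z2]] : exists z, [/\ 0 < z, z <= r - T &
      z <= (r ^+ 2 - (dd + b)) / (`|lam| + 1)].
    by apply: pos_le2; [rewrite subr_gt0|apply: divr_gt0 => //; clear -la0; lra].
  have {}z2 : z * (`|lam| + 1) <= r ^+ 2 - (dd + b).
    by rewrite -ler_pdivlMr//; clear -la0; lra.
  exists z => // t' x' h1 h2; split.
    by move: h1; rewrite !ltr_norml; clear -ht hs z1; lra.
  rewrite (_ : x' - x0 - lam * (t' - t0) = (x' - g t) - lam * (t' - t) +
    (g t - x0 - lam * (t - t0))); last by ring.
  apply: (le_lt_trans (ler_normD _ _)).
  have Hx : `|x' - g t - lam * (t' - t)| < b + z + `|lam| * z.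
    apply: (le_lt_trans (ler_normB _ _)); apply: ltr_leD => //.
    by rewrite normrM ler_wpM2l// ltW.
  clear -Hx Hd z2; lra.
have Hw t : t0 <= t <= s -> forall x, `|x - g t| <= b -> `|u t x - u t (g t)| <= w.
  move=> ht x hx; have hg := gy t ltac:(clear -hs ht; lra).
  have hh : `|x - g t| <= rho / 16 by apply: le_trans b_rho.
  have t_tc : `|t - tc| <= rho / 2.
    by move: ht0; rewrite !ler_norml; clear -ht hs TL TL0 rho0; lra.
  have x_xc : `|x - xc| <= rho / 2.
    by move: hx0 hg hh; rewrite !ler_norml; clear -rho0; lra.
  have g_xc : `|g t - xc| <= rho / 2.
    by move: hx0 hg; rewrite !ler_norml; clear -rho0; lra.
  rewrite -(@ler_pXn2r _ 2)// ?nnegrE//.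
  rewrite -(ler_pM2l m0); apply: (le_trans (cs_holder cs t_tc x_xc g_xc)).
  apply: le_trans bw; rewrite ler_pM2l//; clear -M0; lra.
have s_ge : t0 <= s by case/andP: hs.
have := @strip_avg R f f1 u U V _ (sheared t0 x0 lam r) k1 k2 H g t0 s b
 w (cs_cl cs) H3 H1 (gc s) s_ge b0 HB (cs_convex cs) (cs_range cs) Hw.
by rewrite g0; have := H2 t0 s; clear; lra.
Qed.

(** Suppose the drop [a] satisfies [a ^ 2 > e * (x2 - x1)] and follow both characteristics for the
    time [a * K]. The constant part [q] of the source cancels in the difference. Each value departs
    from its shifted start by at most [5 / 16 * a]: [a / 8] from the deviation of the source,
    [a / 8] from the oscillation across the strip and [a / 16] from [H]. A gap [a / 4] survives, and
    [chars_ordered] gives a contradiction. *)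
Lemma little_o_fwd (R : realType) (tc xc rho M L m m2 c de : R) (f f1 : R -> R)
    (u U V : R -> R -> R) (t0 x0 : R) :
  convex_sol tc xc rho M L m m2 c de f f1 u U V -> 0 <= m2 ->
  `|t0 - tc| <= rho / 4 -> `|x0 - xc| <= rho / 4 ->
  asymp_balance U V t0 x0 (f1 (u t0 x0)) ->
  forall e : R, 0 < e -> exists2 d : R, 0 < d & forall x1 x2,
    x1 = x0 \/ x2 = x0 -> x1 < x2 -> x2 - x1 < d -> u t0 x2 < u t0 x1 ->
    (u t0 x1 - u t0 x2) ^+ 2 <= e * (x2 - x1).
Proof.
move=> cs m20 ht0 hx0 D e e0.
have L0 := cs_L_ge0 cs; have M0 := cs_M cs; have m0 := cs_m cs; have rho0 := cs_rho cs.
(* With [K = 4 / (m * e)], the error [e'] accumulates to [a / 8] over the time [a * K], and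
   [m * (a / 4) * (a * K)] is exactly [a ^ 2 / e]. *)
have [e' [e'0 e'E]] : exists e', 0 < e' /\ e' = m * e / 32.
  by exists (m * e / 32); split=> //; rewrite divr_gt0// mulr_gt0.
have [K [K0 KE]] : exists K, 0 < K /\ K * e' = 1 / 8.
  exists (1 / (8 * e')); split; last by field; rewrite gt_eqF.
  by apply: divr_gt0 => //; rewrite mulr_gt0.
(* The strip has width [ka * a ^ 2], across which the Hoelder bound allows an oscillation of
   [a / 16]. *)
have [ka [ka0 kaE]] : exists ka, 0 < ka /\ 8 * M * ka = m / (16 * 16).
  exists (m / (8 * M) / (16 * 16)); split; last by field; rewrite gt_eqF.
  by apply: divr_gt0 => //; apply: divr_gt0 => //; rewrite mulr_gt0.
have ie0 : 0 < e^-1 by rewrite invr_gt0.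
have mK0 : 0 <= m2 * (1 + M * K) * K.
  apply: mulr_ge0; last exact: ltW.
  by apply: mulr_ge0 => //; apply: addr_ge0 => //; apply: mulr_ge0; exact: ltW.
(* The sheared box has size [C * a]. Each summand pays for one requirement of [char_drift]: the
   duration, the width of the strip, the bending of the curve and the distance
   [x2 - x1 < a ^ 2 / e]; [C <= C ^ 2] serves the quadratic one. *)
have [C [C1 CE]] : exists C, 1 < C /\ C = 1 + K + ka + m2 * (1 + M * K) * K + e^-1.
  by eexists; split; last reflexivity; clear -K0 ka0 mK0 ie0; lra.
have C0 : 0 < C by clear -C1; lra.
have CC : C <= C ^+ 2 by rewrite expr2 ler_peMl// ltW.
have C30 : 0 < C ^+ 3 by rewrite exprn_gt0.
(* Chosen so that the total increment of [H], divided by the width of the strip, is [a / 16]. *)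
have [eta [eta0 etaE]] : exists eta, 0 < eta /\ eta * C ^+ 3 = ka / 16.
  exists (ka / (16 * C ^+ 3)); split; last by field; rewrite gt_eqF.
  by apply: divr_gt0 => //; rewrite mulr_gt0.
have [q qP] := D e' e'0.
have [r0 r00 rP] := qP eta eta0.
have KL0 : 0 < K * (L + 1) by rewrite mulr_gt0//; clear -L0; lra.
have rho16 : 0 < rho / 16 by rewrite divr_gt0.
have [a1 [a10 a1_1 a1_r]] : exists a, [/\ 0 < a, a <= 1 & a <= r0 / C].
  by apply: pos_le2 => //; rewrite divr_gt0.
have [a2 [a20 a2_1 a2_r]] : exists a, [/\ 0 < a, a <= rho / 16 / (K * (L + 1))
    & a <= rho / 16 / ka].
  by apply: pos_le2 => //; apply: divr_gt0.
have [a0 [a00 a01 a02]] := pos_le2 a10 a20.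
have a0r : a0 * C <= r0 by rewrite -ler_pdivlMr//; exact: le_trans a1_r.
have a0L : a0 * (K * (L + 1)) <= rho / 16 by rewrite -ler_pdivlMr//; exact: le_trans a2_1.
have a0k : a0 * ka <= rho / 16 by rewrite -ler_pdivlMr//; exact: le_trans a2_r.
have a0_1 := le_trans a01 a1_1.
clear a1 a10 a1_1 a1_r a2 a20 a2_1 a2_r a01 a02 r00 KL0 qP D.
have [d1 d10 d1P] := cl_cont (cs_cl cs) t0 x0 a0 a00.
have [d [d0 dd1 drho]] := pos_le2 d10 rho16.
exists d => // x1 x2 xor x12 xd w21.
have [a [ap aE]] : exists a, 0 < a /\ a = u t0 x1 - u t0 x2.
  by eexists; split; last reflexivity; rewrite subr_gt0.
rewrite -aE; apply/contraT; rewrite -ltNge => hlt.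
have [x1b x2b u1b u2b] : [/\ `|x1 - x0| <= x2 - x1, `|x2 - x0| <= x2 - x1,
    `|u t0 x1 - u t0 x0| <= a & `|u t0 x2 - u t0 x0| <= a].
  by clear -xor x12 aE w21; case: xor => <-; split; rewrite ler_norml; lra.
have aa0 : a < a0.
  have u1 : `|u t0 x1 - u t0 x0| < a0.
    apply: d1P; first by rewrite subrr normr0.
    by apply: le_lt_trans x1b _; exact: lt_le_trans xd _.
  have u2 : `|u t0 x2 - u t0 x0| < a0.
    apply: d1P; first by rewrite subrr normr0.
    by apply: le_lt_trans x2b _; exact: lt_le_trans xd _.
  move: u1 u2; clear -xor aE; rewrite !ltr_norml.
  by case: xor aE => -> ->; lra.
have h_lt : x2 - x1 < e^-1 * a ^+ 2 by rewrite mulrC ltr_pdivlMr// mulrC.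
have T0 : 0 < a * K by rewrite mulr_gt0.
have TL : a * K * (L + 1) <= rho / 16.
  by apply: le_trans a0L; rewrite -mulrA ler_wpM2r ?(ltW aa0)// mulr_ge0 ?ltW//; clear -L0; lra.
have a2a : a ^+ 2 <= a.
  by rewrite expr2 ler_piMl ?(ltW ap)//; apply: le_trans a0_1; exact: ltW.
have b0 : 0 < ka * a ^+ 2 by rewrite mulr_gt0// exprn_gt0.
have b_rho : ka * a ^+ 2 <= rho / 16.
  apply: le_trans a0k; rewrite mulrC ler_wpM2r ?(ltW ka0)//.
  by apply: (le_trans a2a); exact: ltW.
have r_r0 : 0 < C * a < r0.
  by rewrite mulr_gt0//=; apply: lt_le_trans a0r; rewrite mulrC ltr_pM2r.
have [H [H1 H2 H3]] := rP _ r_r0.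
have Tr : a * K < C * a.
  by rewrite mulrC ltr_pM2r// CE; clear -K0 ka0 mK0 ie0; lra.
have r2 : m2 * (a + M * (a * K)) * (a * K) + (x2 - x1) + ka * a ^+ 2 < (C * a) ^+ 2.
  apply: (@lt_le_trans _ _ (a ^+ 2 * C)); last first.
    by rewrite exprMn mulrC ler_wpM2r ?sqr_ge0.
  rewrite (_ : m2 * (a + M * (a * K)) * (a * K) = a ^+ 2 * (m2 * (1 + M * K) * K));
    last by ring.
  have aK0 : 0 <= a ^+ 2 * (1 + K) by rewrite mulr_ge0 ?sqr_ge0//; clear -K0; lra.
  rewrite CE; clear -aK0 h_lt; lra.
have bw : 8 * M * (ka * a ^+ 2) <= m * (a / 16) ^+ 2.
  by rewrite mulrA kaE exprMn exprVn expr2 (expr2 16) mulrAC -!mulrA.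
have a16 : 0 <= a / 16 by rewrite divr_ge0// ltW.
have h16 : x2 - x1 <= rho / 16 by apply: ltW; exact: lt_le_trans xd _.
have main := char_drift cs m20 ht0 hx0 _ _ (ltW T0) b0 a16 h16 b_rho TL bw Tr r2 H1 H2 H3.
have dH : eta * (C * a) ^+ 3 = ka * a ^+ 2 * (a / 16).
  rewrite (_ : eta * (C * a) ^+ 3 = eta * C ^+ 3 * a ^+ 3); last by ring.
  by rewrite etaE; field.
have fin g y : (forall s, t0 <= s <= t0 + a * K ->
      ka * a ^+ 2 * ((q - e') * (s - t0) - 2 * (a / 16)) - eta * (C * a) ^+ 3 <=
      ka * a ^+ 2 * (u s (g s) - u t0 y) <=
      ka * a ^+ 2 * ((q + e') * (s - t0) + 2 * (a / 16)) + eta * (C * a) ^+ 3) ->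
    forall s, t0 <= s <= t0 + a * K ->
      `|u s (g s) - u t0 y - q * (s - t0)| <= 5 / 16 * a.
  move=> Hg s hs; have := Hg s hs; rewrite dH -mulrBr -mulrDr !ler_pM2l// => B.
  have es : e' * (s - t0) <= a / 8.
    apply: (@le_trans _ _ (e' * (a * K))).
      by rewrite ler_pM2l//; clear -hs; lra.
    by rewrite mulrCA (mulrC e') KE mulrA mulr1.
  by rewrite ler_norml; clear -B es; lra.
have [g1 [g10 g1c /fin g1P]] := main _ x1b u1b.
have [g2 [g20 g2c /fin g2P]] := main _ x2b u2b.
have Ho := @chars_ordered R f f1 u U V g1 g2 t0 (t0 + a * K) m (c - 2 * de) (c + 2 * de)
  (a / 4) (cs_cl cs) g1c g2c (cs_inc cs) (ltW m0).
rewrite g10 g20 in Ho.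
have {}Ho : m * (a / 4) * (t0 + a * K - t0) <= x2 - x1.
  apply: Ho => //; [by rewrite divr_gt0|by rewrite lerDl ltW| |] => t ht.
    by have := cs_range cs t (g1 t); have := cs_range cs t (g2 t); clear; lra.
  by have := g1P t ht; have := g2P t ht; rewrite !ler_norml; clear -aE; lra.
suff : m * (a / 4) * (t0 + a * K - t0) = e^-1 * a ^+ 2 by clear -Ho h_lt; lra.
have -> : K = e'^-1 / 8.
  by rewrite -[LHS](mulfK (lt0r_neq0 e'0)) KE mul1r mulrC.
by rewrite e'E; field; rewrite !gt_eqF.
Qed.

Lemma little_o (R : realType) (tc xc rho M L m m2 c de : R) (f f1 : R -> R)
    (u U V : R -> R -> R) (t0 x0 : R) :
  convex_sol tc xc rho M L m m2 c de f f1 u U V -> 0 <= m2 ->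
  `|t0 - tc| <= rho / 4 -> `|x0 - xc| <= rho / 4 ->
  asymp_balance U V t0 x0 (f1 (u t0 x0)) ->
  forall e : R, 0 < e -> exists2 d : R, 0 < d & forall y,
    `|y - x0| < d -> `|u t0 y - u t0 x0| ^+ 2 <= e * `|y - x0|.
Proof.
move=> cs m20 ht hx D e e0.
have [d1 d10 d1P] := little_o_fwd cs m20 ht hx D e0.
have ht' : `|- t0 - - tc| <= rho / 4 by rewrite -normrN opprD !opprK.
have hx' : `|- x0 - - xc| <= rho / 4 by rewrite -normrN opprD !opprK.
have D' := asymp_balance_refl D.
have := @little_o_fwd _ _ _ _ _ _ _ _ _ _ _ _ _ _ _ (- t0) (- x0)
  (convex_sol_refl cs) m20 ht' hx'.
rewrite /even_refl !opprK => /(_ D' _ e0)[d2 d20 d2P].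
have [d [d0 dd1 dd2]] := pos_le2 d10 d20.
exists d => // y yd; rewrite real_normK ?num_real//.
(* Decreasing pairs are handled forward in time, increasing ones by the reflected solution; the
   centre [x0] may be either end. *)
have fwd x1 x2 : x1 = x0 \/ x2 = x0 -> x1 < x2 -> x2 - x1 < d ->
    (u t0 x1 - u t0 x2) ^+ 2 <= e * (x2 - x1).
  move=> h1 h2 h3; have [h4|h4|E] := ltgtP (u t0 x2) (u t0 x1).
  - by apply: d1P => //; lra.
  - have := d2P (- x2) (- x1); rewrite !opprK -sqrrN opprB (_ : - x1 + x2 = x2 - x1);
      last by ring.
    by apply => //; [case: h1 => ->; [right|left]|rewrite ltrN2|lra].
  - by rewrite E subrr expr0n/= mulr_ge0 ?subr_ge0 ?ltW.
have [yx|xy|->] := ltgtP y x0.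
- rewrite ltr0_norm ?subr_lt0// opprB; apply: fwd => //; first by right.
  by move: yd; rewrite ltr_norml; lra.
- rewrite gtr0_norm ?subr_gt0// -sqrrN opprB; apply: fwd => //; first by left.
  by move: yd; rewrite ltr_norml; lra.
- by rewrite !subrr expr0n/= normr0 mulr0.
Qed.
(** * Fluxes that are nonlinear of finite order *)

Lemma mono_der (R : realType) (psi dpsi : R -> R) (a b k : R) :
  a <= b -> (forall y, a <= y <= b -> der psi y (dpsi y)) ->
  (forall y, a < y < b -> k <= dpsi y) -> k * (b - a) <= psi b - psi a.
Proof.
rewrite le_eqVlt => /orP[/eqP->|ab] Hd Hk; first by rewrite !subrr mulr0.
have [z|z|z] := @MVT R psi dpsi a b ab.
- rewrite in_itv/= => /andP[az zb].
  by apply: der_is_derive; apply: Hd; rewrite !ltW.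
- apply: derivable_within_continuous => x; rewrite in_itv/= => xab.
  by have [] := der_is_derive (Hd x xab).
- rewrite in_itv/= => zab ->; rewrite ler_wpM2r ?Hk// subr_ge0; exact: ltW.
Qed.

(** Descending induction on the order: the next derivative is nonnegative on [[0, h / 2]] and at
    least [c * (h / 2) ^ p] on [[h / 2, h]], so each integration gains one power of [h] and loses
    only a constant factor. *)
Lemma taylor_lower (R : realType) (psi : nat -> R -> R) (i0 j : nat) :
  (forall i h, (i0 <= i < j)%N -> der (psi i) h (psi i.+1 h)) ->
  (forall i, (i0 <= i < j)%N -> psi i 0 = 0) -> 0 < psi j 0 ->
  {for 0, continuous (psi j)} -> (i0 <= j)%N ->
  exists2 c : R, 0 < c & exists2 d : R, 0 < d &
    forall h, 0 < h < d -> c * h ^+ (j - i0) <= psi i0 h.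
Proof.
move=> Hd H0 Hj Hc ij; move: Hd H0.
have [n ->] : exists n, i0 = (j - n)%N by exists (j - i0)%N; lia.
elim: n => [|n IH] Hd H0.
  rewrite subn0 subnn; exists (psi j 0 / 2); first by rewrite divr_gt0.
  move/cvgrPdist_lt : Hc => /(_ _ (divr_gt0 Hj (ltr0n _ 2))) /nbhs_ballP[d d0 dP].
  exists d => // h /andP[h0 hd]; rewrite expr0 mulr1.
  have := dP h; rewrite /ball/= sub0r normrN gtr0_norm// => /(_ hd).
  by rewrite ltr_norml; lra.
(* Truncated subtraction: in this case both indices are 0 and nothing is to be proved. *)
have [jn|nj] := leqP j n.
  have -> : (j - n.+1 = j - n)%N by lia.
  by apply: IH => i; [move=> h hi; apply: Hd; lia|move=> hi; apply: H0; lia].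
have [c c0 [d d0 dP]] := IH (fun i h hi => Hd i h ltac:(lia)) (fun i hi => H0 i ltac:(lia)).
set k := (j - n.+1)%N in Hd H0 *.
have kE : (j - n)%N = k.+1 by rewrite /k; lia.
rewrite kE in dP.
have jk : (j - k = (j - k.+1).+1)%N by rewrite /k; lia.
have Hk h := Hd k h ltac:(rewrite /k; lia).
have H0k := H0 k ltac:(rewrite /k; lia).
set p := (j - k.+1)%N in dP jk.
exists (c * (2^-1) ^+ p * 2^-1); first by rewrite !mulr_gt0// exprn_gt0// invr_gt0.
exists d => // h /andP[h0 hd]; rewrite jk.
have m1 : 0 * (h / 2 - 0) <= psi k (h / 2) - psi k 0.
  apply: (@mono_der R _ (psi k.+1)); [lra|by move=> y _|].
  move=> y hy; apply: le_trans (dP y ltac:(lra)).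
  by rewrite mulr_ge0 ?exprn_ge0// ltW//; lra.
have m2 : c * (h / 2) ^+ p * (h - h / 2) <= psi k h - psi k (h / 2).
  apply: (@mono_der R _ (psi k.+1)); [lra|by move=> y _|].
  move=> y hy; apply: le_trans (dP y ltac:(lra)).
  by rewrite ler_pM2l// lerXn2r// ?nnegrE; lra.
apply: (@le_trans _ _ (c * (h / 2) ^+ p * (h - h / 2))); last by rewrite H0k in m1; lra.
rewrite exprMn exprS le_eqVlt; apply/orP; left; apply/eqP.
by rewrite (_ : h - h / 2 = h / 2); [ring|field].
Qed.

Lemma taylor_upper (R : realType) (psi : nat -> R -> R) (l : nat) (e : R) :
  (forall i h, (i < l)%N -> der (psi i) h (psi i.+1 h)) ->
  (forall i, (i <= l)%N -> psi i 0 = 0) ->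
  {for 0, continuous (psi l)} -> 0 < e ->
  exists2 d : R, 0 < d & forall h, 0 < h < d -> `|psi 0%N h| <= e * h ^+ l.
Proof.
move=> Hd H0 Hc e0.
have [d d0 dP] : exists2 d : R, 0 < d & forall h, 0 < h < d -> `|psi l h| <= e.
  move/cvgrPdist_lt : Hc => /(_ _ e0) /nbhs_ballP[d d0 dP].
  exists d => // h /andP[h0 hd].
  have := dP h; rewrite /ball/= sub0r normrN gtr0_norm// => /(_ hd).
  by rewrite H0// sub0r normrN => /ltW.
exists d => //.
suff H n : (n <= l)%N -> forall h, 0 < h < d -> `|psi (l - n)%N h| <= e * h ^+ n.
  by move=> h hd; have := H l (leqnn _) h hd; rewrite subnn.
elim: n => [_ h hd|n IH nl h hd]; first by rewrite subn0 expr0 mulr1 dP.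
set k := (l - n.+1)%N.
have kE : (l - n)%N = k.+1 by rewrite /k; lia.
rewrite kE in IH.
have := @der_mvt R (psi k) (psi k.+1) 0 h 0 (e * h ^+ n).
rewrite subr0 mul0r subr0 (H0 k) /k ?leq_subr// subr0 exprSr mulrA; apply; first by lra.
  by move=> y _; apply: Hd; rewrite /k; lia.
move=> y /andP[]; rewrite le_eqVlt => /orP[/eqP<- _|y0 yh]; rewrite subr0.
  rewrite -/k H0; last by rewrite /k; lia.
  by rewrite normr0 mulr_ge0 ?exprn_ge0// ltW//; lra.
apply: (le_trans (IH ltac:(lia) y ltac:(lra))).
by rewrite ler_pM2l// lerXn2r// ?nnegrE; lra.
Qed.

(** If all derivatives of orders 2 to [l] vanished at [v], the first-order remainder would be
    [o(h ^ l)] by Taylor's formula, against nonlinearity; [j] is the least order that does not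
    vanish. *)
Lemma nonlinear_order (R : realType) (l : nat) (f : R -> R) (v c : R) :
  (2 <= l)%N -> of_class_C l f -> 0 < c -> nonlinear_at l c f v ->
  exists j, [/\ (2 <= j <= l)%N, derive1n j f v != 0 &
    forall i, (2 <= i < j)%N -> derive1n i f v = 0].
Proof.
move=> l2 [fd fc] c0 [_ [dl dl0 dlP]].
have fder i x : (i < l)%N -> der (derive1n i f) x (derive1n i.+1 f x).
  move=> il; apply: is_derive_der; have := fd i x il => /derivableP.
  by rewrite -derive1E.
have ex : exists j, (2 <= j <= l)%N && (derive1n j f v != 0).
  apply: contrapT => nex.
  have all0 i : (2 <= i <= l)%N -> derive1n i f v = 0.
    by move=> il; apply/eqP/negPn/negP => ni; apply: nex; exists i; rewrite il ni.
  (* The [i]-th derivative of the first-order remainder [h -> f (v + h) - f v - f' (v) h]. *)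
  pose psi i h := derive1n i f (v + h) -
    (if i == 0%N then f v + derive1 f v * h else if i == 1%N then derive1 f v else 0).
  have shift i h : (i < l)%N -> der (fun h => derive1n i f (v + h)) h (derive1n i.+1 f (v + h)).
    move=> il e e0; have [r r0 rP] := fder i (v + h) il e e0.
    by exists r => // h' hr; rewrite addrA; apply: rP.
  have lin (a b h : R) : der (fun h => a + b * h) h b.
    move=> e e0; exists 1 => // h' _.
    rewrite (_ : a + b * (h + h') - (a + b * h) - h' * b = 0); last by ring.
    by rewrite normr0 mulr_ge0// ltW.
  have cst0 (a h : R) : der (fun=> a) h 0.
    move=> e e0; exists 1 => // h' _.
    by rewrite subrr mulr0 subrr normr0 mulr_ge0// ltW.
  have psid i h : (i < l)%N -> der (psi i) h (psi i.+1 h).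
    move=> il; apply: derB; first exact: shift.
    by case: i il => [|[|i]] il /=.
  have psi0 i : (i <= l)%N -> psi i 0 = 0.
    rewrite /psi addr0; case: i => [|[|i]] il; rewrite ?eqxx /=; [ring|by rewrite subrr|].
    by rewrite subr0; apply: (all0 i.+2).
  have psic : {for 0, continuous (psi l)}.
    rewrite /psi; case: l l2 fc {fd dlP fder nex all0 shift psid psi0 psi} => [|[|l]]//= _ fc.
    apply: cvgB; last exact: cvg_cst.
    apply: (@continuous_comp _ _ _ (fun h => v + h) _ 0); last exact: fc.
    by apply: cvgD; [exact: cvg_cst|exact: cvg_id].
  have [d d0 dP] := taylor_upper psid psi0 psic (divr_gt0 c0 (ltr0n _ 2)).
  have [r [r0 r1 r2]] := pos_le2 d0 dl0.
  have h0 : 0 < r / 2 by rewrite divr_gt0.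
  have nh : `|r / 2| = r / 2 by rewrite gtr0_norm.
  have := dP (r / 2) ltac:(lra); have := dlP (r / 2) ltac:(rewrite nh; lra).
  rewrite nh /psi/= opprD addrA => A1 A2; have := le_trans A1 A2.
  by rewrite ler_pM2r ?exprn_gt0//; lra.
have [j /andP[jl jv] jmin] := ex_minnP ex.
exists j; split => // i /andP[i2 ij]; apply/eqP/negPn/negP => ni.
by have := jmin i; rewrite i2 ni (ltnW (leq_trans ij _))//=; lia.
Qed.

(** * Hoelder bounds relative to a value where the flux may degenerate *)

Lemma cont2_snd (R : realType) (w : R -> R -> R) (t : R) : cont2 w -> continuous (w t).
Proof.
move=> wc x; apply/cvgrPdist_lt => e e0; have [d d0 dP] := wc t x e e0.
apply/nbhs_ballP; exists d => // y; rewrite /ball/= distrC => hy.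
by rewrite distrC; apply: dP => //; rewrite subrr normr0.
Qed.

(** The curvature may vanish at an end of the range of values, so convexity is required on its
    middle half only. Points carrying the values at 3/8 and 5/8 of the range exist between [x1] and
    [x2]; their gap is [d / 4], and the margin [d / 16] asked by [holder_between] stays inside the
    middle half. *)
Lemma holder_inner (R : realType) (f f1 : R -> R) (u U V : R -> R -> R)
    (tc xc rho M L m t x1 x2 : R) :
  conslaw f f1 u U V -> balance (box tc xc rho) U V (- M) M (fun=> 0) -> 0 < M ->
  0 < rho -> (forall t x, `|f1 (u t x)| <= L) -> 0 <= m ->
  `|t - tc| <= rho / 2 -> `|x1 - xc| <= rho / 2 -> `|x2 - xc| <= rho / 2 ->
  let d := `|u t x1 - u t x2| in
  strongly_increasing f1 m (Num.min (u t x1) (u t x2) + d / 4)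
    (Num.max (u t x1) (u t x2) - d / 4) ->
  d * (L + 1) <= M * rho -> m * (d / 4) ^+ 2 <= 8 * M * `|x1 - x2|.
Proof.
move=> cl bal M0 rho0 HL m0 ht.
wlog x12 : x1 x2 / x1 <= x2 => [W|].
  have [|/ltW ba] := leP x1 x2; first exact: W.
  move=> h1 h2 /=; rewrite (distrC x1) (distrC (u t x1)) minC maxC.
  exact: W.
move=> h1 h2 d Hm dL.
have L0 : 0 <= L by apply: le_trans (HL 0 0).
have d0 : 0 <= d by rewrite normr_ge0.
have ct := @continuous_subspaceT _ _ `[x1, x2]%classic _ (@cont2_snd R u t (cl_cont cl)).
set lo := Num.min _ _ in Hm; set hi := Num.max _ _ in Hm.
have lohi : hi - lo = d.
  rewrite /hi /lo /d; have [w|w] := leP (u t x1) (u t x2).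
    by rewrite distrC ger0_norm// subr_ge0.
  by rewrite gtr0_norm// subr_gt0.
have [y1 y1i y1E] : exists2 y, y \in `[x1, x2] & u t y = lo + d * (3 / 8).
  by apply: IVT => //; rewrite -/lo -/hi; lra.
have [y2 y2i y2E] : exists2 y, y \in `[x1, x2] & u t y = lo + d * (5 / 8).
  by apply: IVT => //; rewrite -/lo -/hi; lra.
rewrite !in_itv/= in y1i y2i.
have dE : `|u t y1 - u t y2| = d / 4.
  rewrite y1E y2E (_ : lo + d * (3 / 8) - (lo + d * (5 / 8)) = - (d / 4)); last by field.
  by rewrite normrN ger0_norm//; lra.
have [d_eq0|d_neq0] := eqVneq d 0.
  rewrite d_eq0 mul0r expr0n/= mulr0.
  by rewrite !mulr_ge0// ltW.
have {d_neq0}d0 : 0 < d by rewrite lt_neqAle eq_sym d_neq0.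
have hy1 : `|y1 - xc| <= rho / 2 by move: h1 h2; rewrite !ler_norml; lra.
have hy2 : `|y2 - xc| <= rho / 2 by move: h1 h2; rewrite !ler_norml; lra.
have yy : `|y1 - y2| <= `|x1 - x2|.
  by rewrite (distrC x1) (ger0_norm (_ : 0 <= x2 - x1)) ?subr_ge0// ler_norml; lra.
apply: (@le_trans _ _ (8 * M * `|y1 - y2|)); last by rewrite ler_wpM2l ?mulr_ge0 ?(ltW M0).
have Mr : 0 < M * rho by rewrite mulr_gt0.
have := holder_between cl bal M0 HL m0 Hm ht hy1 hy2.
rewrite /= dE y1E y2E; apply; lra.
Qed.

(* The change of unknown [u -> - u] turns a concave flux into a convex one. *)
Lemma conslaw_neg (R : realType) (f f1 : R -> R) (u U V : R -> R -> R) :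
  conslaw f f1 u U V ->
  conslaw (fun w => - f (- w)) (fun w => f1 (- w)) (fun t x => - u t x)
    (fun t x => - U t x) (fun t x => - V t x).
Proof.
have derN (g : R -> R) y z : der g y z -> der (fun y => - g y) y (- z).
  move=> H e e0; have [r r0 rP] := H e e0; exists r => // h hr.
  rewrite (_ : - g (y + h) - - g y - h * - z = - (g (y + h) - g y - h * z)); last by ring.
  by rewrite normrN; exact: rP.
move=> cl; split.
- move=> t x e e0; have [d d0 dP] := cl_cont cl t x e e0; exists d => // t' x' h1 h2.
  by rewrite -normrN opprD !opprK; apply: dP.
- move=> w e e0; have [r r0 rP] := cl_f cl (- w) e e0; exists r => // h hr.
  have := rP (- h); rewrite !normrN => /(_ hr).
  rewrite (_ : - f (- (w + h)) - - f (- w) - h * f1 (- w) =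
    - (f (- w + - h) - f (- w) - - h * f1 (- w))); first by rewrite normrN.
  by rewrite opprD; ring.
- move=> w e e0; have [d d0 dP] := cl_f1 cl (- w) e e0; exists d => // w' hw.
  by apply: dP; rewrite -normrN opprD !opprK.
- by move=> t x; apply: derN; exact: cl_U cl _ _.
- by move=> t x; rewrite opprK; apply: (derN (V ^~ x)); exact: cl_V cl _ _.
Qed.

Lemma excess_neg (R : realType) (U V : R -> R -> R) (t1 t2 a b : R) :
  excess (fun t x => - U t x) (fun t x => - V t x) t1 t2 a b = - excess U V t1 t2 a b.
Proof. by rewrite /excess; ring. Qed.

Lemma balance_neg (R : realType) (B : R -> R -> Prop) (U V : R -> R -> R)
    (k1 k2 : R) (H : R -> R) :
  balance B U V k1 k2 H ->
  balance B (fun t x => - U t x) (fun t x => - V t x) (- k2) (- k1) H.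
Proof.
move=> bal t1 t2 a b t12 ab rin; have := bal t1 t2 a b t12 ab rin.
by rewrite excess_neg !mulNr; clear; lra.
Qed.

Lemma holder_inner_decr (R : realType) (f f1 : R -> R) (u U V : R -> R -> R)
    (tc xc rho M L m t x1 x2 : R) :
  conslaw f f1 u U V -> balance (box tc xc rho) U V (- M) M (fun=> 0) -> 0 < M ->
  0 < rho -> (forall t x, `|f1 (u t x)| <= L) -> 0 <= m ->
  `|t - tc| <= rho / 2 -> `|x1 - xc| <= rho / 2 -> `|x2 - xc| <= rho / 2 ->
  let d := `|u t x1 - u t x2| in
  strongly_increasing (fun w => - f1 w) m (Num.min (u t x1) (u t x2) + d / 4)
    (Num.max (u t x1) (u t x2) - d / 4) ->
  d * (L + 1) <= M * rho -> m * (d / 4) ^+ 2 <= 8 * M * `|x1 - x2|.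
Proof.
move=> cl bal M0 rho0 HL m0 ht h1 h2 d Hm dL.
have bal' := balance_neg bal; rewrite opprK in bal'.
have := @holder_inner R _ _ _ _ _ tc xc rho M L m t x1 x2 (conslaw_neg cl) bal' M0 rho0.
rewrite -opprD normrN; apply => //; first by move=> t' x'; rewrite opprK.
move=> a b; rewrite -oppr_max -oppr_min => pa ab bq.
have := Hm (- b) (- a); rewrite -/d in pa bq *; rewrite lerN2 opprK (addrC (- a)).
have p1 : Num.min (u t x1) (u t x2) + d / 4 < - b by move: bq; clear; lra.
have p2 : - a < Num.max (u t x1) (u t x2) - d / 4 by move: pa; clear; lra.
by move=> /(_ p1 ab p2); clear; lra.
Qed.

(** [taylor_lower] from order 2 to order [j] for the function [h -> tau * f (v + s * h)]. The sign
    [tau] of the curvature may differ between the two sides [s] of [v]. *)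
Lemma flux_curvature (R : realType) (f : R -> R) (l j : nat) (v s : R) :
  of_class_C l f -> (2 <= j <= l)%N -> derive1n j f v != 0 ->
  (forall i, (2 <= i < j)%N -> derive1n i f v = 0) -> s = 1 \/ s = -1 ->
  exists tau c d : R, [/\ tau = 1 \/ tau = -1, 0 < c, 0 < d &
    forall h, 0 < h < d -> c * h ^+ (j - 2) <= tau * derive1n 2 f (v + s * h)].
Proof.
move=> [fd fc] jl jv jmin hs.
have s2 : s * s = 1 by case: hs => ->; ring.
have ns : `|s| = 1 by case: hs => ->; rewrite ?normrN normr1.
have fder i x : (i < l)%N -> der (derive1n i f) x (derive1n i.+1 f x).
  move=> il; apply: is_derive_der; have := fd i x il => /derivableP.
  by rewrite -derive1E.
have snz : s ^+ j * derive1n j f v != 0.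
  by rewrite mulf_neq0// expf_neq0// -normr_eq0 ns oner_eq0.
pose tau := Num.sg (s ^+ j * derive1n j f v).
have htau : tau = 1 \/ tau = -1.
  by rewrite /tau; case: sgrP snz => // _ _; [left|right].
pose psi i h := tau * s ^+ i * derive1n i f (v + s * h).
have [||||c c0 [d d0 dP]] := @taylor_lower R psi 2 j _ _ _ _ ltac:(lia).
- move=> i h hi e e0.
  have [r r0 rP] := fder i (v + s * h) ltac:(lia) e e0.
  exists r => // h' hr.
  have := rP (s * h') ltac:(by rewrite normrM ns mul1r).
  rewrite (_ : psi i (h + h') - psi i h - h' * psi i.+1 h = (tau * s ^+ i) *
    (derive1n i f (v + s * h + s * h') - derive1n i f (v + s * h) -
     s * h' * derive1n i.+1 f (v + s * h))); last first.
    by rewrite /psi mulrDr addrA exprS; ring.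
  rewrite !normrM normrX ns expr1n mul1r mulr1.
  by case: htau => ->; rewrite ?normrN normr1 mul1r.
- by move=> i hi; rewrite /psi mulr0 addr0 jmin ?mulr0.
- by rewrite /psi mulr0 addr0 -mulrA /tau -normrEsg normr_gt0.
- rewrite /psi.
  apply: cvgM; first exact: cvg_cst.
  apply: (@continuous_comp _ _ _ (fun h => v + s * h) _ 0).
    by apply: cvgD; [exact: cvg_cst|apply: cvgM; [exact: cvg_cst|exact: cvg_id]].
  move: jl => /andP[_]; rewrite leq_eqVlt => /orP[/eqP->|jl]; first exact: fc.
  by apply/differentiable_continuous/derivable1_diffP/fd.
exists tau, c, d; split => // h hd.
by have := dP h hd; rewrite /psi expr2 s2 mulr1.
Qed.
Lemma derive1n_der (R : realType) (f : R -> R) (l i : nat) (x : R) :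
  of_class_C l f -> (i < l)%N -> der (derive1n i f) x (derive1n i.+1 f x).
Proof.
move=> [fd _] il; apply: is_derive_der; have := fd i x il => /derivableP.
by rewrite -derive1E.
Qed.

(** Away from the quarter next to [v], the distance to [v] is at least [h / 4] and bounds the
    curvature from below; the range is the one required by [holder_inner]. *)
Lemma strongly_increasing_near (R : realType) (f : R -> R) (l j : nat) (v s tau c d h : R) :
  of_class_C l f -> (2 <= j <= l)%N -> s = 1 \/ s = -1 -> 0 < c ->
  (forall h, 0 < h < d -> c * h ^+ (j - 2) <= tau * derive1n 2 f (v + s * h)) ->
  0 < h < d ->
  strongly_increasing (fun w => tau * derive1 f w) (c * (h / 4) ^+ (j - 2))
    (Num.min v (v + s * h) + h / 4) (Num.max v (v + s * h) - h / 4).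
Proof.
move=> fC jl hs c0 Hc hd a b la ab bh.
rewrite -mulrBr.
have := @mono_der R (fun w => tau * derive1 f w) (fun w => tau * derive1n 2 f w) a b
  (c * (h / 4) ^+ (j - 2)) ab.
rewrite -mulrBr; apply.
  move=> y _ e e0.
  have e1 : 0 < e / (`|tau| + 1) by rewrite divr_gt0// ltr_wpDl.
  have [r r0 rP] := @derive1n_der R f l 1 y fC ltac:(lia) _ e1.
  exists r => // h' hr.
  rewrite (_ : tau * derive1 f (y + h') - tau * derive1 f y - h' * (tau * derive1n 2 f y) =
    tau * (derive1 f (y + h') - derive1 f y - h' * derive1n 2 f y)); last by ring.
  have t0 : 0 <= `|tau| by [].
  rewrite normrM; apply: le_trans (ler_wpM2l t0 (rP _ hr)) _.
  rewrite mulrA ler_wpM2r// mulrCA ler_piMr ?(ltW e0)//.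
  by rewrite ler_pdivrMr ?mul1r ?lerDl// ltr_wpDl.
move=> y /andP[ay yb].
have [h' hh' yE] : exists2 h', h / 4 <= h' < d & y = v + s * h'.
  move: la bh; case: hs => ->; rewrite ?mul1r ?mulN1r.
    rewrite min_l ?max_r; [|lra|lra] => la bh.
    by exists (y - v); [lra|ring].
  rewrite min_r ?max_l; [|lra|lra] => la bh.
  by exists (v - y); [lra|ring].
rewrite yE; apply: le_trans (Hc h' ltac:(lra)).
by rewrite ler_pM2l// lerXn2r// ?nnegrE; lra.
Qed.

(** On the range between [v] and a value at distance [h], the convexity constant is of order
    [h ^ (j - 2)], so the quadratic bound becomes a bound on [h ^ j]. Since [de <= 1] and [j <= l],
    it also bounds [h ^ l]. Curvature of negative sign is treated through [- u]. *)
Lemma holder_at_value (R : realType) (f : R -> R) (l : nat) (v c : R) :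
  (2 <= l)%N -> of_class_C l f -> 0 < c -> nonlinear_at l c f v ->
  exists cc de : R, [/\ 0 < cc, 0 < de & forall (u U V : R -> R -> R)
    (tc xc rho M L t x1 x2 : R),
  conslaw f (derive1 f) u U V -> balance (box tc xc rho) U V (- M) M (fun=> 0) ->
  0 < M -> 0 < rho -> (forall t x, `|derive1 f (u t x)| <= L) ->
  `|t - tc| <= rho / 2 -> `|x1 - xc| <= rho / 2 -> `|x2 - xc| <= rho / 2 ->
  u t x1 = v -> `|u t x2 - v| < de -> `|u t x2 - v| * (L + 1) <= M * rho ->
  cc * `|u t x2 - v| ^+ l <= 8 * M * `|x1 - x2|].
Proof.
move=> l2 fC c0 nl.
have [j [jl jv jmin]] := nonlinear_order l2 fC c0 nl.
have [t1 [c1 [d1 [ht1 c10 d10 H1]]]] := flux_curvature fC jl jv jmin (or_introl erefl).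
have [t2 [c2 [d2 [ht2 c20 d20 H2]]]] := flux_curvature fC jl jv jmin (or_intror erefl).
have [c3 [c30 c31 c32]] := pos_le2 c10 c20.
have [d3 [d30 d31 d32]] := pos_le2 d10 d20.
have [d4 [d40 d43 d41]] := pos_le2 d30 (@ltr01 R).
exists (c3 / 4 ^+ l), d4; split => //; first by rewrite divr_gt0// exprn_gt0.
move=> u U V tc xc rho M L t x1 x2 cl bal M0 rho0 HL ht h1 h2 ux1.
set h := `|_| => hd hL.
have hge0 : 0 <= h by rewrite normr_ge0.
have {hge0}[h0|h_eq0] : 0 < h \/ h = 0.
  by move: hge0; rewrite le_eqVlt => /orP[/eqP|]; [right|left].
2: by rewrite h_eq0 expr0n gtn_eqF ?(leq_trans _ l2)//= mulr0 !mulr_ge0// ltW.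
have dE : `|u t x1 - u t x2| = h by rewrite ux1 distrC.
have fin c' : c3 <= c' -> (c' * (h / 4) ^+ (j - 2)) * (h / 4) ^+ 2 <= 8 * M * `|x1 - x2| ->
    c3 / 4 ^+ l * h ^+ l <= 8 * M * `|x1 - x2|.
  have -> : c' * (h / 4) ^+ (j - 2) * (h / 4) ^+ 2 = c' * (h / 4) ^+ j.
    by rewrite -mulrA -exprD subnK//; case/andP: jl.
  move=> cc'; apply: le_trans; rewrite mulrAC -mulrA -expr_div_n.
  have h4 : 0 <= h / 4 <= 1 by lra.
  apply: ler_pM; [exact: ltW|by rewrite exprn_ge0//; lra|by []|].
  by case/andP: h4 => h4 h4'; apply: ler_wiXn2l => //; case/andP: jl.
have step s tau c' d' : s = 1 \/ s = -1 -> tau = 1 \/ tau = -1 -> 0 < c' -> c3 <= c' ->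
    d4 <= d' -> (forall h, 0 < h < d' -> c' * h ^+ (j - 2) <= tau * derive1n 2 f (v + s * h)) ->
    u t x2 = v + s * h -> c3 / 4 ^+ l * h ^+ l <= 8 * M * `|x1 - x2|.
  move=> hs htau c'0 cc' dd' Hc ux2.
  have hd' : 0 < h < d' by rewrite h0 (lt_le_trans hd).
  have := strongly_increasing_near fC jl hs c'0 Hc hd'.
  have m0 : 0 <= c' * (h / 4) ^+ (j - 2) by rewrite mulr_ge0 ?exprn_ge0// ltW//; lra.
  case: htau => -> Hs; apply: (fin c') => //.
    have := holder_inner cl bal M0 rho0 HL m0 ht h1 h2.
    rewrite dE ux1 ux2; apply => // a b p1 p2 p3.
    by have := Hs a b p1 p2 p3; rewrite !mul1r.
  have := holder_inner_decr cl bal M0 rho0 HL m0 ht h1 h2.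
  rewrite dE ux1 ux2; apply => // a b p1 p2 p3.
  by have := Hs a b p1 p2 p3; rewrite !mulN1r.
have [vx|xv] := leP v (u t x2).
  apply: (step 1 t1 c1 d1) => //; [by left|exact: le_trans d43 d31|].
  by rewrite mul1r /h ger0_norm ?subr_ge0// addrC subrK.
apply: (step (-1) t2 c2 d2) => //; [by right|exact: le_trans d43 d32|].
by rewrite mulN1r /h ltr0_norm ?subr_lt0// opprK addrC subrK.
Qed.
(** * Density points with respect to sheared boxes *)

(* The carrier of [leb2 R] is a product of copies of [measurableTypeR R], not of [R]. *)
Notation plane R := (measurableTypeR R * measurableTypeR R)%type.

(** Second countability: an open set is the union of the rational squares that it contains, each a
    product of intervals. *)
Lemma open_measurable2 (R : realType) (A : set (R * R)) :
  open A -> measurable (A : set (plane R)).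
Proof.
move=> oA.
pose F (q : rat * rat * rat) : set (R * R) :=
  let D := ball (ratr q.1.1 : R) (ratr q.2) `*` ball (ratr q.1.2 : R) (ratr q.2) in
  if `[< D `<=` A >] then D else set0.
have -> : A = \bigcup_q F q.
  apply/seteqP; split=> [z Az|z [q _]]; last first.
    by rewrite /F; case: ifPn => // /asboolP; apply.
  have /nbhs_ballP[e e0 eA] := open_nbhs_nbhs (conj oA Az).
  have [r] := @rat_in_itvoo R (e / 4) (e / 2) ltac:(simpl in e0; lra).
  rewrite in_itv/= => /andP[r1 r2].
  have near (x : R) : exists p : rat, `|x - ratr p| < e / 4.
    have [p] := @rat_in_itvoo R (x - e / 4) (x + e / 4) ltac:(simpl in e0; lra).
    by rewrite in_itv/= => /andP[p1 p2]; exists p; rewrite ltr_norml; lra.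
  have [[p1 hp1] [p2 hp2]] := (near z.1, near z.2).
  exists (p1, p2, r) => //; rewrite /F /=; case: ifPn => [_|/asboolP[]].
    by split; rewrite /ball/= distrC; lra.
  move=> [y1 y2] [h1 h2]; apply: eA; split; rewrite /ball/=.
    rewrite (_ : z.1 - y1 = (z.1 - ratr p1) + (ratr p1 - y1)); last by ring.
    by apply: (le_lt_trans (ler_normD _ _)); move: h1; rewrite /ball/=; lra.
  rewrite (_ : z.2 - y2 = (z.2 - ratr p2) + (ratr p2 - y2)); last by ring.
  by apply: (le_lt_trans (ler_normD _ _)); move: h2; rewrite /ball/=; lra.
apply: countable_bigcupT_measurable => [|q]; first exact: countableP.
rewrite /F; case: ifPn => // _.
by apply: measurableX; exact: measurable_ball.
Qed.

Definition sym_itv (R : realType) (N : R) : set R := `[- N, N]%classic.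

Definition square (R : realType) (N : R) : set (R * R) :=
  sym_itv N `*` sym_itv N.

Lemma measurable_square (R : realType) (N : R) :
  measurable (square N : set (plane R)).
Proof. by apply: measurableX; exact: measurable_itv. Qed.

Lemma lebesgue_regular (R : realType) (A : set (measurableTypeR R)) (N e : R) :
  measurable A -> 0 < e -> exists U C : set R, [/\ open U, closed C, A `<=` U,
    C `<=` A & (lebesgue_measure ((U `\` C) `&` sym_itv N) <= e%:E)%E].
Proof.
move=> mA e0; set I := sym_itv N.
have mI : measurable I by exact: measurable_itv.
have fin (X : set R) : (lebesgue_measure (X `&` I) < +oo)%E.
  apply: (@le_lt_trans _ _ (lebesgue_measure I)).
    by apply: le_outer_measure; exact: subIsetr.
  by rewrite /I /sym_itv lebesgue_measure_itv/=; case: ifP => // _; rewrite ltry.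
have e2 : 0 < e / 2 by rewrite divr_gt0.
have [U [oU AU mU]] := lebesgue_regularity_outer (measurableI _ _ mA mI) (fin _) e2.
have [U' [oU' AU' mU']] :=
  lebesgue_regularity_outer (measurableI _ _ (measurableC mA) mI) (fin _) e2.
have oI : open (~` I) by apply: closed_openC; exact: interval_closed.
(* Only the part inside [I] is measured, so the complement of [I] can be added to both open sets to
   obtain inclusions valid on the whole line. *)
exists (U `|` ~` I), (~` (U' `|` ~` I)); split.
- exact: openU.
- by apply: open_closedC; exact: openU.
- by move=> x Ax; have [Ix|] := pselect (I x); [left; apply: AU|right].
- by move=> x /not_orP[nU' /contrapT Ix]; apply: contrapT => nA; apply/nU'/AU'.
- have mU1 : measurable (U `\` (A `&` I)).
    by apply: measurableD; [exact: open_measurable|exact: measurableI].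
  have mU2 : measurable (U' `\` (~` A `&` I)).
    by apply: measurableD; [exact: open_measurable|apply: measurableI => //; exact: measurableC].
  apply: (@le_trans _ _ (lebesgue_measure (U `\` (A `&` I)) +
    lebesgue_measure (U' `\` (~` A `&` I)))%E); last first.
    by rewrite (splitr e) EFinD; apply: leeD; exact: ltW.
  apply: le_trans (le_outer_measure _ _ _ _) (outer_measureU2 _ _ _).
  move=> x [[[Ux|//] /contrapT [U'x|//]] Ix].
  by have [Ax|nAx] := pselect (A x); [right; split => // -[]|left; split => // -[]].
Qed.

Lemma leb2_rect (R : realType) (A B : set (measurableTypeR R)) :
  measurable A -> measurable B ->
  leb2 R (A `*` B) = (lebesgue_measure A * lebesgue_measure B)%E.
Proof. by move=> mA mB; exact: product_measure1E. Qed.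

(** Dynkin induction from rectangles, where the one-dimensional result applies to each factor.
    Complements exchange the open and the closed set; for countable unions all open sets are kept
    but only finitely many closed ones, and continuity of the measure on the bounded square controls
    the rest. *)
Lemma leb2_regular (R : realType) (A : set (plane R))
    (N : R) : 0 < N -> measurable A -> forall e : R, 0 < e ->
  exists U C : set (R * R), [/\ open U, closed C, A `<=` U,
    C `<=` A & (leb2 R ((U `\` C) `&` square N) <= e%:E)%E].
Proof.
move=> N0.
have mop (X : set (R * R)) : open X -> measurable (X : set (plane R)).
  exact: open_measurable2.
have mcl (X : set (R * R)) : closed X -> measurable (X : set (plane R)).
  by move=> cX; rewrite -[X]setCK; apply: measurableC; apply: mop; exact: closed_openC.
have mI : measurable (sym_itv N) by exact: measurable_itv.
have lI : lebesgue_measure (sym_itv N) = (2 * N)%:E.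
  rewrite /sym_itv lebesgue_measure_itv/= lte_fin ifT; last by lra.
  by rewrite -EFinB; congr (_%:E); ring.
have fst_cont : continuous (fst : R * R -> R) by move=> z; exact: cvg_fst.
have snd_cont : continuous (snd : R * R -> R) by move=> z; exact: cvg_snd.
pose G : set (set (plane R)) :=
  [set A `*` B | A in measurable & B in measurable].
rewrite measurable_prod_measurableType -/G.
apply: (@dynkin_induction _ _ G (fun A => forall e : R, 0 < e ->
  exists U C : set (R * R), [/\ open U, closed C, A `<=` U,
    C `<=` A & (leb2 R ((U `\` C) `&` square N) <= e%:E)%E])).
- exact: measurable_prod_measurableType.
- move=> _ _ [A1 mA1 [B1 mB1 <-]] [A2 mA2 [B2 mB2 <-]].
  exists (A1 `&` A2); first exact: measurableI.
  by exists (B1 `&` B2); [exact: measurableI|rewrite setXI].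
- move=> e e0; exists (setT : set (R * R)), (setT : set (R * R)).
  split => //; first exact: openT.
  by rewrite setDv set0I measure0 lee_fin ltW.
- move=> _ [A1 mA1 [B1 mB1 <-]] e e0.
  have e' : 0 < e / (4 * N) by rewrite divr_gt0// mulr_gt0.
  have [U1 [C1 [oU1 cC1 AU1 CA1 m1]]] := lebesgue_regular N mA1 e'.
  have [U2 [C2 [oU2 cC2 AU2 CA2 m2]]] := lebesgue_regular N mB1 e'.
  exists (U1 `*` U2), (C1 `*` C2); split.
  + rewrite (_ : U1 `*` U2 = fst @^-1` U1 `&` snd @^-1` U2)//.
    by apply: openI; apply: open_comp => // z _.
  + rewrite (_ : C1 `*` C2 = fst @^-1` C1 `&` snd @^-1` C2)//.
    by apply: closedI; apply: preimage_closed => // z _.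
  + by move=> [x y] [/= ? ?]; split; [exact: AU1|exact: AU2].
  + by move=> [x y] [/= ? ?]; split; [exact: CA1|exact: CA2].
  + have mD1 : measurable ((U1 `\` C1) `&` sym_itv N : set R).
      apply: measurableI => //; apply: measurableD; first exact: open_measurable.
      exact: closed_measurable.
    have mD2 : measurable ((U2 `\` C2) `&` sym_itv N : set R).
      apply: measurableI => //; apply: measurableD; first exact: open_measurable.
      exact: closed_measurable.
    set D1 := _ `&` _ in m1 mD1; set D2 := _ `&` _ in m2 mD2.
    have sub : (U1 `*` U2 `\` C1 `*` C2) `&` square N `<=`
        D1 `*` sym_itv N `|` sym_itv N `*` D2.
      move=> [x y] [[[/= U1x U2y] nC] [/= xI yI]].
      have [C1x|nC1] := pselect (C1 x); last by left.
      by right; split => //=; split => //; split => // C2y; exact: nC.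
    have mR : measurable (D1 `*` sym_itv N :
       set (plane R)) by exact: measurableX.
    have mR' : measurable (sym_itv N `*` D2 :
       set (plane R)) by exact: measurableX.
    apply: (@le_trans _ _ (leb2 R (D1 `*` sym_itv N `|` sym_itv N `*` D2))).
      apply: le_measure => //; rewrite inE; last exact: measurableU.
      apply: measurableI; last exact: measurable_square.
      apply: measurableD; first by apply: measurableX; exact: open_measurable.
      by apply: measurableX; exact: closed_measurable.
    apply: (@le_trans _ _ (leb2 R (D1 `*` sym_itv N) + leb2 R (sym_itv N `*` D2))%E).
      exact: measureU2.
    rewrite (leb2_rect mD1 mI) (leb2_rect mI mD2).
    rewrite lI (splitr e) EFinD; apply: leeD.
      rewrite (_ : e / 2 = e / (4 * N) * (2 * N)); last by field; rewrite gt_eqF.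
      by rewrite [X in (_ <= X)%E]EFinM; apply: lee_wpmul2r => //; rewrite lee_fin; lra.
    rewrite (_ : e / 2 = (2 * N) * (e / (4 * N))); last by field; rewrite gt_eqF.
    by rewrite [X in (_ <= X)%E]EFinM; apply: lee_wpmul2l => //; rewrite lee_fin; lra.
- move=> S mS IH e e0; have [U [C [oU cC SU CS m]]] := IH e e0.
  exists (~` C), (~` U); split.
  + exact: closed_openC.
  + exact: open_closedC.
  + exact: subsetC.
  + exact: subsetC.
  + by rewrite (_ : ~` C `\` ~` U = U `\` C)// setDE setCK setIC -setDE.
- move=> F mF tF IH e e0.
  have e2 : 0 < e / 2 by rewrite divr_gt0.
  have ep n : 0 < e / 2 / (2 ^ n.+1)%:R by rewrite divr_gt0// ltr0n expn_gt0.
  have /choice[UC HUC] : forall n, exists UC : set (R * R) * set (R * R),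
      [/\ open UC.1, closed UC.2, F n `<=` UC.1, UC.2 `<=` F n &
        (leb2 R ((UC.1 `\` UC.2) `&` square N) <= (e / 2 / (2 ^ n.+1)%:R)%:E)%E].
    by move=> n; have [U [C H]] := IH n _ (ep n); exists (U, C).
  pose U n := (UC n).1; pose C n := (UC n).2.
  have oU n : open (U n) by case: (HUC n).
  have cC n : closed (C n) by case: (HUC n).
  have mD n : measurable ((U n `\` C n) `&` square N :
     set (plane R)).
    apply: measurableI; last exact: measurable_square.
    by apply: measurableD; [exact: mop|exact: mcl].
  (* The error when the first [k] closed sets are kept. These sets decrease to one of measure at
     most [e / 2], so some [X k] has measure at most [e]. *)
  pose X k : set (plane R) :=
    (\bigcup_n U n `\` \bigcup_(n in `I_k) C n) `&` square N.
  have oUU : open (\bigcup_n U n) by apply: bigcup_open.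
  have cCk k : closed (\bigcup_(n in `I_k) C n).
    by apply: closed_bigcup => //; exact: finite_II.
  have mX k : measurable (X k).
    apply: measurableI; last exact: measurable_square.
    by apply: measurableD; [exact: mop|exact: mcl].
  have Xcap : \bigcap_k X k `<=` \bigcup_n ((U n `\` C n) `&` square N).
    move=> z Xz; have [[[n _ Unz] _] Qz] := Xz 0%N I.
    exists n => //; split => //; split => // Cnz.
    by have [[_ nC] _] := Xz n.+1 I; apply: nC; exists n => //=.
  have mcap : measurable (\bigcap_k X k) by exact: bigcapT_measurable.
  have le2 : (leb2 R (\bigcap_k X k) <= (e / 2)%:E)%E.
    apply: (le_trans (measure_sigma_subadditive _ mD mcap Xcap)).
    have := @epsilon_trick R (fun=> 0%E) (e / 2) xpredT (fun=> lexx _) (ltW e2).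
    rewrite [X in (_ <= X + _)%E]eseries0// add0e; apply: le_trans.
    apply: lee_nneseries => [n _ _|n _]; first exact: measure_ge0.
    by rewrite add0e; case: (HUC n).
  have X0fin : (leb2 R (X 0%N) < +oo)%E.
    apply: (@le_lt_trans _ _ (leb2 R (square N))).
      apply: le_measure; rewrite ?inE//; first exact: measurable_square.
      exact: subIsetr.
    rewrite (leb2_rect mI mI) lI -EFinM; exact: ltry.
  have Xni : {homo X : n m / (n <= m)%N >-> (m <= n)%O}.
    move=> n m nm; apply/subsetPset; apply: setSI; apply: setDS.
    by apply: bigcup_subset => // k /= kn; exact: leq_trans nm.
  have cvX := nonincreasing_cvg_mu X0fin mX mcap Xni.
  have [k Hk] : exists k, (leb2 R (X k) <= e%:E)%E.
    apply: contrapT => nex.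
    have : (e%:E <= limn (leb2 R \o X))%E.
      apply: lime_ge; first by apply/cvg_ex; eexists; exact: cvX.
      by apply: nearW => n /=; apply/ltW; rewrite ltNge; apply/negP => ?; apply: nex; exists n.
    rewrite (cvg_lim _ cvX)// => /le_trans/(_ le2); rewrite lee_fin; lra.
  exists (\bigcup_n U n), (\bigcup_(n in `I_k) C n); split => //.
  + by apply: subset_bigcup => n _; case: (HUC n).
  + by move=> z [n _ Cz]; exists n => //; case: (HUC n) => _ _ _ CF _; exact: CF.
Qed.
(** Stated for arbitrary sets with a size function, since the shape of a sheared box depends on its
    centre and these boxes are not given as balls of a metric. *)
Lemma vitali_half (R : realType) (T I : Type) (B : I -> set T) (rad : I -> R)
    (V : set I) (r0 : R) :
  (forall i, V i -> 0 < rad i <= r0) -> (forall i, V i -> B i !=set0) ->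
  exists D : set I, [/\ D `<=` V, trivIset D B &
    forall i, V i -> exists j, [/\ D j, B i `&` B j !=set0 & rad i <= 2 * rad j]].
Proof.
move=> Hr HB.
(* the maximal families among those that, when they meet a set, also meet it in
   a member of at least half its size *)
pose P (D : set I) := [/\ D `<=` V, trivIset D B &
  forall i j, V i -> D j -> B i `&` B j !=set0 ->
    exists k, [/\ D k, B i `&` B k !=set0 & rad i <= 2 * rad k]].
have [F FP Ftot|D [PD Dmax]] := @Zorn_bigcup I P.
  split.
  - by move=> i [X FX Xi]; case: (FP X FX) => + _ _; apply.
  - move=> i j [X FX Xi] [Y FY Yj].
    have [XY|YX] := Ftot X Y FX FY.
      by case: (FP Y FY) => _ tY _; apply: tY => //; exact: XY.
    by case: (FP X FX) => _ tX _; apply: tX => //; exact: YX.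
  - move=> i j Vi [X FX Xj] ij.
    have [_ _ /(_ i j Vi Xj ij)[k [Xk ik rk]]] := FP X FX.
    by exists k; split => //; exists X.
case: PD => DV tD HD; exists D; split => // i Vi; apply: contrapT => nex.
(* The sets disjoint from the whole family. If there is one, adding to the family a member of [N] of
   more than half the supremal size contradicts maximality. *)
pose N := [set k | V k /\ forall j, D j -> B k `&` B j = set0].
have Ni : N i.
  split => // j Dj; apply: contrapT => /eqP/set0P ij; apply: nex.
  by have [k ?] := HD i j Vi Dj ij; exists k.
have supN : has_sup (rad @` N).
  split; first by exists (rad i), i.
  by exists r0 => _ [k [Vk _] <-]; have /andP[] := Hr k Vk.
have s0 : 0 < sup (rad @` N).
  by apply: (@lt_le_trans _ _ (rad i)); [have /andP[] := Hr i Vi|apply: (ub_le_sup supN.2); exists i].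
have [_ [k [Vk Nk] <-] hk] := sup_adherent (divr_gt0 s0 (ltr0n R 2)) supN.
apply: (Dmax (D `|` [set k])).
  split; first by left.
  move=> sub; have Dk : D k by apply: sub; right.
  by have [x Bx] := HB k Vk; have := Nk k Dk; rewrite setIid => E0; rewrite E0 in Bx.
split.
- by move=> j [/DV//|->].
- move=> a b [Da|->] [Db|->] //; first exact: tD.
    by rewrite setIC Nk// => -[].
  by rewrite Nk// => -[].
- move=> a b Va Db ab.
  have [[c [Dc ac]]|nc] := pselect (exists c, D c /\ B a `&` B c !=set0).
    by have [d [Dd ad rd]] := HD a c Va Dc ac; exists d; split => //; left.
  have Na : N a.
    split => // c Dc; apply: contrapT => /eqP/set0P ac; apply: nc; by exists c.
  case: Db => [Db|bk]; first by case: nc; exists b.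
  exists k; split; [by right|by rewrite -bk|].
  have : rad a <= sup (rad @` N) by apply: (ub_le_sup supN.2); exists a.
  lra.
Qed.

Lemma negligible_outer (d : measure_display) (T : measurableType d) (R : realType)
    (mu : {measure set T -> \bar R}) (A : set T) :
  (forall e : R, 0 < e -> exists M : set T,
     [/\ measurable M, A `<=` M & (mu M <= e%:E)%E]) -> mu.-negligible A.
Proof.
move=> H.
have /choice[M HM] : forall n : nat, exists M : set T,
    [/\ measurable M, A `<=` M & (mu M <= (n.+1%:R^-1)%:E)%E].
  by move=> n; apply: H; rewrite invr_gt0.
have mM : measurable (\bigcap_n M n) by apply: bigcapT_measurable => n; case: (HM n).
exists (\bigcap_n M n); split => //; last by move=> x Ax n _; case: (HM n) => _ + _; apply.
apply/eqP; rewrite eq_le measure_ge0 andbT; apply/lee_addgt0Pr => e e0; rewrite add0e.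
have [n hn] : exists n : nat, n.+1%:R^-1 < e.
  exists (Num.truncn e^-1).
  rewrite -[e in _ < e]invrK ltf_pV2 ?posrE ?invr_gt0// ?ltr0n//.
  exact: truncnS_gt.
apply: (@le_trans _ _ (mu (M n))).
  apply: le_measure; rewrite ?inE//; first by case: (HM n).
  exact: bigcap_inf.
by case: (HM n) => _ _ /le_trans; apply; rewrite lee_fin ltW.
Qed.

Definition shear_box (R : realType) (lam : R) (z : R * R) (r : R) : set (R * R) :=
  [set p | sheared z.1 z.2 lam r p.1 p.2].

Lemma shear_box_open (R : realType) (lam : R) (z : R * R) (r : R) :
  open (shear_box lam z r).
Proof.
have c1 : continuous (fun p : R * R => `|p.1 - z.1|).
  move=> p; apply: cvg_norm; apply: cvgB; [exact: cvg_fst|exact: cvg_cst].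
have c2 : continuous (fun p : R * R => `|p.2 - z.2 - lam * (p.1 - z.1)|).
  move=> p; apply: cvg_norm; apply: cvgB.
    by apply: cvgB; [exact: cvg_snd|exact: cvg_cst].
  apply: cvgM; first exact: cvg_cst.
  by apply: cvgB; [exact: cvg_fst|exact: cvg_cst].
rewrite (_ : shear_box lam z r = (fun p : R * R => `|p.1 - z.1|) @^-1` [set x | x < r] `&`
  (fun p : R * R => `|p.2 - z.2 - lam * (p.1 - z.1)|) @^-1` [set x | x < r ^+ 2])//.
by apply: openI; apply: open_comp => // p _.
Qed.

Arguments shear_box_open {R} lam z r.

Lemma leb2_shear_box (R : realType) (lam : R) (z : R * R) (r : R) :
  0 < r -> (leb2 R (shear_box lam z r) <= (4 * r ^+ 3)%:E)%E.
Proof.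
move=> r0.
have mS := open_measurable2 (shear_box_open lam z r).
have r20 : 0 <= r ^+ 2 by rewrite sqr_ge0.
pose D : set R := ball z.1 r.
have mD : measurable (D : set (measurableTypeR R)) by exact: measurable_ball.
apply: (@le_trans _ _ (\int[lebesgue_measure]_(t in D) (cst (r ^+ 2 *+ 2)%:E t))%E); last first.
  rewrite integral_cst//= lebesgue_measure_ball; last exact: ltW.
  by rewrite -EFinM lee_fin le_eqVlt; apply/orP; left; apply/eqP; ring.
rewrite [leLHS](_ : _ = \int[lebesgue_measure]_t lebesgue_measure (xsection (shear_box lam z r) t))%E//.
rewrite [leRHS]integral_mkcond.
apply: ge0_le_integral => //.
- exact: (measurable_fun_xsection (@lebesgue_measure R) mS).
- by apply/(measurable_restrictT _ mD); exact: measurable_cst.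
- move=> t _; rewrite patchE; case: ifPn => [tD|/negP tD].
    rewrite /= -(@lebesgue_measure_ball R (z.2 + lam * (t - z.1)))//.
    apply: le_outer_measure => x; rewrite /xsection/= inE => -[_ /= h].
    by rewrite /ball/= distrC opprD addrA.
  rewrite (_ : xsection _ _ = set0) ?measure0//.
  apply/seteqP; split => // x; rewrite /xsection/= inE => -[/= h _]; apply: tD.
  by rewrite inE /D /ball/= distrC.
Qed.
(* Boxes at nearby points with slopes [O(r)] apart engulf each other, as balls do;
   this is what the covering argument needs. *)
Lemma shear_box_engulf (R : realType) (l l' l0 L r s : R) (z z' p : R * R) :
  0 <= L -> 0 < r -> s <= 2 * r -> `|l0 - l| <= L * r -> `|l0 - l'| <= L * s ->
  shear_box l z r p -> shear_box l' z' s p ->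
  shear_box l' z' s `<=` shear_box l z ((5 + 12 * L) * r).
Proof.
move=> L0 r0 sr h1 h2 [/= p1 p2] [/= q1 q2] p' [/= k1 k2].
have ll : `|l' - l| <= 3 * L * r.
  have hs : L * s <= L * (2 * r) by rewrite ler_wpM2l.
  rewrite (_ : l' - l = (l0 - l) - (l0 - l')); last by ring.
  by apply: (le_trans (ler_normB _ _)); clear -h1 h2 hs; lra.
have tt : `|p'.1 - p.1| <= 4 * r.
  rewrite (_ : p'.1 - p.1 = (p'.1 - z'.1) - (p.1 - z'.1)); last by ring.
  by apply: (le_trans (ler_normB _ _)); clear -k1 q1 sr; lra.
have s0 : 0 <= s by apply: ltW; exact: le_lt_trans q1.
have s2 : s ^+ 2 <= 4 * r ^+ 2.
  have -> : 4 * r ^+ 2 = (2 * r) ^+ 2 by ring.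
  by rewrite ler_pXn2r// nnegrE// mulr_ge0// ltW.
have Lr : 0 <= L * r by rewrite mulr_ge0// ltW.
split => /=.
  rewrite (_ : p'.1 - z.1 = (p'.1 - p.1) + (p.1 - z.1)); last by ring.
  by apply: (le_lt_trans (ler_normD _ _)); clear -tt p1 Lr; lra.
have prod : `|(l' - l) * (p'.1 - p.1)| <= 12 * L * r ^+ 2.
  rewrite normrM; apply: (@le_trans _ _ (3 * L * r * (4 * r))); last first.
    by rewrite le_eqVlt; apply/orP; left; apply/eqP; ring.
  by apply: ler_pM.
rewrite (_ : p'.2 - z.2 - l * (p'.1 - z.1) = (p'.2 - z'.2 - l' * (p'.1 - z'.1))
  - (p.2 - z'.2 - l' * (p.1 - z'.1)) + (p.2 - z.2 - l * (p.1 - z.1))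
  + (l' - l) * (p'.1 - p.1)); last by ring.
apply: (le_lt_trans (ler_normD _ _)).
have A1 : `|(p'.2 - z'.2 - l' * (p'.1 - z'.1)) - (p.2 - z'.2 - l' * (p.1 - z'.1))
   + (p.2 - z.2 - l * (p.1 - z.1))| < 9 * r ^+ 2.
  apply: (le_lt_trans (ler_normD _ _)).
  have := ler_normB (p'.2 - z'.2 - l' * (p'.1 - z'.1)) (p.2 - z'.2 - l' * (p.1 - z'.1)).
  by move=> A2; move: A2 k2 q2 p2 s2; clear; lra.
(* Across the axis, two deviations of at most [4 * r ^ 2] and one of [r ^ 2] make 9, and slopes
   [3 * L * r] apart over a time [4 * r] add [12 * L]; along the axis, 5 would be enough. *)
have A3 : (9 + 12 * L) * r ^+ 2 <= ((5 + 12 * L) * r) ^+ 2.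
  rewrite exprMn ler_wpM2r ?sqr_ge0// expr2.
  have : 0 <= L * L by rewrite mulr_ge0.
  by clear -L0; lra.
by move: A1 A3 prod; clear; lra.
Qed.

(** Lebesgue's density theorem for sheared boxes. The points of [E] where it fails are covered by
    boxes inside an open [U] barely larger than [E], each with a fixed proportion outside [E]. A
    disjoint subfamily has total measure controlled by that of [U] minus [E], and its enlargements
    still cover. *)
Lemma sheared_density (R : realType) (lam : R * R -> R) (K E : set (R * R))
    (N L r1 : R) :
  0 < N -> 0 <= L -> 0 < r1 ->
  (forall z, K z -> `|z.1| < N /\ `|z.2| < N) ->
  (forall z r, K z -> 0 < r < r1 -> forall p, shear_box (lam z) z r p ->
    `|lam p - lam z| <= L * r) ->
  measurable (E : set (plane R)) -> E `<=` K ->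
  {ae leb2 R, forall z, E z -> forall eta : R, 0 < eta -> exists2 r0 : R, 0 < r0 &
    forall r, 0 < r < r0 ->
      (leb2 R (shear_box (lam z) z r `\` E) <= (eta * r ^+ 3)%:E)%E}.
Proof.
move=> N0 L0 r10 KN Klam mE EK.
pose A k := [set z | E z /\ forall r0 : R, 0 < r0 -> exists r, 0 < r < r0 /\
  ((k.+1%:R^-1 * r ^+ 3)%:E < leb2 R (shear_box (lam z) z r `\` E))%E].
suff HA k : (leb2 R).-negligible (A k).
  apply: negligibleS (negligible_bigcup HA) => z /= /not_implyP[Ez].
  move=> /existsNP[eta /not_implyP[eta0 nex]].
  exists (Num.truncn eta^-1) => //; split => // r0 r00; apply: contrapT => nr.
  apply: nex; exists r0 => // r hr; rewrite leNgt; apply/negP => lt; apply: nr.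
  exists r; split => //; apply: le_lt_trans lt; rewrite lee_fin.
  apply: ler_wpM2r; first by rewrite exprn_ge0// ltW//; case/andP: hr.
  rewrite -[leRHS]invrK lef_pV2 ?posrE ?invr_gt0// ?ltr0n//.
  by apply/ltW; exact: truncnS_gt.
apply: negligible_outer => e e0.
pose C := 5 + 12 * L.
have C0 : 0 < C by rewrite /C; clear -L0; lra.
pose Kc := 4 * C ^+ 3 * k.+1%:R.
have Kc0 : 0 < Kc by rewrite !mulr_gt0// exprn_gt0.
have [U [F [oU cF EU FE mUF]]] := leb2_regular N0 mE (divr_gt0 e0 Kc0).
have mU := open_measurable2 oU.
pose sq := [set z : R * R | `|z.1| < N /\ `|z.2| < N].
have osq : open sq.
  have c1 : continuous (fun p : R * R => `|p.1|).
    by move=> p; apply: cvg_norm; exact: cvg_fst.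
  have c2 : continuous (fun p : R * R => `|p.2|).
    by move=> p; apply: cvg_norm; exact: cvg_snd.
  rewrite (_ : sq = (fun p : R * R => `|p.1|) @^-1` [set x | x < N] `&`
    (fun p : R * R => `|p.2|) @^-1` [set x | x < N])//.
  by apply: openI; apply: open_comp => // p _.
pose BB (i : R * R * R) := shear_box (lam i.1) i.1 i.2.
pose V := [set i : R * R * R | [/\ A k i.1, 0 < i.2 < r1, BB i `<=` U `&` sq &
  ((k.+1%:R^-1 * i.2 ^+ 3)%:E < leb2 R (BB i `\` E))%E]].
have ctr i : V i -> BB i i.1.
  by move=> [_ /andP[h _] _ _]; split => /=; rewrite !subrr ?mulr0 ?subrr normr0// exprn_gt0.
have [D [DV tD HD]] : exists D : set (R * R * R), [/\ D `<=` V, trivIset D BB &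
    forall i, V i -> exists j, [/\ D j, BB i `&` BB j !=set0 & i.2 <= 2 * j.2]].
  apply: (@vitali_half R _ _ BB snd V r1) => i Vi; last by exists i.1; exact: ctr.
  by case: Vi => _ /andP[-> /ltW ->].
have mB i : measurable (BB i : set (plane R)).
  by apply: open_measurable2; exact: shear_box_open.
have /choice[q qP] : forall i, exists q : rat * rat, V i -> BB i (ratr q.1, ratr q.2).
  move=> i; have [Vi|nV] := pselect (V i); last by exists (0, 0).
  have /nbhs_ballP[d d0 dP] := open_nbhs_nbhs (conj (shear_box_open _ _ _) (ctr i Vi)).
  have near (x : R) : exists p : rat, `|x - ratr p| < d.
    have [p] := @rat_in_itvoo R (x - d) (x + d) ltac:(simpl in d0; clear -d0; lra).
    by rewrite in_itv/= => /andP[p1 p2]; exists p; rewrite ltr_norml; clear -p1 p2; lra.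
  have [[p1 hp1] [p2 hp2]] := (near i.1.1, near i.1.2).
  by exists (p1, p2) => _; apply: dP; split.
pose idx i := pickle (q i).
have idx_inj i j : D i -> D j -> idx i = idx j -> i = j.
  move=> Di Dj /(pcan_inj pickleK) qq; apply: tD => //.
  by exists (ratr (q i).1, ratr (q i).2); split; [|rewrite qq]; apply: qP; exact: DV.
pose S n := \bigcup_(i in [set i | D i /\ idx i = n]) BB i.
pose S' n := \bigcup_(i in [set i | D i /\ idx i = n])
  shear_box (lam i.1) i.1 (C * i.2).
have SE i : D i -> S (idx i) = BB i.
  move=> Di; apply/seteqP; split=> [z [j [Dj ji] zj]|z zi]; last by exists i.
  by rewrite (idx_inj i j).
have S'E i : D i -> S' (idx i) = shear_box (lam i.1) i.1 (C * i.2).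
  move=> Di; apply/seteqP; split=> [z [j [Dj ji] zj]|z zi]; last by exists i.
  by rewrite (idx_inj i j).
have S0 n : (forall i, D i -> idx i <> n) -> S n = set0 /\ S' n = set0.
  by move=> H; split; apply/seteqP; split => // z [i [Di /(H i Di)]].
have oS n : open (S n) by apply: bigcup_open => i _; exact: shear_box_open.
have oS' n : open (S' n) by apply: bigcup_open => i _; exact: shear_box_open.
have mS n := open_measurable2 (oS n).
have mS' n := open_measurable2 (oS' n).
have tS : trivIset setT (fun n => S n `\` E).
  move=> n m _ _ [z [[[i [Di in_] zi] _] [[j [Dj jm] zj] _]]].
  by rewrite -in_ -jm; congr idx; apply: tD => //; exists z.
have cmp n : (leb2 R (S' n) <= Kc%:E * leb2 R (S n `\` E))%E.
  have [[i [Di <-]]|nex] := pselect (exists i, D i /\ idx i = n); last first.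
    have [|-> ->] := S0 n; first by move=> i Di ni; apply: nex; exists i.
    by rewrite measure0 mule_ge0// lee_fin ltW.
  have [_ /andP[i0 _] _ lt] := DV i Di.
  rewrite SE// S'E//.
  apply: (le_trans (leb2_shear_box _ _ _)); first by rewrite mulr_gt0.
  apply: (@le_trans _ _ (Kc%:E * (k.+1%:R^-1 * i.2 ^+ 3)%:E)%E); last first.
    by apply: lee_wpmul2l; [rewrite lee_fin ltW|exact: ltW].
  rewrite -EFinM lee_fin /Kc le_eqVlt; apply/orP; left; apply/eqP.
  have : k.+1%:R != 0 :> R by rewrite pnatr_eq0.
  by move: (k.+1%:R : R) => kk kk0; field.
exists (\bigcup_n S' n); split.
- exact: bigcupT_measurable.
- move=> z Az.
  have Uz : (U `&` sq) z by split; [apply: EU; case: Az|apply: KN; apply: EK; case: Az].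
  have /nbhs_ballP[d d0 dP] := open_nbhs_nbhs (conj (openI oU osq) Uz).
  rewrite /= in d0.
  have la : 0 <= `|lam z| by [].
  have [a [a0 a1 a2]] : exists a : R, [/\ 0 < a, a <= 1 & a <= d / (1 + `|lam z|)].
    by apply: pos_le2 => //; apply: divr_gt0 => //; clear -la; lra.
  have {}a2 : a * (1 + `|lam z|) <= d by rewrite -ler_pdivlMr//; clear -la; lra.
  have [b [b0 b1 b2]] := pos_le2 a0 r10.
  have [r [/andP[r0 rb] lt]] := Az.2 b b0.
  have Vi : V (z, r).
    split => //=; first by rewrite r0 (lt_le_trans rb).
    move=> p [/= p1 p2]; apply: dP; split; rewrite /ball/= distrC.
      by move: p1 rb b1 a2 (mulr_ge0 (ltW a0) la); clear; lra.
    have r2 : r ^+ 2 <= r by rewrite expr2 ler_piMl ?(ltW r0)//; move: rb b1 a1; clear; lra.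
    have lr : `|lam z * (p.1 - z.1)| <= `|lam z| * r.
      by rewrite normrM ler_wpM2l// ltW.
    have ra : r * (1 + `|lam z|) < a * (1 + `|lam z|).
      by rewrite ltr_pM2r; [move: rb b1|move: la]; clear; lra.
    rewrite (_ : p.2 - z.2 = (p.2 - z.2 - lam z * (p.1 - z.1)) + lam z * (p.1 - z.1));
      last by ring.
    by apply: (le_lt_trans (ler_normD _ _)); move: p2 r2 lr ra a2; clear; lra.
  have [j [Dj [p [zp jp]] rj]] := HD _ Vi.
  exists (idx j) => //; rewrite S'E//.
  have [Aj /andP[j0 jr1] _ _] := DV j Dj.
  have [Kz Kj] : K z /\ K j.1 by split; apply: EK; [case: Az|case: Aj].
  apply: (@shear_box_engulf R (lam j.1) (lam z) (lam p) L j.2 r j.1 z p) => //.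
  + by apply: Klam => //; rewrite j0 jr1.
  + by apply: (Klam _ _ Kz _ _ zp); rewrite r0 (lt_le_trans rb b2).
  + exact: (ctr _ Vi).
- apply: (le_trans (measure_sigma_subadditive _ mS' (bigcupT_measurable _ mS')
    (fun _ => id))).
  apply: (@le_trans _ _ (\sum_(0 <= n <oo) (Kc%:E * leb2 R (S n `\` E)))%E).
    by apply: lee_nneseries => [n _ _|n _]; [exact: measure_ge0|exact: cmp].
  rewrite nneseriesZl; last by move=> n _; exact: measure_ge0.
  have mSE n : measurable (S n `\` E : set (plane R)).
    exact: measurableD.
  have := @measure_bigcup _ _ _ (leb2 R) setT (fun n => S n `\` E) (fun n _ => mSE n) tS.
  under eq_eseriesl do rewrite in_setT.
  move=> <-.
  apply: (@le_trans _ _ (Kc%:E * (e / Kc)%:E)%E); last first.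
    by rewrite -EFinM mulrC divfK ?gt_eqF.
  apply: lee_wpmul2l; first by rewrite lee_fin ltW.
  apply: le_trans mUF; apply: le_measure; rewrite ?inE.
  + exact: bigcupT_measurable.
  + apply: measurableI; last exact: measurable_square.
    apply: measurableD => //; rewrite -[F]setCK; apply: measurableC.
    by apply: open_measurable2; exact: closed_openC.
  + move=> z [n _ [[i [Di _] zi] nE]].
    have [_ _ /(_ z zi)[Uz [z1 z2]] _] := DV i Di.
    split; first by split => // /FE.
    by split; rewrite /= /sym_itv/= in_itv/= -ler_norml ltW.
Qed.
(** * Test functions *)

Lemma der_cont (R : realType) (f : R -> R) (x d : R) : der f x d -> {for x, continuous f}.
Proof.
move=> /der_is_derive[fd _].
exact/differentiable_continuous/derivable1_diffP.
Qed.

Lemma primitive_exists (R : realType) (phi : R -> R) :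
  continuous phi -> exists Phi : R -> R, forall x, der Phi x (phi x).
Proof.
move=> pc.
pose mu := @lebesgue_measure R.
have pint (a b : R) : mu.-integrable `[a, b] (EFin \o phi).
  apply: continuous_compact_integrable; first exact: segment_compact.
  exact: continuous_subspaceT.
(* The signed integral from 0: one of the two intervals is always empty or a point. Near [x0] it
   differs from the integral from [- N] by a constant, to which the fundamental theorem applies. *)
pose Phi x := (\int[mu]_(t in `[0, x]) phi t) - (\int[mu]_(t in `[x, 0]) phi t).
exists Phi => x0.
pose N := `|x0| + 2.
pose F x := \int[mu]_(t in `[- N, x]) phi t.
have x0N : - N < x0 - 1 /\ x0 + 1 < N.
  by have := ler_norm x0; have := ler_norm (- x0); rewrite normrN /N; clear; lra.
have PhiF x : - N <= x -> Phi x = F x - F 0.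
  move=> Nx; have N0 : - N <= 0 by rewrite oppr_le0 /N addr_ge0.
  have [x_ge0|x_lt0] := leP 0 x.
    rewrite /F (Rintegral_itvB (pint (- N) x)) ?bnd_simp//.
    rewrite Rintegral_itv_obnd_cbnd; last first.
      by apply: integrableS (pint 0 x) => //; exact: subset_itv_oc_cc.
    rewrite /Phi [X in _ - X](_ : _ = 0) ?subr0//.
    move: x_ge0; rewrite le_eqVlt => /orP[/eqP<-|x_gt0].
      by rewrite set_itv1 Rintegral_set1.
    by rewrite set_itv_ge ?Rintegral_set0// bnd_simp -ltNge.
  rewrite -opprB /F (Rintegral_itvB (pint (- N) 0)) ?bnd_simp//; last exact: ltW.
  rewrite Rintegral_itv_obnd_cbnd; last first.
    by apply: integrableS (pint x 0) => //; exact: subset_itv_oc_cc.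
  rewrite /Phi [X in X - _](_ : _ = 0) ?sub0r//.
  by rewrite set_itv_ge ?Rintegral_set0// bnd_simp -ltNge.
have [Fd F'] := @continuous_FTC1_closed R phi (- N) x0 N ltac:(clear -x0N; lra)
  (pint _ _) ltac:(clear -x0N; lra) (pc x0).
have Fis : is_derive x0 1 F (phi x0).
  by rewrite -F' derive1E; apply: DeriveDef.
move=> e e0; have [r r0 rP] := is_derive_der Fis e0.
have [s [s0 s1 s2]] := pos_le2 r0 (@ltr01 R).
exists s => // h hs.
have hs1 : `|h| < 1 by exact: lt_le_trans s2.
rewrite !PhiF; last 2 first.
- by clear -x0N; lra.
- by move: hs1; rewrite ltr_norml; clear -x0N; lra.
rewrite (_ : F (x0 + h) - F 0 - (F x0 - F 0) - h * phi x0 =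
  F (x0 + h) - F x0 - h * phi x0); last by ring.
by apply: rP; exact: lt_le_trans s1.
Qed.

Lemma primitive_FTC (R : realType) (phi Phi : R -> R) (a b : R) :
  continuous phi -> (forall x, der Phi x (phi x)) -> a <= b ->
  \int[lebesgue_measure]_(x in `[a, b]) phi x = Phi b - Phi a.
Proof.
move=> pc Pd; rewrite le_eqVlt => /orP[/eqP->|ab].
  by rewrite set_itv1 Rintegral_set1 subrr.
have dP x : derivable Phi x 1 by have [] := der_is_derive (Pd x).
have cP : continuous Phi by move=> x; exact: der_cont (Pd x).
rewrite /Rintegral (@continuous_FTC2 _ phi Phi) //.
- exact: continuous_subspaceT.
- by split => //; [apply: cvg_at_right_filter|apply: cvg_at_left_filter]; exact: cP.
- by move=> x _; rewrite derive1E; have [] := der_is_derive (Pd x).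
Qed.

Lemma Rintegral_itv1 (R : realType) (a b : R) : a <= b ->
  \int[lebesgue_measure]_(x in `[a, b]) 1 = b - a.
Proof.
move=> ab; rewrite (@primitive_FTC R (fun=> 1) id)//; first by move=> x; exact: cvg_cst.
move=> x e e0; exists 1 => // h _.
by rewrite (_ : x + h - x - h * 1 = 0) ?normr0 ?mulr_ge0 ?(ltW e0)//; ring.
Qed.

Fixpoint smooth (R : realType) (n : nat) (f : R -> R) : Prop :=
  if n is m.+1 then
    exists2 f' : R -> R, (forall x : R, is_derive x (1 : R) f (f' x)) & smooth m f'
  else continuous f.

Lemma smooth_cont (R : realType) n (f : R -> R) : smooth n f -> continuous f.
Proof.
by case: n => //= n [f' fd _] x; exact: der_cont (is_derive_der (fd x)).
Qed.

Lemma smoothS (R : realType) n (f : R -> R) : smooth n.+1 f -> smooth n f.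
Proof.
elim: n f => [f|n IH f [f' fd /IH sf']]; first exact: smooth_cont.
by exists f'.
Qed.

Lemma smooth_cst (R : realType) n (c : R) : smooth n (fun=> c).
Proof.
elim: n c => [c x|n IH c]; first exact: cvg_cst.
by exists (fun=> 0) => // x; exact: is_derive_cst.
Qed.

Lemma smoothD (R : realType) n (f g : R -> R) :
  smooth n f -> smooth n g -> smooth n (fun x => f x + g x).
Proof.
elim: n f g => [f g fc gc x|n IH f g [f' fd sf] [g' gd sg]].
  by apply: cvgD; [exact: fc|exact: gc].
by exists (fun x => f' x + g' x); [move=> x; exact: is_deriveD|exact: IH].
Qed.

Lemma smoothM (R : realType) n (f g : R -> R) :
  smooth n f -> smooth n g -> smooth n (fun x => f x * g x).
Proof.
elim: n f g => [f g fc gc x|n IH f g sf sg].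
  by apply: cvgM; [exact: fc|exact: gc].
have [sf0 sg0] := (smoothS sf, smoothS sg).
case: sf sg => [f' fd sf] [g' gd sg].
exists (fun x => f x * g' x + g x * f' x).
  by move=> x; exact: is_deriveM.
by apply: smoothD; exact: IH.
Qed.

Lemma smooth_affine (R : realType) n (f : R -> R) (a b : R) :
  smooth n f -> smooth n (fun x => f (a * x + b)).
Proof.
elim: n f => [f fc x|n IH f [f' fd sf]].
  apply: (@continuous_comp _ _ _ (fun x => a * x + b)); last exact: fc.
  by apply: cvgD; [apply: cvgM; [exact: cvg_cst|exact: cvg_id]|exact: cvg_cst].
exists (fun x => f' (a * x + b) * a); last first.
  by apply: smoothM; [exact: IH|exact: smooth_cst].
move=> x; apply: (@is_derive1_comp R f (fun x => a * x + b)).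
apply: der_is_derive => e e0; exists 1 => // h _.
rewrite (_ : a * (x + h) + b - (a * x + b) - h * a = 0); last by ring.
by rewrite normr0 mulr_ge0// ltW.
Qed.

(** The span of the functions [x ^ (- m) * exp (- 1 / x)] is closed under differentiation, so
    smoothness at all orders follows by one induction over all [m]. *)
Definition flat (R : realType) (m : nat) (x : R) : R :=
  if 0 < x then x^-1 ^+ m * expR (- x^-1) else 0.

(** The exponential of [1 / x] dominates the term of order [m + 2] of its series; the square that
    remains gives the derivative 0 at the origin. *)
Lemma flat_le (R : realType) (m : nat) (x : R) :
  0 <= flat m x <= m.+2`!%:R * x ^+ 2.
Proof.
rewrite /flat; case: ifPn => [x0|_]; last by rewrite lexx mulr_ge0// sqr_ge0.
have xV0 : 0 < x^-1 by rewrite invr_gt0.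
rewrite mulr_ge0 ?exprn_ge0 ?expR_ge0 ?(ltW xV0)//=.
have := expR_ge1Dxn m.+1 (ltW xV0); rewrite expRN => h.
have f0 : 0 < (m.+2`!)%:R :> R by rewrite ltr0n fact_gt0.
have y0 : 0 < x^-1 ^+ m.+2 / (m.+2`!)%:R by rewrite divr_gt0// exprn_gt0.
have : (expR x^-1)^-1 <= (x^-1 ^+ m.+2 / (m.+2`!)%:R)^-1.
  by rewrite lef_pV2 ?posrE ?expR_gt0//; move: h; clear; lra.
rewrite -(ler_pM2l (exprn_gt0 m xV0)) => /le_trans; apply.
rewrite invf_div mulrCA le_eqVlt; apply/orP; left; apply/eqP; congr (_ * _).
rewrite exprVn exprVn invrK exprSr exprSr; field.
by rewrite expf_neq0// gt_eqF.
Qed.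

Lemma flat_der (R : realType) (m : nat) (x : R) :
  der (flat m) x (flat m.+2 x - m%:R * flat m.+1 x).
Proof.
have [x0|x0|<-] := ltgtP 0 x.
- have xn0 : x != 0 by rewrite gt_eqF.
  have iV : is_derive x 1 (fun y : R => y^-1) (- x ^- 2).
    by have := is_deriveV xn0 (is_derive_id x 1); rewrite /GRing.scale/= mulr1.
  have iE : is_derive x 1 (fun y : R => expR (- y^-1)) (expR (- x^-1) * (x ^- 2)).
    apply: (@is_derive1_comp R expR (fun y => - y^-1)).
    by have := is_deriveN iV; rewrite opprK.
  have iX : is_derive x 1 (fun y : R => y^-1 ^+ m) (m%:R * x^-1 ^+ m.-1 * (- x ^- 2)).
    have := is_deriveX m iV; rewrite /GRing.scale/=.
    suff -> : (fun y : R => y^-1 ^+ m) = (fun y : R => y^-1) ^+ m by [].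
    by apply/funext => y; rewrite exprfctE.
  have := is_derive_der (is_deriveM iX iE) => D e e0.
  have [r r0 rP] := D e e0.
  have [s [s0 s1 s2]] := pos_le2 r0 x0.
  exists s => // h hs.
  have xh : 0 < x + h.
    by have := lt_le_trans hs s2; rewrite ltr_norml; clear; lra.
  have := rP h (lt_le_trans hs s1).
  rewrite /flat x0 xh !fctE /GRing.scale/=.
  suff -> : x^-1 ^+ m * (expR (- x^-1) * x ^- 2) +
    expR (- x^-1) * (m%:R * x^-1 ^+ m.-1 * - x ^- 2) =
    x^-1 ^+ m.+2 * expR (- x^-1) - m%:R * (x^-1 ^+ m.+1 * expR (- x^-1)) by [].
  rewrite -exprVn; case: m {iX rP D} => [|m]; rewrite ?mul0r ?mulr0 /=.
    by rewrite expr0; ring.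
  by rewrite !exprS; ring.
- move=> e e0; exists (- x); first by rewrite oppr_gt0.
  move=> h; rewrite ltr_norml => hx; rewrite /flat.
  have -> : (0 < x) = false by apply/negbTE; rewrite -leNgt ltW.
  have -> : (0 < x + h) = false by apply/negbTE; rewrite -leNgt; move: hx; clear; lra.
  rewrite (_ : 0 - 0 - h * (0 - m%:R * 0) = 0); last by ring.
  by rewrite normr0 mulr_ge0// ltW.
- move=> e e0; have f0 : 0 < (m.+2`!)%:R :> R by rewrite ltr0n fact_gt0.
  exists (e / (m.+2`!)%:R); first by rewrite divr_gt0.
  move=> h; rewrite ltr_pdivlMr// add0r => hh.
  have F0 k : flat k 0 = 0 :> R by rewrite /flat ltxx.
  rewrite !F0 (_ : flat m h - 0 - h * (0 - m%:R * 0) = flat m h); last by ring.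
  have /andP[p1 p2] := flat_le m h.
  rewrite ger0_norm//; apply: (le_trans p2).
  by rewrite -(real_normK (num_real h)) expr2 mulrA ler_wpM2r// mulrC ltW.
Qed.

Lemma smooth_flat (R : realType) n m : smooth n (@flat R m).
Proof.
elim: n m => [m x|n IH m]; first exact: der_cont (flat_der m x).
exists (fun x => flat m.+2 x + (- m%:R) * flat m.+1 x).
  by move=> x; rewrite mulNr; apply: der_is_derive; exact: flat_der.
by apply: smoothD => //; apply: smoothM => //; exact: smooth_cst.
Qed.
Lemma smooth_step_exists (R : realType) : exists S k : R -> R,
  [/\ forall n, smooth n S, continuous k, forall x, der S x (k x),
      forall x, 0 <= k x &
      [/\ forall x, 0 <= S x <= 1, forall x : R, x <= 0 -> S x = 0, forall x : R, 1 <= x -> S x = 1 &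
          forall x : R, x <= 0 \/ 1 <= x -> k x = 0]].
Proof.
(* A bump positive exactly between 0 and 1; its normalised primitive is the step. *)
pose be (x : R) := flat 0 x * flat 0 (-1 * x + 1).
have sbe n : smooth n be.
  by apply: smoothM; [|apply: smooth_affine]; exact: smooth_flat.
have be0 x : 0 <= be x.
  by apply: mulr_ge0; [have /andP[] := flat_le 0 x|have /andP[] := flat_le 0 (-1 * x + 1)].
have be_out (x : R) : x <= 0 \/ 1 <= x -> be x = 0.
  move=> h; rewrite /be /flat.
  case: h => h; first by rewrite ltNge h/= mul0r.
  have -> : (0 < -1 * x + 1) = false by apply/negbTE; rewrite -leNgt; move: h; clear; lra.
  by rewrite mulr0.
have [Phi PhiP] := primitive_exists (smooth_cont (sbe 0%N)).
have mono x y : x <= y -> Phi x <= Phi y.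
  move=> xy; rewrite -subr_ge0 -[leLHS](mul0r (y - x)).
  by apply: (@mono_der R Phi be).
have c0 : 0 < Phi 1 - Phi 0.
  have b0 : 0 < be (1 / 2).
    rewrite /be /flat ifT; last by lra.
    rewrite ifT; last by lra.
    by rewrite !expr0 !mul1r mulr_gt0// expR_gt0.
  have [r r0 rP] := PhiP (1 / 2) (be (1 / 2) / 2) (divr_gt0 b0 (ltr0n _ 2)).
  have [h [h0 h1 h2]] : exists h, [/\ 0 < h, h <= r / 2 & h <= 1 / 2 :> R].
    by apply: pos_le2; rewrite ?divr_gt0.
  have := rP h; rewrite gtr0_norm// => /(_ ltac:(move: r0 h1; clear; lra)).
  rewrite ler_norml => /andP[H _].
  have := mono 0 (1 / 2) ltac:(lra); have := mono (1 / 2 + h) 1 ltac:(lra).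
  have := mulr_gt0 h0 b0; move: H; clear; lra.
have out_const (x y : R) : x <= y -> (y <= 0 \/ 1 <= x) -> Phi x = Phi y.
  move=> xy h; apply/eqP; rewrite eq_sym -subr_eq0 -normr_le0.
  have := @der_mvt R Phi be x y 0 0 xy (fun z _ => PhiP z).
  rewrite !mul0r subr0; apply => z hz.
  rewrite subr0 be_out ?normr0//.
  by case: h => h; [left|right]; move: h hz; clear; lra.
pose c := Phi 1 - Phi 0.
have S0 x : x <= 0 -> c^-1 * (Phi x - Phi 0) = 0.
  by move=> h; rewrite (out_const x 0 h (or_introl (lexx _))) subrr mulr0.
have S1 x : 1 <= x -> c^-1 * (Phi x - Phi 0) = 1.
  by move=> h; rewrite -(out_const 1 x h (or_intror (lexx _))) mulVf// gt_eqF.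
have Sd x : der (fun x => c^-1 * (Phi x - Phi 0)) x (c^-1 * be x).
  move=> e e0; have [r r0 rP] := PhiP x (e * c) (mulr_gt0 e0 c0).
  exists r => // h hr; have H := rP h hr.
  rewrite (_ : c^-1 * (Phi (x + h) - Phi 0) - c^-1 * (Phi x - Phi 0) - h * (c^-1 * be x) =
    c^-1 * (Phi (x + h) - Phi x - h * be x)); last by ring.
  rewrite normrM (@gtr0_norm _ c^-1) ?invr_gt0// ler_pdivrMl//.
  by rewrite (_ : c * (e * `|h|) = e * c * `|h|)//; ring.
have sk n : smooth n (fun x => c^-1 * be x).
  by apply: smoothM => //; exact: smooth_cst.
exists (fun x => c^-1 * (Phi x - Phi 0)), (fun x => c^-1 * be x); split.
- case=> [x|n]; first exact: der_cont (Sd x).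
  by exists (fun x => c^-1 * be x) => // x; apply: der_is_derive; exact: Sd.
- exact: (smooth_cont (sk 0%N)).
- exact: Sd.
- by move=> x; rewrite mulr_ge0// invr_ge0 ltW.
- split => //; last by move=> x /be_out ->; rewrite mulr0.
  move=> x; have [x0|x0] := leP x 0; first by rewrite S0// lexx ler01.
  have [x1|x1] := leP 1 x; first by rewrite S1// ler01 lexx.
  rewrite mulr_ge0 ?invr_ge0 ?(ltW c0) ?subr_ge0 ?(mono _ _ (ltW x0))//=.
  by rewrite ler_pdivrMl// mulr1 lerD2r mono// ltW.
Qed.

(** A difference of two rescaled steps. Its derivative is a difference of two nonnegative kernels of
    mass 1, one concentrated at each end: tested against these, a function is averaged near a side
    of the rectangle. *)
Lemma cutoff_exists (R : realType) (s t e : R) : 0 < e -> 2 * e <= t - s ->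
  exists A k1 k2 : R -> R,
  [/\ forall n, smooth n A, continuous k1 /\ continuous k2,
      forall x, der A x (k1 x - k2 x),
      (forall x, 0 <= k1 x /\ 0 <= k2 x) /\
      (\int[lebesgue_measure]_(x in `[s, t]) k1 x = 1 /\
       \int[lebesgue_measure]_(x in `[s, t]) k2 x = 1) &
      [/\ forall x, 0 <= A x <= 1, forall x : R, x <= s \/ t <= x -> A x = 0,
          forall x : R, s + e <= x <= t - e -> A x = 1,
          forall x : R, x <= s \/ s + e <= x -> k1 x = 0 &
          forall x : R, x <= t - e \/ t <= x -> k2 x = 0]].
Proof.
move=> e0 est; have [S [k [Ss kc Sd k0 [S01 S0 S1 kout]]]] := smooth_step_exists R.
have ie : 0 < e^-1 by rewrite invr_gt0.
have affd b x : der (fun x => S (e^-1 * x + b)) x (e^-1 * k (e^-1 * x + b)).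
  move=> d d0; have [r r0 rP] := Sd (e^-1 * x + b) (d * e) (mulr_gt0 d0 e0).
  exists (r * e); first by rewrite mulr_gt0.
  move=> h hr; have := rP (e^-1 * h).
  rewrite normrM (gtr0_norm ie) mulrC ltr_pdivrMr// => /(_ hr).
  rewrite (_ : e^-1 * (x + h) + b = e^-1 * x + b + e^-1 * h); last by ring.
  rewrite (_ : h * (e^-1 * k (e^-1 * x + b)) = e^-1 * h * k (e^-1 * x + b)); last by ring.
  rewrite (_ : d * e * (`|h| / e) = d * `|h|)//.
  by field; rewrite gt_eqF.
have affc b : continuous (fun x => e^-1 * k (e^-1 * x + b)).
  move=> x; apply: cvgM; first exact: cvg_cst.
  apply: (@continuous_comp _ _ _ (fun x => e^-1 * x + b)); last exact: kc.
  by apply: cvgD; [apply: cvgM; [exact: cvg_cst|exact: cvg_id]|exact: cvg_cst].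
pose b1 := - (e^-1 * s); pose b2 := 1 - e^-1 * t.
have b1E x : e^-1 * x + b1 = (x - s) / e by rewrite /b1; ring.
have b2E x : e^-1 * x + b2 = (x - t) / e + 1 by rewrite /b2; ring.
have le0 b x : (x / e + b <= 0) = (x <= - b * e).
  by rewrite -lerBrDr sub0r ler_pdivrMr.
have ge1 b x : (1 <= x / e + b) = ((1 - b) * e <= x).
  by rewrite -lerBlDr ler_pdivlMr.
have st : s <= t by move: e0 est; clear; lra.
exists (fun x => S (e^-1 * x + b1) - S (e^-1 * x + b2)), (fun x => e^-1 * k (e^-1 * x + b1)),
  (fun x => e^-1 * k (e^-1 * x + b2)); split.
- move=> n.
  have -> : (fun x => S (e^-1 * x + b1) - S (e^-1 * x + b2)) =
     (fun x => S (e^-1 * x + b1) + -1 * S (e^-1 * x + b2)).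
    by apply/funext => x; rewrite mulN1r.
  by apply: smoothD; [|apply: smoothM; first exact: smooth_cst]; exact: smooth_affine.
- by split; exact: affc.
- by move=> x; apply: derB; exact: affd.
- split; first by move=> x; split; rewrite mulr_ge0// ltW.
  rewrite !(primitive_FTC (affc _) (affd _))//; split.
    rewrite !b1E subrr mul0r (S0 0)// S1 ?subr0//.
    by rewrite ler_pdivlMr//; move: e0 est; clear; lra.
  rewrite !b2E subrr mul0r add0r (S1 1)// S0 ?subr0//.
  by rewrite le0; move: e0 est; clear; lra.
- have A1 x : s + e <= x -> S (e^-1 * x + b1) = 1.
    by move=> h; apply: S1; rewrite b1E ler_pdivlMr//; move: h; clear; lra.
  have A0 x : x <= s -> S (e^-1 * x + b1) = 0.
    by move=> h; apply: S0; rewrite b1E ler_pdivrMr//; move: h; clear; lra.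
  have B1 x : t <= x -> S (e^-1 * x + b2) = 1.
    by move=> h; apply: S1; rewrite b2E ge1; move: h; clear; lra.
  have B0 x : x <= t - e -> S (e^-1 * x + b2) = 0.
    by move=> h; apply: S0; rewrite b2E le0; move: h; clear; lra.
  split.
  + move=> x; have [h|h] := leP (s + e) x.
      by rewrite A1//; have := S01 (e^-1 * x + b2); clear; lra.
    by rewrite B0 ?subr0//; move: h est; clear; lra.
  + move=> x [h|h].
      by rewrite A0// B0 ?subr0//; move: h e0 est; clear; lra.
    by rewrite A1 ?B1 ?subrr//; move: h e0 est; clear; lra.
  + by move=> x /andP[h1 h2]; rewrite A1// B0// subr0.
  + move=> x h; rewrite kout ?mulr0// b1E; case: h => h; [left|right].
      by rewrite ler_pdivrMr//; move: h; clear; lra.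
    by rewrite ler_pdivlMr//; move: h; clear; lra.
  + move=> x h; rewrite kout ?mulr0// b2E; case: h => h; [left|right].
      by rewrite le0; move: h; clear; lra.
    by rewrite ge1; move: h; clear; lra.
Qed.

Definition tensor (R : realType) (A B : R -> R) (z : R * R) : R := A z.1 * B z.2.

Lemma tensor_dt (R : realType) (A B : R -> R) (z : R * R) (d : R) :
  is_derive z.1 (1 : R) A d -> is_derive z ((1, 0) : R * R) (tensor A B) (d * B z.2).
Proof.
move=> [Ad Ad']; have cA : h^-1 *: (A (h *: (1 : R) + z.1) - A z.1) @[h --> 0^'] --> d.
  by rewrite -Ad'; exact: Ad.
have c : h^-1 *: (tensor A B (h *: ((1, 0) : R * R) + z) - tensor A B z) @[h --> 0^'] -->
    d * B z.2.
  have -> : (fun h : R => h^-1 *: (tensor A B (h *: ((1, 0) : R * R) + z) - tensor A B z)) =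
     (fun h : R => h^-1 *: (A (h *: (1 : R) + z.1) - A z.1) * B z.2).
    apply/funext => h; rewrite /tensor /GRing.scale/= /GRing.scale/= mulr0 add0r.
    by ring.
  by apply: cvgM => //; exact: cvg_cst.
by split; [apply/cvg_ex; eexists; exact: c|apply/cvg_lim].
Qed.

Lemma tensor_dx (R : realType) (A B : R -> R) (z : R * R) (d : R) :
  is_derive z.2 (1 : R) B d -> is_derive z ((0, 1) : R * R) (tensor A B) (A z.1 * d).
Proof.
move=> [Ad Ad']; have cA : h^-1 *: (B (h *: (1 : R) + z.2) - B z.2) @[h --> 0^'] --> d.
  by rewrite -Ad'; exact: Ad.
have c : h^-1 *: (tensor A B (h *: ((0, 1) : R * R) + z) - tensor A B z) @[h --> 0^'] -->
    A z.1 * d.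
  have -> : (fun h : R => h^-1 *: (tensor A B (h *: ((0, 1) : R * R) + z) - tensor A B z)) =
     (fun h : R => A z.1 * (h^-1 *: (B (h *: (1 : R) + z.2) - B z.2))).
    apply/funext => h; rewrite /tensor /GRing.scale/= /GRing.scale/= mulr0 add0r.
    by ring.
  by apply: cvgM => //; exact: cvg_cst.
by split; [apply/cvg_ex; eexists; exact: c|apply/cvg_lim].
Qed.

(** For each order [smooth] provides its own derivative; uniqueness of derivatives identifies them
    all. *)
Lemma smooth_exists_der (R : realType) (A : R -> R) :
  (forall n, smooth n A) -> exists A' : R -> R,
    (forall x : R, is_derive x (1 : R) A (A' x)) /\ forall n, smooth n A'.
Proof.
move=> sA; have [A' Ad _] := sA 1%N; exists A'; split => // n.
have [A'' Ad' s] := sA n.+1.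
suff -> : A' = A'' by [].
apply/funext => x; have [_ <-] := Ad x; by have [_ <-] := Ad' x.
Qed.

Lemma tensor_class (R : realType) n (A B : R -> R) :
  (forall n, smooth n A) -> (forall n, smooth n B) -> of_class_C2 n (tensor A B).
Proof.
elim: n A B => [|n IH] A B sA sB.
  move=> z; apply: cvgM.
    apply: (@continuous_comp _ _ _ fst A); first exact: cvg_fst.
    exact: (smooth_cont (sA 0%N)).
  apply: (@continuous_comp _ _ _ snd B); first exact: cvg_snd.
  exact: (smooth_cont (sB 0%N)).
have [A' [Ad sA']] := smooth_exists_der sA.
have [B' [Bd sB']] := smooth_exists_der sB.
split.
- move=> z; apply: cvgM.
    apply: (@continuous_comp _ _ _ fst A); first exact: cvg_fst.
    exact: (smooth_cont (sA 0%N)).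
  apply: (@continuous_comp _ _ _ snd B); first exact: cvg_snd.
  exact: (smooth_cont (sB 0%N)).
- by move=> z; have [] := tensor_dt B (Ad z.1).
- by move=> z; have [] := tensor_dx A (Bd z.2).
- rewrite (_ : dt (tensor A B) = tensor A' B); first exact: IH.
  by apply/funext => z; rewrite /dt; have [_ ->] := tensor_dt B (Ad z.1).
- rewrite (_ : dx (tensor A B) = tensor A B'); first exact: IH.
  by apply/funext => z; rewrite /dx; have [_ ->] := tensor_dx A (Bd z.2).
Qed.

Lemma tensor_test (R : realType) (Omega : set (R * R)) (A B : R -> R) (t1 t2 a b : R) :
  (forall n, smooth n A) -> (forall n, smooth n B) ->
  (forall x : R, x <= t1 \/ t2 <= x -> A x = 0) -> (forall x : R, x <= a \/ b <= x -> B x = 0) ->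
  `[t1, t2]%classic `*` `[a, b]%classic `<=` Omega ->
  test_function Omega (tensor A B).
Proof.
move=> sA sB A0 B0 sub.
have cr : compact (`[t1, t2]%classic `*` `[a, b]%classic : set (R * R)).
  by apply: compact_setX; exact: segment_compact.
have clr : closed (`[t1, t2]%classic `*` `[a, b]%classic : set (R * R)).
  by apply: compact_closed => //; exact: norm_hausdorff.
have supp : closure [set z | tensor A B z != 0] `<=` `[t1, t2]%classic `*` `[a, b]%classic.
  have := proj1 (closure_id _) clr => ->; apply: closureS => z /=; rewrite /tensor => nz.
  split => /=; rewrite in_itv/=; apply/andP; split; rewrite leNgt; apply/negP => h;
    move/eqP: nz; apply.
  - by rewrite A0 ?mul0r//; left; exact: ltW.
  - by rewrite A0 ?mul0r//; right; exact: ltW.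
  - by rewrite B0 ?mulr0//; left; exact: ltW.
  - by rewrite B0 ?mulr0//; right; exact: ltW.
split.
- by move=> n; exact: tensor_class.
- apply: subclosed_compact cr supp; exact: closed_closure.
- exact: subset_trans supp sub.
Qed.
(** * From the weak formulation to the balance on rectangles *)

Lemma continuous_measurable2 (R : realType) (F : R * R -> R) : continuous F ->
  measurable_fun setT (F : plane R -> measurableTypeR R).
Proof.
move=> Fc; apply: (measurability _ (RGenOpens.measurableE R)) => _ [_ [a [b ->] <-]].
rewrite setTI; apply: open_measurable2; exact: open_comp.
Qed.

Definition rect (R : realType) (t1 t2 a b : R) : set (R * R) :=
  `[t1, t2]%classic `*` `[a, b]%classic.

Lemma measurable_rect (R : realType) (t1 t2 a b : R) :
  measurable (rect t1 t2 a b : set (plane R)).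
Proof. by apply: measurableX; exact: measurable_itv. Qed.

Lemma leb2_rect_itv (R : realType) (t1 t2 a b : R) : t1 <= t2 -> a <= b ->
  leb2 R (rect t1 t2 a b) = ((t2 - t1) * (b - a))%:E.
Proof.
move=> t12 ab; rewrite /rect leb2_rect; [|exact: measurable_itv|exact: measurable_itv].
have len (x y : R) : x <= y -> lebesgue_measure `[x, y]%classic = (y - x)%:E.
  rewrite lebesgue_measure_itv/= lte_fin; by case: ltgtP => // -> _; rewrite subrr.
by rewrite !len.
Qed.

Lemma rect_integrable (R : realType) (t1 t2 a b C : R) (F : R * R -> R) :
  measurable_fun setT (F : plane R -> measurableTypeR R) ->
  t1 <= t2 -> a <= b -> (forall z, rect t1 t2 a b z -> `|F z| <= C) ->
  (leb2 R).-integrable (rect t1 t2 a b) (EFin \o F).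
Proof.
move=> mF t12 ab FC; apply: measurable_bounded_integrable.
- exact: measurable_rect.
- by have := leb2_rect_itv t12 ab => /= ->; rewrite ltry.
- exact: measurable_funTS.
- exists C; split; first exact: num_real.
  by move=> x Cx z Qz /=; apply: (le_trans (FC z Qz)); exact: ltW.
Qed.

Lemma continuous_rect_bound (R : realType) (t1 t2 a b : R) (F : R * R -> R) :
  continuous F -> exists2 C : R, 0 < C & forall z, rect t1 t2 a b z -> `|F z| <= C.
Proof.
move=> Fc.
have cr : compact (rect t1 t2 a b : set (R * R)).
  by apply: compact_setX; exact: segment_compact.
have /compact_bounded[C [_ CP]] := continuous_compact (continuous_subspaceT Fc) cr.
exists (`|C| + 1); first by rewrite ltr_wpDl.
by move=> z Qz; apply: CP; [rewrite ltr_pwDr// ler_norm|exists z].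
Qed.

Lemma continuous_rect_integrable (R : realType) (t1 t2 a b : R) (F : R * R -> R) :
  continuous F -> t1 <= t2 -> a <= b -> (leb2 R).-integrable (rect t1 t2 a b) (EFin \o F).
Proof.
move=> Fc t12 ab; have [C _ FC] := @continuous_rect_bound R t1 t2 a b F Fc.
by apply: (@rect_integrable R t1 t2 a b C) => //; exact: continuous_measurable2.
Qed.

Lemma continuous_itv_integrable (R : realType) (p : R -> R) (a b : R) :
  continuous p -> (@lebesgue_measure R).-integrable `[a, b] (EFin \o p).
Proof.
move=> pc; apply: continuous_compact_integrable; first exact: segment_compact.
exact: continuous_subspaceT.
Qed.

Lemma continuous_tensor (R : realType) (p q : R -> R) :
  continuous p -> continuous q -> continuous (tensor p q).
Proof.
move=> pc qc z; apply: cvgM.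
  by apply: (@continuous_comp _ _ _ fst p); [exact: cvg_fst|exact: pc].
by apply: (@continuous_comp _ _ _ snd q); [exact: cvg_snd|exact: qc].
Qed.

Lemma Rintegral_tensor (R : realType) (t1 t2 a b : R) (p q : R -> R) :
  continuous p -> continuous q -> t1 <= t2 -> a <= b ->
  \int[leb2 R]_(z in rect t1 t2 a b) tensor p q z =
  (\int[lebesgue_measure]_(t in `[t1, t2]) p t) *
  (\int[lebesgue_measure]_(x in `[a, b]) q x).
Proof.
move=> pc qc t12 ab.
have ip := continuous_itv_integrable t1 t2 pc.
have iq := continuous_itv_integrable a b qc.
have iF := continuous_rect_integrable (continuous_tensor pc qc) t12 ab.
rewrite {1}/Rintegral integral_mkcond -integral12_prod_meas1; last first.
  by rewrite -integrable_mkcond//; exact: measurable_rect.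
set Q := (X in _ = _ * X).
have inner t : (\int[lebesgue_measure]_y ((EFin \o tensor p q) \_ (rect t1 t2 a b)) (t, y) =
    ((p \_ `[t1, t2]) t)%:E * Q%:E)%E.
  rewrite /Q /Rintegral fineK; last by apply: integrable_fin_num => //; exact: measurable_itv.
  rewrite [in RHS]integral_mkcond -integralZl//; last first.
    by rewrite -integrable_mkcond//; exact: measurable_itv.
  apply: eq_integral => y _; rewrite /rect /patch /tensor /=.
  rewrite in_setX/=; case: (t \in _) => /=; last by rewrite mul0e.
  by case: (y \in _) => //=; rewrite mule0.
rewrite /fubini_F; under eq_integral do rewrite inner.
rewrite integralZr//; last first.
  rewrite (_ : (fun x => _) = (EFin \o p) \_ `[t1, t2]); last first.
    by apply/funext => x; rewrite /patch; case: ifP.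
  by rewrite -integrable_mkcond//; exact: measurable_itv.
rewrite (_ : (fun x => _) = (EFin \o p) \_ `[t1, t2]); last first.
  by apply/funext => x; rewrite /patch; case: ifP.
rewrite -integral_mkcond fineM//.
by apply: integrable_fin_num => //; exact: measurable_itv.
Qed.
Lemma cont2_continuous (R : realType) (w : R -> R -> R) :
  cont2 w -> continuous (fun z : R * R => w z.1 z.2).
Proof.
move=> wc z; apply/cvgrPdist_lt => e e0; have [d d0 dP] := wc z.1 z.2 e e0.
exists (ball z.1 d, ball z.2 d) => [|y [h1 h2]]; first by split; exact: nbhsx_ballx.
rewrite /= distrC; apply: dP.
  by rewrite distrC; exact: h1.
by rewrite distrC; exact: h2.
Qed.

Lemma cont2_fst (R : realType) (w : R -> R -> R) (x : R) : cont2 w -> continuous (w ^~ x).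
Proof.
by move=> wc; apply: (@cont2_snd R (fun x t => w t x)) => y t e e0;
  have [d d0 dP] := wc t y e e0; exists d => // y' t' h1 h2; exact: dP.
Qed.

Lemma continuous_mul (R : realType) (T : topologicalType) (F G : T -> R) :
  continuous F -> continuous G -> continuous (fun z => F z * G z).
Proof. by move=> Fc Gc z; apply: cvgM; [exact: Fc|exact: Gc]. Qed.

Lemma continuous_compl (R : realType) (T : topologicalType) (F : T -> R) :
  continuous F -> continuous (fun z => 1 - F z).
Proof. by move=> Fc z; apply: cvgB; [exact: cvg_cst|exact: Fc]. Qed.

Lemma Rintegral_close d (T : measurableType d) (R : realType)
    (mu : {measure set T -> \bar R}) (D : set T) (F G H : T -> R) :
  measurable D -> mu.-integrable D (EFin \o F) -> mu.-integrable D (EFin \o G) ->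
  mu.-integrable D (EFin \o H) -> (forall z, D z -> `|F z - G z| <= H z) ->
  `|\int[mu]_(z in D) F z - \int[mu]_(z in D) G z| <= \int[mu]_(z in D) H z.
Proof.
move=> mD iF iG iH h; rewrite -RintegralB//.
have iFG : mu.-integrable D (EFin \o (fun z => F z - G z)).
  by have := integrableB mD iF iG.
apply: (le_trans (le_normr_Rintegral mD iFG)); apply: le_Rintegral => //.
by move/integrable_norm: iFG.
Qed.

(** Meant for [P] a kernel concentrated at a side of the rectangle, [B] the cutoff along that side
    and [q] the value of [W] on it, extended constantly across. The integrands differ by
    [P * ((W - q) * B - q * (1 - B))]. *)
Lemma kernel_estimate (R : realType) (t1 t2 a b om C : R) (W P B q : R * R -> R) :
  t1 <= t2 -> a <= b ->
  continuous W -> continuous P -> continuous B -> continuous q ->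
  0 <= om -> 0 <= C ->
  (forall z, rect t1 t2 a b z -> [/\ 0 <= P z, 0 <= B z <= 1, `|q z| <= C &
     P z != 0 -> `|W z - q z| <= om]) ->
  `|\int[leb2 R]_(z in rect t1 t2 a b) (W z * (P z * B z)) -
    \int[leb2 R]_(z in rect t1 t2 a b) (P z * q z)| <=
  om * (\int[leb2 R]_(z in rect t1 t2 a b) P z) +
  C * (\int[leb2 R]_(z in rect t1 t2 a b) (P z * (1 - B z))).
Proof.
move=> t12 ab Wc Pc Bc qc om0 C0 h.
have mQ := measurable_rect t1 t2 a b.
have i1 := continuous_rect_integrable Pc t12 ab.
have i2 := continuous_rect_integrable (continuous_mul Pc (continuous_compl Bc)) t12 ab.
rewrite -!RintegralZl// -RintegralD//; last 2 first.
- by have := integrableZl mQ om i1.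
- by have := integrableZl mQ C i2.
apply: Rintegral_close => //.
- exact: (continuous_rect_integrable (continuous_mul Wc (continuous_mul Pc Bc))).
- exact: (continuous_rect_integrable (continuous_mul Pc qc)).
- by have := integrableD mQ (integrableZl mQ om i1) (integrableZl mQ C i2).
- move=> z /h[P0 /andP[B0 B1] qC Wq].
  rewrite (_ : _ - _ = P z * ((W z - q z) * B z - q z * (1 - B z))); last by ring.
  rewrite normrM (ger0_norm P0); have [->|Pz] := eqVneq (P z) 0.
    by rewrite !(mul0r, mulr0) addr0.
  rewrite (_ : om * P z + _ = P z * (om + C * (1 - B z))); last by ring.
  apply: ler_wpM2l => //; apply: (le_trans (ler_normB _ _)); apply: lerD.
    rewrite normrM (ger0_norm B0) -[leRHS]mulr1.
    by apply: ler_pM => //; exact: Wq.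
  have B1' : 0 <= 1 - B z by rewrite subr_ge0.
  by rewrite normrM (ger0_norm B1') ler_wpM2r.
Qed.

Lemma cutoff_deficit (R : realType) (A : R -> R) (s t e : R) :
  continuous A -> 0 < e -> 2 * e <= t - s -> (forall x, 0 <= A x <= 1) ->
  (forall x : R, s + e <= x <= t - e -> A x = 1) ->
  \int[lebesgue_measure]_(x in `[s, t]) (1 - A x) <= 2 * e.
Proof.
move=> Ac e0 est A01 A1.
have Dc := continuous_compl Ac.
have [D Dd] := primitive_exists Dc.
have st : s <= t by move: e0 est; clear; lra.
rewrite (primitive_FTC Dc Dd st).
have bd x : `|1 - A x - 0| <= 1.
  by rewrite subr0 ger0_norm; have := A01 x; clear; lra.
have H1 := @der_mvt R D _ s (s + e) 0 1 ltac:(move: e0; clear; lra) (fun x _ => Dd x) (fun x _ => bd x).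
have H3 := @der_mvt R D _ (t - e) t 0 1 ltac:(move: e0; clear; lra) (fun x _ => Dd x) (fun x _ => bd x).
have H2 := @der_mvt R D _ (s + e) (t - e) 0 0 ltac:(move: est; clear; lra) (fun x _ => Dd x).
have {}H2 := H2 (fun x hx => ltac:(by rewrite A1// subrr subr0 normr0)).
move: H1 H2 H3; rewrite !ler_norml; clear; lra.
Qed.

(** With [p] concentrated near the time [s], the double integral approximates the integral of [w s]
    over the side, which is [W b - W a]. *)
Lemma kernel_time (R : realType) (w : R -> R -> R) (p B W : R -> R) (t1 t2 a b s e om C : R) :
  cont2 w -> continuous p -> continuous B -> t1 <= t2 -> 0 < e -> 2 * e <= b - a ->
  0 <= om -> 0 <= C ->
  (forall t, 0 <= p t) -> \int[lebesgue_measure]_(t in `[t1, t2]) p t = 1 ->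
  (forall x, 0 <= B x <= 1) -> (forall x : R, a + e <= x <= b - e -> B x = 1) ->
  (forall x, der W x (w s x)) -> (forall x, a <= x <= b -> `|w s x| <= C) ->
  (forall t x, a <= x <= b -> p t != 0 -> `|w t x - w s x| <= om) ->
  `|\int[leb2 R]_(z in rect t1 t2 a b) (w z.1 z.2 * (p z.1 * B z.2)) - (W b - W a)| <=
  om * (b - a) + C * (2 * e).
Proof.
move=> wc pc Bc t12 e0 eab om0 C0 p0 p1 B01 B1 Wd wC ws.
have ab : a <= b by move: e0 eab; clear; lra.
have wsc : continuous (w s) by exact: cont2_snd.
have c1 : continuous (fun _ : R => 1 : R) by move=> x; exact: cvg_cst.
have Pc := continuous_tensor pc c1.
have Bc2 := continuous_tensor c1 Bc.
have qc := continuous_tensor c1 wsc.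
have := @kernel_estimate R t1 t2 a b om C _ _ _ _ t12 ab (cont2_continuous wc) Pc Bc2 qc om0 C0.
have E : (fun z => tensor p (fun=> 1) z * tensor (fun=> 1) (w s) z) = tensor p (w s).
  by apply/funext => z; rewrite /tensor mul1r mulr1.
have E2 : (fun z => tensor p (fun=> 1) z * (1 - tensor (fun=> 1) B z)) =
    tensor p (fun x => 1 - B x).
  by apply/funext => z; rewrite /tensor mul1r mulr1.
have E3 : (fun z => w z.1 z.2 * (tensor p (fun=> 1) z * tensor (fun=> 1) B z)) =
   (fun z => w z.1 z.2 * (p z.1 * B z.2)).
  by apply/funext => z; rewrite /tensor mul1r mulr1.
rewrite E E2 E3 !Rintegral_tensor//; last exact: continuous_compl.
rewrite p1 !mul1r (primitive_FTC wsc Wd ab).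
rewrite (Rintegral_itv1 ab).
have cd := cutoff_deficit Bc e0 eab B01 B1.
move=> K; apply: le_trans (K _) _; last by rewrite lerD2l ler_wpM2l.
move=> [t x] [/= _ hx]; rewrite in_itv/= in hx; rewrite /tensor /= !mulr1 !mul1r.
by split => //; [exact: wC|exact: ws].
Qed.

Lemma kernel_space (R : realType) (w : R -> R -> R) (k A W : R -> R) (t1 t2 a b y e om C : R) :
  cont2 w -> continuous k -> continuous A -> a <= b -> 0 < e -> 2 * e <= t2 - t1 ->
  0 <= om -> 0 <= C ->
  (forall x, 0 <= k x) -> \int[lebesgue_measure]_(x in `[a, b]) k x = 1 ->
  (forall t, 0 <= A t <= 1) -> (forall t : R, t1 + e <= t <= t2 - e -> A t = 1) ->
  (forall t, der W t (w t y)) -> (forall t, t1 <= t <= t2 -> `|w t y| <= C) ->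
  (forall t x, t1 <= t <= t2 -> k x != 0 -> `|w t x - w t y| <= om) ->
  `|\int[leb2 R]_(z in rect t1 t2 a b) (w z.1 z.2 * (A z.1 * k z.2)) - (W t2 - W t1)| <=
  om * (t2 - t1) + C * (2 * e).
Proof.
move=> wc kc Ac ab e0 et om0 C0 k0 k1 A01 A1 Wd wC ws.
have t12 : t1 <= t2 by move: e0 et; clear; lra.
have wsc : continuous (w ^~ y) by exact: cont2_fst.
have c1 : continuous (fun _ : R => 1 : R) by move=> x; exact: cvg_cst.
have Pc := continuous_tensor c1 kc.
have Bc2 := continuous_tensor Ac c1.
have qc := continuous_tensor wsc c1.
have := @kernel_estimate R t1 t2 a b om C _ _ _ _ t12 ab (cont2_continuous wc) Pc Bc2 qc om0 C0.
have E : (fun z => tensor (fun=> 1) k z * tensor (w ^~ y) (fun=> 1) z) = tensor (w ^~ y) k.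
  by apply/funext => z; rewrite /tensor mul1r mulr1 mulrC.
have E2 : (fun z => tensor (fun=> 1) k z * (1 - tensor A (fun=> 1) z)) =
    tensor (fun t => 1 - A t) k.
  by apply/funext => z; rewrite /tensor mul1r mulr1 mulrC.
have E3 : (fun z => w z.1 z.2 * (tensor (fun=> 1) k z * tensor A (fun=> 1) z)) =
   (fun z => w z.1 z.2 * (A z.1 * k z.2)).
  by apply/funext => z; rewrite /tensor mul1r mulr1 (mulrC (k _)).
rewrite E E2 E3 !Rintegral_tensor//; last exact: continuous_compl.
rewrite k1 !mulr1 (primitive_FTC wsc Wd t12).
rewrite (Rintegral_itv1 t12).
have cd := cutoff_deficit Ac e0 et A01 A1.
move=> K; apply: le_trans (K _) _; last by rewrite lerD2l ler_wpM2l.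
move=> [t x] [/= ht _]; rewrite in_itv/= in ht; rewrite /tensor /= !mulr1 !mul1r.
by split => //; [exact: wC|exact: ws].
Qed.
Lemma integral_deficit (R : realType) (A B : R -> R) (g : R * R -> R) (t1 t2 a b e M : R) :
  measurable_fun setT (g : plane R -> measurableTypeR R) ->
  (forall z, `|g z| <= M) -> continuous A -> continuous B -> 0 < e ->
  2 * e <= t2 - t1 -> 2 * e <= b - a ->
  (forall t, 0 <= A t <= 1) -> (forall t : R, t1 + e <= t <= t2 - e -> A t = 1) ->
  (forall x, 0 <= B x <= 1) -> (forall x : R, a + e <= x <= b - e -> B x = 1) ->
  `|\int[leb2 R]_(z in rect t1 t2 a b) (g z * (A z.1 * B z.2)) -
    \int[leb2 R]_(z in rect t1 t2 a b) g z| <= M * ((t2 - t1 + (b - a)) * (2 * e)).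
Proof.
move=> mg gM Ac Bc e0 et eb A01 A1 B01 B1.
have t12 : t1 <= t2 by move: e0 et; clear; lra.
have ab : a <= b by move: e0 eb; clear; lra.
have M0 : 0 <= M := le_trans (normr_ge0 _) (gM (0, 0)).
have c1 : continuous (fun _ : R => 1 : R) by move=> x; exact: cvg_cst.
have mQ := measurable_rect t1 t2 a b.
have iA := continuous_rect_integrable (continuous_tensor (continuous_compl Ac) c1) t12 ab.
have iB := continuous_rect_integrable (continuous_tensor c1 (continuous_compl Bc)) t12 ab.
have AB := continuous_tensor Ac Bc.
have iS := integrableD mQ iA iB.
have K : `|\int[leb2 R]_(z in rect t1 t2 a b) (g z * (A z.1 * B z.2)) -
    \int[leb2 R]_(z in rect t1 t2 a b) g z| <=
  \int[leb2 R]_(z in rect t1 t2 a b) (M * (tensor (fun t => 1 - A t) (fun=> 1) z +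
     tensor (fun=> 1) (fun x => 1 - B x) z)).
  apply: Rintegral_close => //.
  - apply: (@rect_integrable R t1 t2 a b M) => //.
      by apply: measurable_funM => //; exact: continuous_measurable2 AB.
    move=> z _; rewrite normrM -[leRHS]mulr1; apply: ler_pM => //.
    have /andP[A0 A1'] := A01 z.1; have /andP[B0 B1'] := B01 z.2.
    by rewrite ger0_norm ?mulr_ge0//; rewrite -[leRHS]mulr1 ler_pM.
  - by apply: (@rect_integrable R t1 t2 a b M).
  - by have := integrableZl mQ M iS.
  - move=> z _; rewrite (_ : _ - _ = - (g z * (1 - A z.1 * B z.2))); last by ring.
    have := A01 z.1; have := B01 z.2; rewrite /tensor mulr1 mul1r.
    set x := A z.1; set y := B z.2 => hy hx.
    (* The bound rests on [0 <= 1 - x * y <= (1 - x) + (1 - y)] for [x] and [y] between 0 and 1. *)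
    have xy1 : 0 <= 1 - x * y by move: hx hy; clear; nra.
    rewrite normrN normrM (ger0_norm xy1); apply: ler_pM => //.
    by move: hx hy; clear; nra.
apply: (le_trans K); rewrite RintegralZl//; apply: ler_wpM2l => //.
rewrite RintegralD// !Rintegral_tensor//; try exact: continuous_compl.
rewrite !Rintegral_itv1//.
have := cutoff_deficit Ac e0 et A01 A1; have := cutoff_deficit Bc e0 eb B01 B1.
have t12' : 0 <= t2 - t1 by rewrite subr_ge0.
have ab' : 0 <= b - a by rewrite subr_ge0.
move=> /(ler_wpM2l t12') h1 /(ler_wpM2r ab') h2.
by apply: (le_trans (lerD h2 h1)); rewrite le_eqVlt; apply/orP; left; apply/eqP; ring.
Qed.

(** The test function is a product of two cutoffs, whose derivatives are the four kernels at the
    sides. Here [w] stands for [u] where the rectangle sees it, with continuity on the whole plane,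
    and [g0] is a measurable, everywhere bounded representative of [g]. *)
Lemma weak_excess (R : realType) (f : R -> R) (w U V : R -> R -> R) (Omega : set (R * R))
    (u g g0 : R * R -> R) (M t1 t2 a b : R) :
  cont2 w -> cont2 (fun t x => f (w t x)) ->
  (forall t x, der (U t) x (w t x)) -> (forall t x, der (V ^~ x) t (f (w t x))) ->
  measurable_fun setT (g0 : plane R -> measurableTypeR R) ->
  measurable_fun setT (g \_ Omega : plane R -> measurableTypeR R) ->
  (forall z, `|g0 z| <= M) -> {ae leb2 R, forall z, (g \_ Omega) z = g0 z} ->
  weak_solution Omega f u g -> rect t1 t2 a b `<=` Omega ->
  (forall z, rect t1 t2 a b z -> u z = w z.1 z.2) -> t1 < t2 -> a < b ->
  excess U V t1 t2 a b = \int[leb2 R]_(z in rect t1 t2 a b) g0 z.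
Proof.
move=> wc fc Ud Vd mg0 mg g0M gg0 sol sub uw t12 ab.
have [t12' ab'] := (ltW t12, ltW ab).
have mQ := measurable_rect t1 t2 a b.
have wc2 := cont2_continuous wc; have fc2 := cont2_continuous fc.
have [C1 C10 C1P] := @continuous_rect_bound R t1 t2 a b _ wc2.
have [C2 C20 C2P] := @continuous_rect_bound R t1 t2 a b _ fc2.
have M0 : 0 <= M := le_trans (normr_ge0 _) (g0M (0, 0)).
set G0 := (X in _ = X).
have sw : cont2 (fun x t => f (w t x)).
  by move=> x t e e0; have [d d0 dP] := fc t x e e0; exists d => // x' t' h1 h2; exact: dP.
pose K := 2 * (t2 - t1 + (b - a)) + 4 * C1 + 4 * C2 + M * ((t2 - t1 + (b - a)) * 2).
suff main eta : 0 < eta -> `|excess U V t1 t2 a b - G0| <= K * eta.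
  have K0 : 0 < K.
    have : 0 <= M * ((t2 - t1 + (b - a)) * 2).
      by rewrite mulr_ge0// mulr_ge0// addr_ge0// subr_ge0.
    by rewrite /K; move: t12 ab C10 C20; clear; lra.
  apply/eqP; rewrite -subr_eq0 -normr_le0; apply/ler_addgt0Pr => e e0.
  rewrite add0r; have := main (e / K) (divr_gt0 e0 K0).
  by rewrite mulrC divfK// gt_eqF.
move=> eta0.
have [d1 d10 d1P] := cont2_tube t1 wc eta0 ab'.
have [d2 d20 d2P] := cont2_tube t2 wc eta0 ab'.
have [d3 d30 d3P] := cont2_tube a sw eta0 t12'.
have [d4 d40 d4P] := cont2_tube b sw eta0 t12'.
have [e e0] := @pos_le_all R [:: d1; d2; d3; d4; (t2 - t1) / 2; (b - a) / 2; eta]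
  ltac:(by rewrite /= d10 d20 d30 d40 eta0 !divr_gt0 ?subr_gt0).
rewrite /= andbT => /and5P[ed1 ed2 ed3 ed4 /and3P[et2 eb2 ee]].
have {}et2 : 2 * e <= t2 - t1 by move: et2; clear; lra.
have {}eb2 : 2 * e <= b - a by move: eb2; clear; lra.
have [A [k1 [k2 [As [k1c k2c] Ad [k0 [ik1 ik2]] [A01 Aout A1 k1out k2out]]]]] := cutoff_exists e0 et2.
have [B [m1 [m2 [Bs [m1c m2c] Bd [m0 [im1 im2]] [B01 Bout B1 m1out m2out]]]]] := cutoff_exists e0 eb2.
have Ac := smooth_cont (As 0%N); have Bc := smooth_cont (Bs 0%N).
have eta0' := ltW eta0; have C10' := ltW C10; have C20' := ltW C20.
have near1 (s d x : R) (k : R -> R) : e <= d ->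
    (forall x, x <= s \/ s + e <= x -> k x = 0) -> k x != 0 -> `|x - s| < d.
  move=> ed kout kx; rewrite ltr_norml; apply/andP; split; rewrite ltNge; apply/negP => h;
    move/eqP: kx; apply; apply: kout; [left|right]; move: e0 ed h; clear; lra.
have near2 (s d x : R) (k : R -> R) : e <= d ->
    (forall x, x <= s - e \/ s <= x -> k x = 0) -> k x != 0 -> `|x - s| < d.
  move=> ed kout kx; rewrite ltr_norml; apply/andP; split; rewrite ltNge; apply/negP => h;
    move/eqP: kx; apply; apply: kout; [left|right]; move: e0 ed h; clear; lra.
have I1 := @kernel_time R w k1 B (U t1) t1 t2 a b t1 e eta C1 wc k1c Bc t12' e0 eb2 eta0' C10'
  (fun t => (k0 t).1) ik1 B01 B1 (Ud t1).
have {}I1 := I1 (fun x hx => C1P (t1, x) ltac:(by split => /=; rewrite in_itv/= ?lexx)).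
have {}I1 := I1 (fun t x hx kt => d1P t x (near1 _ _ _ _ ed1 k1out kt) hx).
have I2 := @kernel_time R w k2 B (U t2) t1 t2 a b t2 e eta C1 wc k2c Bc t12' e0 eb2 eta0' C10'
  (fun t => (k0 t).2) ik2 B01 B1 (Ud t2).
have {}I2 := I2 (fun x hx => C1P (t2, x) ltac:(by split => /=; rewrite in_itv/= ?lexx ?t12')).
have {}I2 := I2 (fun t x hx kt => d2P t x (near2 _ _ _ _ ed2 k2out kt) hx).
have J1 := @kernel_space R _ m1 A (V ^~ a) t1 t2 a b a e eta C2 fc m1c Ac ab' e0 et2 eta0' C20'
  (fun t => (m0 t).1) im1 A01 A1 (Vd ^~ a).
have {}J1 := J1 (fun t ht => C2P (t, a) ltac:(by split => /=; rewrite in_itv/= ?lexx ?ab')).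
have {}J1 := J1 (fun t x ht kx => d3P x t (near1 _ _ _ _ ed3 m1out kx) ht).
have J2 := @kernel_space R _ m2 A (V ^~ b) t1 t2 a b b e eta C2 fc m2c Ac ab' e0 et2 eta0' C20'
  (fun t => (m0 t).2) im2 A01 A1 (Vd ^~ b).
have {}J2 := J2 (fun t ht => C2P (t, b) ltac:(by split => /=; rewrite in_itv/= ?lexx ?ab')).
have {}J2 := J2 (fun t x ht kx => d4P x t (near2 _ _ _ _ ed4 m2out kx) ht).
have GG := integral_deficit mg0 g0M Ac Bc e0 et2 eb2 A01 A1 B01 B1.
move: I1 I2 J1 J2 GG.
set I1 := (X in `|X - (U t1 b - _)|); set I2 := (X in `|X - (U t2 b - _)|).
set J1 := (X in `|X - (V t2 a - _)|); set J2 := (X in `|X - (V t2 b - _)|).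
set G := (X in `|X - G0|) => hI1 hI2 hJ1 hJ2 hG.
(* The weak formulation for [tensor A B], split into the four sides and the source. *)
have tot : I1 - I2 + (J1 - J2) + G = 0.
  have cI1 := continuous_mul wc2 (continuous_tensor k1c Bc).
  have cI2 := continuous_mul wc2 (continuous_tensor k2c Bc).
  have cJ1 := continuous_mul fc2 (continuous_tensor Ac m1c).
  have cJ2 := continuous_mul fc2 (continuous_tensor Ac m2c).
  have mAB := continuous_measurable2 (continuous_tensor Ac Bc).
  have cI : continuous (fun z : R * R => w z.1 z.2 * tensor k1 B z - w z.1 z.2 * tensor k2 B z).
    by move=> z; apply: cvgB; [exact: cI1|exact: cI2].
  have cJ : continuous (fun z : R * R => f (w z.1 z.2) * tensor A m1 z - f (w z.1 z.2) * tensor A m2 z).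
    by move=> z; apply: cvgB; [exact: cJ1|exact: cJ2].
  have cIJ : continuous (fun z : R * R => w z.1 z.2 * tensor k1 B z - w z.1 z.2 * tensor k2 B z +
     (f (w z.1 z.2) * tensor A m1 z - f (w z.1 z.2) * tensor A m2 z)).
    by move=> z; apply: cvgD; [exact: cI|exact: cJ].
  have int := fun F (c : continuous F) => continuous_rect_integrable c t12' ab'.
  have iG : (leb2 R).-integrable (rect t1 t2 a b) (EFin \o (fun z => g0 z * tensor A B z)).
    apply: (@rect_integrable R t1 t2 a b M) => //; first exact: measurable_funM.
    move=> z _; rewrite normrM -[leRHS]mulr1; apply: ler_pM => //.
    have /andP[A0 A1'] := A01 z.1; have /andP[B0 B1'] := B01 z.2.
    by rewrite /tensor ger0_norm ?mulr_ge0//; rewrite -[leRHS]mulr1 ler_pM.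
  rewrite /I1 /I2 /J1 /J2 /G -(RintegralB mQ (int _ cI1) (int _ cI2)).
  rewrite -(RintegralB mQ (int _ cJ1) (int _ cJ2)) -(RintegralD mQ (int _ cI) (int _ cJ)).
  rewrite -(RintegralD mQ (int _ cIJ) iG).
  have := sol _ (tensor_test As Bs Aout Bout sub).
  have dtE z : dt (tensor A B) z = (k1 z.1 - k2 z.1) * B z.2.
    by rewrite /dt; have [_ ->] := tensor_dt B (der_is_derive (Ad z.1)).
  have dxE z : dx (tensor A B) z = A z.1 * (m1 z.2 - m2 z.2).
    by rewrite /dx; have [_ ->] := tensor_dx A (der_is_derive (Bd z.2)).
  rewrite /Rintegral => sol0; rewrite (_ : (\int[leb2 R]_(z in rect t1 t2 a b) _)%E = 0%E)//.
  rewrite -[RHS]sol0; set F0 := fun z : R * R => w z.1 z.2 * tensor k1 B z - w z.1 z.2 * tensor k2 B z +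
     (f (w z.1 z.2) * tensor A m1 z - f (w z.1 z.2) * tensor A m2 z).
  have mF0 := continuous_measurable2 cIJ.
  transitivity (\int[leb2 R]_(z in rect t1 t2 a b) (F0 z + (g \_ Omega) z * tensor A B z)%:E)%E.
    apply: ae_eq_integral => //.
    - by apply/measurable_EFinP/measurable_funTS/measurable_funD => //; exact: measurable_funM.
    - by apply/measurable_EFinP/measurable_funTS/measurable_funD => //; exact: measurable_funM.
    - move: gg0 => [N [mN N0 NP]]; exists N; split => //; apply: subset_trans NP => z /=.
      by apply: contra_not => gz _; rewrite gz.
  rewrite integral_mkcond [RHS]integral_mkcond; apply: eq_integral => z _.
  rewrite /patch dtE dxE; case: ifPn => [/set_mem zQ|zQ].
    rewrite (mem_set (sub _ zQ)) uw// /F0 /tensor; congr (_%:E); ring.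
  case: ifPn => // zO; rewrite /tensor; congr (_%:E); apply/esym.
  (* Outside the rectangle the point lies beyond one of its sides, where the corresponding cutoff
     and both of its kernels vanish. *)
  have [hz|hz] : (z.1 <= t1 \/ t2 <= z.1) \/ (z.2 <= a \/ b <= z.2).
    have [h1|h1] := leP z.1 t1; first by left; left.
    have [h2|h2] := leP t2 z.1; first by left; right.
    have [h3|h3] := leP z.2 a; first by right; left.
    have [h4|h4] := leP b z.2; first by right; right.
    by exfalso; move/negP: zQ; apply; apply/mem_set; split => /=; rewrite in_itv/= !ltW.
  - rewrite (Aout _ hz) k1out ?k2out ?subrr ?mul0r ?mulr0 ?addr0//.
      by case: hz => hz; [left|right]; move: hz e0 et2; clear; lra.
    by case: hz => hz; [left|right]; move: hz e0 et2; clear; lra.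
  - rewrite (Bout _ hz) m1out ?m2out ?subrr ?mul0r ?mulr0 ?addr0//.
      by case: hz => hz; [left|right]; move: hz e0 eb2; clear; lra.
    by case: hz => hz; [left|right]; move: hz e0 eb2; clear; lra.
have -> : excess U V t1 t2 a b - G0 = (I1 - (U t1 b - U t1 a)) - (I2 - (U t2 b - U t2 a)) +
    (J1 - (V t2 a - V t1 a)) - (J2 - (V t2 b - V t1 b)) + (G - G0).
  by move: tot; rewrite /excess; clear; lra.
have M2 : 0 <= M * ((t2 - t1 + (b - a)) * 2).
  by rewrite mulr_ge0// mulr_ge0// addr_ge0// subr_ge0.
have {}hG : `|G - G0| <= M * ((t2 - t1 + (b - a)) * 2) * eta.
  by apply: (le_trans hG); rewrite !mulrA ler_wpM2l// -mulrA.
have step (C X Y : R) : 0 <= C -> `|X| <= Y + C * (2 * e) -> `|X| <= Y + C * 2 * eta.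
  by move=> C0 /le_trans; apply; rewrite lerD2l mulrA ler_wpM2l// mulr_ge0.
move: hI1 hI2 hJ1 hJ2 hG => /(step _ _ _ C10') + /(step _ _ _ C10') + /(step _ _ _ C20') +
  /(step _ _ _ C20').
rewrite (_ : K * eta = (eta * (b - a) + C1 * 2 * eta) + (eta * (b - a) + C1 * 2 * eta) +
  (eta * (t2 - t1) + C2 * 2 * eta) + (eta * (t2 - t1) + C2 * 2 * eta) +
  M * ((t2 - t1 + (b - a)) * 2) * eta); last by rewrite /K; ring.
have tri (i1 i2 j1 j2 h n1 n2 n3 n4 n5 : R) : `|i1| <= n1 -> `|i2| <= n2 -> `|j1| <= n3 ->
    `|j2| <= n4 -> `|h| <= n5 -> `|i1 - i2 + j1 - j2 + h| <= n1 + n2 + n3 + n4 + n5.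
  by rewrite !ler_norml; clear; lra.
exact: tri.
Qed.
(** * Almost every point *)

Lemma avoid_open (R : realType) (w : R -> R -> R) (v y s t : R) : cont2 w -> 0 <= s ->
  (forall x, `|x - y| <= s -> w t x != v) ->
  exists2 d : R, 0 < d & forall t', `|t' - t| < d -> forall x, `|x - y| <= s -> w t' x != v.
Proof.
move=> wc s0 av.
have ab : y - s <= y + s by move: s0; clear; lra.
have wn : continuous (fun x : R => `|w t x - v|).
  by move=> x; exact: (cvg_norm (cvgB (@cont2_snd R w t wc x) (cvg_cst v))).
have wcon := @continuous_subspaceT _ _ `[y - s, y + s]%classic _ wn.
have [c cI cmin] := EVT_min ab wcon.
have inI x : `|x - y| <= s -> x \in `[y - s, y + s].
  by rewrite in_itv/= ler_norml; clear; lra.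
have mu0 : 0 < `|w t c - v|.
  rewrite normr_gt0 subr_eq0; apply: av; move: cI; rewrite in_itv/= ler_norml; clear; lra.
have [d d0 dP] := cont2_tube t wc (divr_gt0 mu0 (ltr0n _ 2)) ab.
exists d => // t' ht x hx; apply/eqP => E.
have := cmin _ (inI x hx); have xI := inI x hx; rewrite in_itv/= in xI.
have := dP t' x ht xI; rewrite E distrC; move: mu0; clear; lra.
Qed.

(* The exceptional set is Borel since the sets [O k n] below are open, and its
   slices are null by the Lebesgue density theorem. *)
Lemma slice_density (R : realType) (w : R -> R -> R) (v : R) : cont2 w ->
  {ae leb2 R, forall z : R * R, w z.1 z.2 = v -> forall eta : R, 0 < eta ->
    exists2 d : R, 0 < d & forall y, 0 < `|y - z.2| < d ->
      exists2 x, w z.1 x = v & `|x - y| <= eta * `|y - z.2|}.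
Proof.
move=> wc.
(* Points with, at distance less than [1 / (n + 1)] in their slice, the centre of an interval free
   of the value [v] whose radius exceeds the fraction [1 / (k + 1)] of that distance. Failure of the
   claim means membership for one [k] and all [n]. *)
pose O (k n : nat) : set (R * R) := [set z | exists y s : R,
  [/\ 0 < s, forall x, `|x - y| <= s -> w z.1 x != v, 0 < `|y - z.2| < n.+1%:R^-1 &
      `|y - z.2| < k.+1%:R * s]].
have oO k n : open (O k n).
  rewrite openE => z [y [s [s0 av /andP[h0 hn] hk]]].
  have [d1 d10 d1P] := avoid_open wc (ltW s0) av.
  have [d2 d20] := @pos_le_all R [:: `|y - z.2|; n.+1%:R^-1 - `|y - z.2|; k.+1%:R * s - `|y - z.2|]
    ltac:(by rewrite /= h0 !subr_gt0 hn hk).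
  rewrite /= andbT => /and3P[e1 e2 e3].
  exists (ball z.1 d1, ball z.2 d2) => /=; first by split; exact: nbhsx_ballx.
  move=> p [/= hp1 hp2]; exists y, s.
  have hp : `| `|y - p.2| - `|y - z.2| | < d2.
    apply: (le_lt_trans (ler_dist_dist _ _)).
    rewrite (_ : y - p.2 - (y - z.2) = z.2 - p.2); last by ring.
    exact: hp2.
  rewrite ltr_norml in hp.
  have gen (a b d c : R) : - d < a - b < d -> d <= b -> d <= c - b -> 0 < a < c.
    by clear; lra.
  have gen' (a b d c : R) : - d < a - b < d -> d <= c - b -> a < c by clear; lra.
  split => //.
  - by apply: d1P; rewrite distrC; exact: hp1.
  - exact: gen hp e1 e2.
  - exact: gen' hp e3.
pose S := [set z : R * R | w z.1 z.2 = v].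
have mS : measurable (S : set (plane R)).
  rewrite (_ : S = setT `&` (fun z => w z.1 z.2) @^-1` [set v]).
    by apply: (continuous_measurable2 (cont2_continuous wc)).
  by rewrite setTI.
pose N k := S `&` \bigcap_n O k n.
have mN k : measurable (N k : set (plane R)).
  apply: measurableI => //; apply: bigcapT_measurable => n.
  exact: open_measurable2.
suff nN k : (leb2 R).-negligible (N k).
  apply: negligibleS (negligible_bigcup nN) => z /= /not_implyP[Sz].
  move=> /existsNP[eta /not_implyP[eta0 nex]].
  have ke : 1 < (Num.truncn eta^-1).+1%:R * eta.
    by rewrite -ltr_pdivrMr// div1r truncnS_gt.
  exists (Num.truncn eta^-1) => //; split => // n _.
  apply: contrapT => nO; apply: nex; exists n.+1%:R^-1; first by rewrite invr_gt0 ltr0n.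
  move=> y /andP[y0 yn]; apply: contrapT => nx; apply: nO.
  exists y, (eta * `|y - z.2|); split.
  - exact: mulr_gt0.
  - by move=> x hx; apply/eqP => xv; apply: nx; exists x.
  - by rewrite y0.
  - by rewrite mulrA -[ltLHS]mul1r ltr_pM2r.
exists (N k); split => //.
rewrite [LHS](_ : _ = \int[lebesgue_measure]_t lebesgue_measure (xsection (N k) t))%E//.
apply: integral0_eq => t _.
pose St : set (measurableTypeR R) := [set x | w t x = v].
have mSt : measurable St.
  rewrite (_ : St = setT `&` w t @^-1` [set v]); last by rewrite setTI.
  by apply: (continuous_measurable_fun (@cont2_snd R w t wc)).
have [N1 [mN1 N10 N1P]] := lebesgue_density mSt.
have mX : measurable (xsection (N k) t) by exact: measurable_xsection (mN k).
apply: (@subset_measure0 _ _ _ (@lebesgue_measure R) _ _ mX mN1 _ N10).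
move=> x; rewrite /xsection/= inE => -[xS xO]; apply: N1P => /= cv.
have xSt : St x by [].
rewrite indicE mem_set// in cv.
(* In the ball of radius [2 * h] about [x], the ball of radius [h / (k + 1)] about [y] misses the
   slice; its share of the length is [1 / (2 * (k + 1))]. *)
pose th : R := 1 - (2 * k.+1%:R)^-1.
have k0 : 0 < k.+1%:R :> R by rewrite ltr0n.
have th1 : (th%:E < 1%:E)%E by rewrite lte_fin ltrBlDr ltrDl invr_gt0 mulr_gt0.
have nb : nbhs (1%:E : \bar R) [set y | (th%:E < y)%E].
  by apply: open_nbhs_nbhs; split => //; exact: open_ereal_gt_ereal.
have [rho rho0 rhoP] := cv _ nb.
have [n nrho] : exists n : nat, n.+1%:R^-1 < rho / 2.
  exists (Num.truncn (rho / 2)^-1).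
  rewrite -[ltRHS]invrK ltf_pV2 ?posrE ?invr_gt0 ?divr_gt0// ?ltr0n//.
  exact: truncnS_gt.
have [y [s [s0 av /andP[h0 hn] hk]]] := xO n I.
rewrite /= in av h0 hn hk.
have [h hE] : exists h : R, h = `|y - x| by exists `|y - x|.
rewrite -hE in h0 hn hk.
have h20 : 0 < 2 * h by rewrite mulr_gt0.
have : (th%:E < lebesgue_measure (St `&` ball x (2 * h)) *
    (lebesgue_measure (ball x (2 * h)))^-1)%E.
  apply: rhoP => //=; rewrite sub0r normrN gtr0_norm//.
  by rewrite mulrC -ltr_pdivlMr//; exact: lt_trans nrho.
rewrite lebesgue_measure_ball; last exact: ltW.
have [s' s'E] : exists s' : R, s' = h / k.+1%:R by exists (h / k.+1%:R).
have s'0 : 0 < s' by rewrite s'E divr_gt0.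
have s's : s' < s by rewrite s'E ltr_pdivrMr// mulrC.
have s'h : s' <= h by rewrite s'E ler_pdivrMr// ler_peMr ?(ltW h0)// ler1n.
set X := St `&` _.
have mX' : measurable (X : set (measurableTypeR R)).
  by apply: measurableI => //; exact: measurable_ball.
have mY : measurable (ball y s' : set (measurableTypeR R)) by exact: measurable_ball.
have XY : (lebesgue_measure X + lebesgue_measure (ball y s') <= lebesgue_measure (ball x (2 * h)))%E.
  rewrite -measureU//; last first.
    apply/seteqP; split => // q [[qS _] /ltW]; rewrite distrC => hq.
    by have := av q (le_trans hq (ltW s's)); rewrite qS eqxx.
  apply: le_outer_measure => q [[] //|]; rewrite /ball/= => hq.
  rewrite (_ : x - q = (x - y) + (y - q)); last by ring.
  apply: (le_lt_trans (ler_normD _ _)); rewrite (distrC x) -hE.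
  by move: hq s'h; clear; lra.
move: XY; rewrite !lebesgue_measure_ball; [|exact: ltW|exact: ltW].
have [a ->] : exists a : R, lebesgue_measure X = a%:E.
  exists (fine (lebesgue_measure X)); rewrite fineK// ge0_fin_numE//.
  apply: (@le_lt_trans _ _ (lebesgue_measure (ball x (2 * h)))).
    by apply: le_outer_measure => q [].
  by rewrite lebesgue_measure_ball ?ltry// ltW.
have h40 : 0 < 2 * h *+ 2 by rewrite pmulrn_lgt0.
rewrite inver gt_eqF// -EFinD -EFinM !(lee_fin, lte_fin) => h1.
rewrite ltr_pdivlMr// ltNge => /negP; apply.
apply: (@le_trans _ _ (2 * h *+ 2 - s' *+ 2)); first by move: h1; clear; lra.
rewrite le_eqVlt; apply/orP; left; apply/eqP; rewrite /th s'E; field.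
by rewrite gt_eqF.
Qed.

(** * From density points to a nearly constant source *)

Lemma excess_degenerate (R : realType) (U V : R -> R -> R) (t1 t2 a b : R) :
  t1 = t2 \/ a = b -> excess U V t1 t2 a b = 0.
Proof. by move=> [->|->]; rewrite /excess; ring. Qed.

(* [H s] is proportional to the measure of the part of [B `\` E] with time at most [s]. *)
Lemma density_balance (R : realType) (B E : set (R * R)) (g : R * R -> R)
    (U V : R -> R -> R) (q e M K : R) :
  measurable (B : set (plane R)) ->
  measurable (E : set (plane R)) ->
  measurable_fun setT (g : plane R -> measurableTypeR R) ->
  (forall z, `|g z| <= M) -> 0 <= e -> (forall z, E z -> `|g z - q| <= e) ->
  (leb2 R (B `\` E) <= K%:E)%E ->
  (forall t1 t2 a b, t1 < t2 -> a < b -> rect t1 t2 a b `<=` B ->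
     excess U V t1 t2 a b = \int[leb2 R]_(z in rect t1 t2 a b) g z) ->
  exists H : R -> R, [/\ {homo H : x y / x <= y},
    forall s s', H s' - H s <= (M + `|q|) * K &
    balance (fun t x => B (t, x)) U V (q - e) (q + e) H].
Proof.
move=> mB mE mg gM e0 gq DK exc; set C := M + `|q|.
have M0 : 0 <= M := le_trans (normr_ge0 _) (gM (0, 0)).
have C0 : 0 <= C by rewrite addr_ge0.
pose D (s : R) : set (R * R) := (B `\` E) `&` [set p | p.1 <= s].
have mhalf (s : R) : measurable ([set p | p.1 <= s] : set (plane R)).
  rewrite (_ : [set p | _] = `]-oo, s]%classic `*` setT).
    by apply: measurableX => //; exact: measurable_itv.
  by apply/seteqP; split => [p /= h|p [/= + _]]; rewrite ?in_itv//= in_itv.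
have mD s : measurable (D s : set (plane R)).
  by apply: measurableI => //; apply: measurableD.
have DK' s : (leb2 R (D s) <= K%:E)%E.
  apply: (@le_trans _ _ (leb2 R (B `\` E))) => //; apply: le_measure.
  - by rewrite inE; exact: mD.
  - by rewrite inE; exact: measurableD.
  - by move=> p [].
have Dfin s : exists2 m : R, leb2 R (D s) = m%:E & 0 <= m <= K.
  exists (fine (leb2 R (D s))).
    rewrite fineK// ge0_fin_numE ?measure_ge0//.
    by apply: le_lt_trans (DK' s) _; rewrite ltry.
  rewrite fine_ge0 ?measure_ge0//= -lee_fin fineK//.
  rewrite ge0_fin_numE ?measure_ge0//.
  by apply: le_lt_trans (DK' s) _; rewrite ltry.
pose m s := fine (leb2 R (D s)).
have mE' s : leb2 R (D s) = (m s)%:E by rewrite /m; have [k -> _] := Dfin s.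
have m0 s : 0 <= m s <= K by rewrite /m; have [k -> //] := Dfin s.
exists (fun s => C * m s); split.
- move=> s s' ss'; apply: ler_wpM2l => //; rewrite -lee_fin -!mE'.
  apply: le_measure; rewrite ?inE; [exact: mD|exact: mD|].
  by move=> p [h1 h2]; split => //=; exact: le_trans h2 ss'.
- move=> s s'; rewrite -mulrBr; apply: ler_wpM2l => //.
  by have := m0 s; have := m0 s'; clear; lra.
move=> t1 t2 a b t12 ab rin; rewrite -mulrBr.
have mmono : m t1 <= m t2.
  rewrite -lee_fin -!mE'; apply: le_measure; rewrite ?inE; [exact: mD|exact: mD|].
  by move=> p [h1 h2]; split => //=; exact: le_trans h2 t12.
have key : `|excess U V t1 t2 a b - q * ((b - a) * (t2 - t1))| <=
    e * ((b - a) * (t2 - t1)) + C * (m t2 - m t1); last first.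
  by move: key; rewrite ler_norml !mulrDl mulNr; clear; lra.
have [dg|[t12' ab']] : (t1 = t2 \/ a = b) \/ (t1 < t2 /\ a < b).
  have [?|?|?] := ltgtP t1 t2; [|by move: t12; rewrite leNgt => /negP|by left; left].
  have [?|?|?] := ltgtP a b; [by right|by move: ab; rewrite leNgt => /negP|by left; right].
- have -> : (b - a) * (t2 - t1) = 0.
    by case: dg => ->; rewrite subrr ?mulr0 ?mul0r.
  by rewrite excess_degenerate// !mulr0 subrr normr0 add0r mulr_ge0// subr_ge0.
have rB : rect t1 t2 a b `<=` B.
  by move=> [t x] [/= h1 h2]; rewrite !in_itv/= in h1 h2; exact: rin.
rewrite exc//.
have mQ := measurable_rect t1 t2 a b.
have area := leb2_rect_itv t12 ab.
have iq : (leb2 R).-integrable (rect t1 t2 a b) (EFin \o cst q).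
  by apply: (@rect_integrable R _ _ _ _ `|q|) => //; exact: measurable_cst.
have qE : q * ((b - a) * (t2 - t1)) = \int[leb2 R]_(z in rect t1 t2 a b) q.
  by rewrite Rintegral_cst//; have /= -> := area; rewrite /= (mulrC (b - a)).
rewrite qE.
have mCE : measurable (~` E : set (plane R)).
  exact: measurableC.
have mi : measurable_fun setT (\1_(~` E) : plane R -> R).
  exact: measurable_indic.
have ii : (leb2 R).-integrable (rect t1 t2 a b) (EFin \o \1_(~` E)).
  apply: (@rect_integrable R _ _ _ _ 1) => // z _.
  by rewrite indicE; case: (_ \in _); rewrite ?normr1// normr0.
have ie : (leb2 R).-integrable (rect t1 t2 a b) (EFin \o cst e).
  by apply: (@rect_integrable R _ _ _ _ `|e|) => //; exact: measurable_cst.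
apply: (@le_trans _ _ (\int[leb2 R]_(z in rect t1 t2 a b) (e + C * \1_(~` E) z))).
  apply: Rintegral_close => //.
  - by apply: (@rect_integrable R _ _ _ _ M).
  - by have := integrableD mQ ie (integrableZl mQ C ii).
  - move=> z _; rewrite indicE; have [zE|zE] := pselect (E z).
      rewrite memNset ?mulr0 ?addr0; first exact: gq.
      by apply: contrapT => /contrapT h; apply: h.
    rewrite mem_set// mulr1; apply: (le_trans (ler_normB _ _)).
    by rewrite -[leLHS]add0r; apply: lerD => //; apply: lerD.
rewrite RintegralD//; last by have := integrableZl mQ C ii.
rewrite RintegralZl// Rintegral_cst//; have /= -> := area.
rewrite /= (mulrC (b - a)) lerD2l; apply: ler_wpM2l => //.
rewrite /Rintegral integral_indic//.
pose A := (B `\` E) `&` [set p | t1 < p.1 <= t2].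
have mA : measurable (A : set (plane R)).
  rewrite (_ : A = D t2 `\` D t1); first exact: measurableD.
  apply/seteqP; split => p; rewrite /A /D /=.
    by move=> [BE /andP[h1 h2]]; split => // -[_]; rewrite leNgt h1.
  by move=> [[BE h2] h1]; split => //; rewrite h2 andbT ltNge; apply/negP => h; apply: h1.
have DA : (leb2 R (D t1) + leb2 R A = leb2 R (D t2))%E.
  rewrite -measureU//; last first.
    by apply/seteqP; split => // p [[_ /= h1] [_ /= /andP[h2 _]]]; rewrite leNgt h2 in h1.
  congr (leb2 R _); apply/seteqP; split => p.
    move=> [[BE h]|[BE /andP[h1 h2]]]; split => //=; exact: le_trans h t12.
  move=> [BE h2]; have [h|h] := leP p.1 t1; [by left|right; split => //=].
  by rewrite h.
(* The set [A] omits the initial time [t1], so that increments of [m] add up; the omitted segment is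
   null. *)
have sub : (leb2 R (~` E `&` rect t1 t2 a b) <= leb2 R A)%E.
  have l0 : leb2 R (rect t1 t1 a b) = 0%E.
    by rewrite leb2_rect_itv// subrr mul0r.
  rewrite -[leRHS]add0e -l0; apply: (@le_trans _ _ (leb2 R (rect t1 t1 a b `|` A))).
    apply: le_measure; rewrite ?inE.
    - exact: measurableI.
    - by apply: measurableU => //; exact: measurable_rect.
    move=> [t x] [nE rtx]; have := rtx => -[/= ht hx].
    rewrite in_itv/= in ht; case/andP: ht; rewrite le_eqVlt => /orP[/eqP t1t|t1t] tt2.
      by left; split => //=; rewrite -t1t in_itv/= lexx.
    by right; split; [split => //; exact: rB|rewrite /= t1t].
  by apply: measureU2 => //; exact: measurable_rect.
have [k kE] : exists k, leb2 R A = k%:E.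
  exists (fine (leb2 R A)); rewrite fineK// ge0_fin_numE ?measure_ge0//.
  apply: (@le_lt_trans _ _ (leb2 R (D t2))); last by rewrite mE' ltry.
  by rewrite -DA leeDr// measure_ge0.
have mk : m t2 - m t1 = k.
  by move: DA; rewrite !mE' kE -EFinD => -[<-]; rewrite addrAC subrr add0r.
rewrite mk -lee_fin fineK ?kE -?kE//.
rewrite ge0_fin_numE ?measure_ge0//.
by apply: (le_lt_trans sub); rewrite kE ltry.
Qed.

Lemma ae_forall_count d (T : measurableType d) (R : realType) (mu : {measure set T -> \bar R})
    (I : countType) (P : I -> T -> Prop) :
  (forall i, {ae mu, forall x, P i x}) -> {ae mu, forall x, forall i, P i x}.
Proof.
move=> h; pose Q (n : nat) (x : T) := if unpickle n is Some i then P i x else True.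
have /ae_foralln : forall n, {ae mu, forall x, Q n x}.
  by move=> n; rewrite /Q; case: unpickle => [i|]; [exact: h|exact: aeW].
move=> [A [mA A0 AP]]; exists A; split => //; apply: subset_trans AP => x /=.
by apply: contra_not => hQ i; have := hQ (pickle i); rewrite /Q pickleK.
Qed.

(** The density theorem is applied to the countably many sets [E q n], where [g] is within
    [1 / (n + 1)] of the rational [q]. At a given point [n] is dictated by [e] and [q] by the value
    of [g]; off [E q n] the source is only bounded, and [density_balance] charges that part to
    [H]. *)
Lemma convex_ae (R : realType) (tc xc rho M L m m2 c de M0 : R) (f f1 : R -> R)
    (u U V : R -> R -> R) (g : R * R -> R) :
  convex_sol tc xc rho M L m m2 c de f f1 u U V -> 0 <= m2 ->
  measurable_fun setT (g : plane R -> measurableTypeR R) ->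
  (forall z, `|g z| <= M0) ->
  (forall t1 t2 a b, t1 < t2 -> a < b -> rect_in (box tc xc rho) t1 t2 a b ->
     excess U V t1 t2 a b = \int[leb2 R]_(z in rect t1 t2 a b) g z) ->
  {ae leb2 R, forall z : R * R, box tc xc (rho / 4) z.1 z.2 ->
    forall e : R, 0 < e -> exists2 d : R, 0 < d & forall y,
      `|y - z.2| < d -> `|u z.1 y - u z.1 z.2| ^+ 2 <= e * `|y - z.2|}.
Proof.
move=> cs m20 mg gM exc.
have rho0 := cs_rho cs; have M1 := cs_M cs; have m0 := cs_m cs.
have L0 : 0 <= L := le_trans (normr_ge0 _) (cs_L cs 0 0).
have M00 : 0 <= M0 := le_trans (normr_ge0 _) (gM (0, 0)).
pose K : set (R * R) := [set z | box tc xc (rho / 4) z.1 z.2].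
pose lam (z : R * R) := f1 (u z.1 z.2).
pose C := M + 1 + 8 * M * (1 + m2 * M) / m.
have C0 : 0 <= C.
  have : 0 <= 8 * M * (1 + m2 * M) / m.
    by rewrite divr_ge0 ?(ltW m0)// !mulr_ge0 ?addr_ge0 ?mulr_ge0// ltW.
  by rewrite /C; move: M1; clear; lra.
pose N := `|tc| + `|xc| + rho.
have [r1 [r10 r1a r1b]] : exists r : R, [/\ 0 < r, r <= rho / (16 * (L + 1)) & r <= 1].
  by apply: pos_le2 => //; rewrite divr_gt0// mulr_gt0// ltr_wpDl.
have r1L (r : R) : r < r1 -> r * (L + 1) < rho / 8.
  have L1 : 0 < L + 1 by rewrite ltr_wpDl.
  have := ler_wpM2r (ltW L1) r1a.
  rewrite (_ : rho / (16 * (L + 1)) * (L + 1) = rho / 16); last by field; rewrite gt_eqF.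
  by move=> h1 h2; have := ltr_pM2r L1 r r1; rewrite h2; move: rho0 h1; clear; lra.
have mK : measurable (K : set (plane R)).
  rewrite (_ : K = ball tc (rho / 4) `*` ball xc (rho / 4)).
    by apply: measurableX; exact: measurable_ball.
  by apply/seteqP; split => z [h1 h2]; split; rewrite /ball/= distrC.
have KN z : K z -> `|z.1| < N /\ `|z.2| < N.
  have := ler_norm tc; have := ler_norm (- tc); have := ler_norm xc; have := ler_norm (- xc).
  rewrite !normrN => h1 h2 h3 h4 [h5 h6]; move: h5 h6; rewrite !ltr_norml => h5 h6.
  by split; apply/andP; split; rewrite /N; move: h1 h2 h3 h4 h5 h6 rho0; clear; lra.
have N0 : 0 < N by rewrite ltr_wpDl// addr_ge0.
(* By [cs_spacetime], [u] and hence the slope vary by [O(r)] on a sheared box: the hypothesis that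
   lets the boxes engulf one another. *)
have Klam z r : K z -> 0 < r < r1 -> forall p, shear_box (lam z) z r p ->
    `|lam p - lam z| <= m2 * C * r.
  move=> [h1 h2] /andP[r0 rr1] p [h3 h4].
  have inc t x : c - 2 * de < u t x < c + 2 * de.
    by have := cs_u cs t x; have := normr_ge0 (u t x - c); rewrite ltr_norml; clear; lra.
  apply: (le_trans (cs_lip cs (inc _ _) (inc _ _))); rewrite -mulrA; apply: ler_wpM2l => //.
  apply: (cs_spacetime cs); rewrite ?(ltW h1) ?(ltW h2) ?(ltW h3) ?(ltW h4)//.
    exact: r1L.
  exact: le_trans (ltW rr1) r1b.
pose E (q : rat) (n : nat) := K `&` [set z | `|g z - ratr q| <= n.+1%:R^-1].
have mE q n : measurable (E q n : set (plane R)).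
  apply: measurableI => //.
  rewrite (_ : [set z | _] = setT `&` (fun z => `|g z - ratr q|) @^-1` `]-oo, n.+1%:R^-1]).
    have mf : measurable_fun setT (fun z : plane R => `|g z - ratr q|).
      by apply: measurableT_comp => //; apply: measurable_funB => //; exact: measurable_cst.
    by apply: mf => //; exact: measurable_itv.
  by rewrite setTI; apply/seteqP; split => z /=; rewrite in_itv.
have dens q n := sheared_density N0 (mulr_ge0 m20 C0) r10 KN Klam (mE q n) (@subIsetl _ _ _).
have := ae_forall_count (fun qn : rat * nat => dens qn.1 qn.2).
move=> [A [mA A0 AP]]; exists A; split => //; apply: subset_trans AP => z /=.
apply: contra_not => D Kz.
have [h1 h2] := Kz.
apply: (little_o cs m20 (ltW h1) (ltW h2)) => e e0.
have [n ne] : exists n : nat, n.+1%:R^-1 <= e.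
  exists (Num.truncn e^-1); rewrite -[leRHS]invrK lef_pV2 ?posrE ?invr_gt0// ?ltr0n//.
  exact/ltW/truncnS_gt.
have n0 : 0 < n.+1%:R^-1 :> R by rewrite invr_gt0 ltr0n.
have [q] := @rat_in_itvoo R (g z - n.+1%:R^-1) (g z + n.+1%:R^-1)
  ltac:(by rewrite ltrD2l gtrN).
rewrite in_itv/= => /andP[q1 q2].
have Ez : E q n z.
  split => //=; move: q1 q2 (ltW n0); move: (n.+1%:R^-1 : R) (g z) (ratr q) => x y w.
  by rewrite ler_norml; clear; lra.
exists (ratr q) => eta eta0.
pose c1 := M0 + `|ratr q| + 1 : R.
have c10 : 0 < c1 by rewrite ltr_wpDl// addr_ge0.
have [r0 r00 r0P] := D (q, n) Ez (eta / c1) (divr_gt0 eta0 c10).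
have [r2 [r20 r2a r2b]] := pos_le2 r00 r10.
exists r2 => // r /andP[rpos rr2].
have mB := open_measurable2 (shear_box_open (lam z) z r).
have [|H [H1 H2 H3]] := @density_balance R _ (E q n) g U V (ratr q) e M0 _ mB (mE q n) mg gM
  (ltW e0) (fun p Ep => le_trans Ep.2 ne) (r0P r ltac:(by rewrite rpos (lt_le_trans rr2))).
  move=> t1 t2 a b t12 ab sub; apply: exc => // t x ht hx.
  have [h3 h4] : shear_box (lam z) z r (t, x).
    by apply: sub; split; rewrite /= in_itv.
  have rr1 : r < r1 := lt_le_trans rr2 r2b.
  have rsq : r ^+ 2 <= r.
    by rewrite expr2 -[leRHS]mulr1 ler_pM2l// (le_trans (ltW rr1)).
  have lamr : `|lam z * (t - z.1)| <= L * r.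
    by rewrite normrM; apply: ler_pM => //; [exact: cs_L cs _ _|exact: ltW].
  have gen (z1 z2 y s q' : R) : `|z1 - tc| < rho / 4 -> `|z2 - xc| < rho / 4 -> `|t - z1| < s ->
      `|x - z2 - y| < q' -> `|y| <= L * s -> q' <= s -> s * (L + 1) < rho / 8 -> 0 <= L * s ->
      0 < s -> box tc xc rho t x.
    rewrite mulrDr mulr1 (mulrC s) /box !ltr_norml ler_norml.
    by move: (L * s) => Ls; move: rho0; clear; lra.
  by apply: (gen _ _ _ _ _ h1 h2 h3 h4 lamr rsq (r1L r rr1)) => //; rewrite mulr_ge0// ltW.
exists H; split => //.
- move=> s s'; apply: le_trans (H2 s s') _.
  rewrite (_ : (M0 + _) * _ = (M0 + `|ratr q|) / c1 * (eta * r ^+ 3)); last by ring.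
  rewrite -[leRHS]mul1r; apply: ler_wpM2r; first by rewrite mulr_ge0 ?exprn_ge0// ltW.
  by rewrite ler_pdivrMr// mul1r /c1; clear; lra.
Qed.
(** The nearest-point projection onto [[c - r, c + r]], used to extend [u] continuously from a box
    to the plane without enlarging its range. *)
Definition clamp (R : realType) (c r s : R) : R := Num.max (c - r) (Num.min (c + r) s).

Lemma clampP (R : realType) (c r s : R) : 0 < r ->
  [\/ s <= c - r /\ clamp c r s = c - r, c + r <= s /\ clamp c r s = c + r |
     c - r <= s <= c + r /\ clamp c r s = s].
Proof.
move=> r0; rewrite /clamp; have [h|h] := leP (c + r) s.
  by rewrite max_r; [apply: Or32|move: r0; clear; lra].
have [h'|h'] := leP (c - r) s; last by apply: Or31; rewrite ltW.
by apply: Or33; rewrite ltW.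
Qed.

Lemma clamp_in (R : realType) (c r s : R) : 0 < r -> `|clamp c r s - c| <= r.
Proof.
by move=> r0; have := clampP c s r0; rewrite ler_norml; move: r0; clear => r0 [] [h ->]; lra.
Qed.

Lemma clamp_id (R : realType) (c r s : R) : 0 < r -> `|s - c| <= r -> clamp c r s = s.
Proof.
by move=> r0; have := clampP c s r0; rewrite ler_norml; move: r0; clear => r0 [] [h ->]; lra.
Qed.

Lemma clamp_lip (R : realType) (c r s s' : R) : 0 < r ->
  `|clamp c r s - clamp c r s'| <= `|s - s'|.
Proof.
wlog ss : s s' / s <= s' => [W r0|r0].
  have [|/ltW h] := leP s s'; first by move=> h; exact: W.
  by rewrite distrC (distrC s); exact: W.
rewrite ler_norml ler0_norm ?subr_le0//.
have := clampP c s r0; have := clampP c s' r0.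
by move: ss r0; clear => ss r0 [] [h ->] [] [h' ->]; lra.
Qed.

(** The extension by clamping need not solve the equation outside the box, which is why the balance
    is asserted for rectangles in the box only. That every value of [w] is a value of [u] in the box
    transfers range conditions to the whole plane. *)
Lemma local_solution (R : realType) (f f1 : R -> R) (Omega : set (R * R))
    (u g g0 : R * R -> R) (M tc xc rho : R) :
  (forall w, der f w (f1 w)) -> continuous f1 -> open Omega ->
  {within Omega, continuous u} -> weak_solution Omega f u g ->
  measurable_fun setT (g0 : plane R -> measurableTypeR R) ->
  measurable_fun setT (g \_ Omega : plane R -> measurableTypeR R) ->
  (forall z, `|g0 z| <= M) -> {ae leb2 R, forall z, (g \_ Omega) z = g0 z} ->
  0 < rho -> (forall t x, `|t - tc| <= rho -> `|x - xc| <= rho -> Omega (t, x)) ->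
  exists w U V : R -> R -> R, [/\ conslaw f f1 w U V,
    forall t x, `|t - tc| <= rho -> `|x - xc| <= rho -> w t x = u (t, x),
    forall t x, exists t' x', [/\ `|t' - tc| <= rho, `|x' - xc| <= rho & w t x = u (t', x')] &
    forall t1 t2 a b, t1 < t2 -> a < b -> rect_in (box tc xc rho) t1 t2 a b ->
      excess U V t1 t2 a b = \int[leb2 R]_(z in rect t1 t2 a b) g0 z].
Proof.
move=> fd f1c oO uc sol mg0 mg g0M gg0 rho0 sub.
pose w t x := u (clamp tc rho t, clamp xc rho x).
have wE t x : `|t - tc| <= rho -> `|x - xc| <= rho -> w t x = u (t, x).
  by move=> ht hx; rewrite /w !clamp_id.
have wc : cont2 w.
  move=> t x e e0.
  have Oz := sub _ _ (clamp_in tc t rho0) (clamp_in xc x rho0).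
  have cu : {for (clamp tc rho t, clamp xc rho x), continuous u}.
    by move: uc; rewrite continuous_open_subspace// => /(_ _ (mem_set Oz)).
  have [d d0 dP] : exists2 d : R, 0 < d & forall p, `|p.1 - clamp tc rho t| < d ->
      `|p.2 - clamp xc rho x| < d -> `|u p - u (clamp tc rho t, clamp xc rho x)| < e.
    move/cvgrPdist_lt: cu => /(_ e e0)[[A B] /= [[d1 /= d10 d1A] [d2 /= d20 d2B]] AB].
    have [d [d0 dd1 dd2]] := pos_le2 d10 d20; exists d => // p h1 h2.
    rewrite distrC; apply: AB; split => /=.
      by apply: d1A; rewrite /= distrC; exact: lt_le_trans dd1.
    by apply: d2B; rewrite /= distrC; exact: lt_le_trans dd2.
  exists d => // t' x' h1 h2; apply: dP => /=.
    exact: le_lt_trans (clamp_lip _ _ _ rho0) h1.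
  exact: le_lt_trans (clamp_lip _ _ _ rho0) h2.
have fc : continuous f by move=> v; exact: der_cont (fd v).
have fwc : cont2 (fun t x => f (w t x)).
  move=> t x e e0; have := fc (w t x) => /cvgrPdist_lt /(_ e e0)[d /= d0 dP].
  have [d' d'0 d'P] := wc t x d d0; exists d' => // t' x' h1 h2.
  by rewrite distrC; apply: dP; rewrite /= distrC; exact: d'P.
have [U UP] := choice (fun t => primitive_exists (@cont2_snd R w t wc)).
have [V VP] := choice (fun x => primitive_exists (@cont2_fst R _ x fwc)).
exists w, U, (fun t x => V x t); split => //.
- split => //.
  + move=> v e e0; have := f1c v => /cvgrPdist_lt /(_ e e0)[d /= d0 dP].
    by exists d => // v' hv; rewrite distrC; apply: dP; rewrite /= distrC.
- by move=> t x; exists (clamp tc rho t), (clamp xc rho x); split => //; exact: clamp_in.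
- move=> t1 t2 a b t12 ab rin.
  have rsub z : rect t1 t2 a b z -> box tc xc rho z.1 z.2.
    by move=> [/= h1 h2]; rewrite !in_itv/= in h1 h2; exact: rin.
  apply: (@weak_excess R f w U (fun t x => V x t) Omega u g g0 M) => //.
    by move=> [t x] /rsub[h1 h2]; apply: sub; exact: ltW.
  by move=> [t x] /rsub[h1 h2] /=; rewrite wE// ltW.
Qed.
Lemma balance_bounded (R : realType) (tc xc rho M0 M : R) (U V : R -> R -> R) (g : R * R -> R) :
  measurable_fun setT (g : plane R -> measurableTypeR R) ->
  (forall z, `|g z| <= M0) -> M0 <= M ->
  (forall t1 t2 a b, t1 < t2 -> a < b -> rect_in (box tc xc rho) t1 t2 a b ->
     excess U V t1 t2 a b = \int[leb2 R]_(z in rect t1 t2 a b) g z) ->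
  balance (box tc xc rho) U V (- M) M (fun=> 0).
Proof.
move=> mg gM MM exc.
have M00 : 0 <= M0 := le_trans (normr_ge0 _) (gM (0, 0)).
move=> t1 t2 a b t12 ab rin; rewrite subrr subr0 addr0 mulNr -ler_norml.
have A0 : 0 <= (b - a) * (t2 - t1) by rewrite mulr_ge0// subr_ge0.
have [dg|[t12' ab']] : (t1 = t2 \/ a = b) \/ (t1 < t2 /\ a < b).
  have [?|?|?] := ltgtP t1 t2; [|by move: t12; rewrite leNgt => /negP|by left; left].
  have [?|?|?] := ltgtP a b; [by right|by move: ab; rewrite leNgt => /negP|by left; right].
  by rewrite excess_degenerate// normr0 mulr_ge0// (le_trans M00).
rewrite exc//; apply: (@le_trans _ _ (M0 * ((b - a) * (t2 - t1)))); last exact: ler_wpM2r.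
have mQ := measurable_rect t1 t2 a b.
have icst (k : R) : (leb2 R).-integrable (rect t1 t2 a b) (EFin \o cst k).
  by apply: (@rect_integrable R _ _ _ _ `|k|) => //; exact: measurable_cst.
have cstE (k : R) : \int[leb2 R]_(z in rect t1 t2 a b) k = k * ((b - a) * (t2 - t1)).
  by rewrite Rintegral_cst//; have /= -> := leb2_rect_itv t12 ab; rewrite /= (mulrC (b - a)).
have ig : (leb2 R).-integrable (rect t1 t2 a b) (EFin \o g).
  by apply: (@rect_integrable R _ _ _ _ M0).
have := Rintegral_close mQ ig (icst 0) (icst M0).
by rewrite !cstE mul0r subr0; apply => z _; rewrite subr0.
Qed.

(** The [l]-th power of the desired estimate, which postpones real exponents to
    [little_o_limsup]. *)
Definition little_o_at (R : realType) (l : nat) (u : R * R -> R) (z : R * R) : Prop :=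
  forall e : R, 0 < e -> exists2 d : R, 0 < d & forall y,
    `|y - z.2| < d -> `|u (z.1, y) - u z| ^+ l <= e * `|y - z.2|.

Lemma degenerate_ae (R : realType) (f : R -> R) (l : nat) (u U V : R -> R -> R)
    (v c tc xc rho M L : R) :
  (2 <= l)%N -> of_class_C l f -> 0 < c -> nonlinear_at l c f v ->
  conslaw f (derive1 f) u U V -> balance (box tc xc rho) U V (- M) M (fun=> 0) ->
  0 < M -> 0 < rho -> (forall t x, `|derive1 f (u t x)| <= L) ->
  {ae leb2 R, forall z : R * R, box tc xc (rho / 4) z.1 z.2 -> u z.1 z.2 = v ->
    little_o_at l (fun p => u p.1 p.2) z}.
Proof.
move=> l2 fC c0 nl cl bal M0 rho0 HL.
have L0 : 0 <= L := le_trans (normr_ge0 _) (HL 0 0).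
have [cc [de [cc0 de0 H]]] := holder_at_value l2 fC c0 nl.
have [A [mA A0 AP]] := slice_density v (cl_cont cl).
exists A; split => //; apply: subset_trans AP => z /=.
apply: contra_not => D [h1 h2] zv e e0.
(* The slice has a point within [eta * |y - z.2|] of [y], and the Hoelder bound from it loses the
   factor [8 * M / cc]. *)
have [eta [eta0 etae eta1]] : exists eta : R, [/\ 0 < eta, eta <= e * cc / (8 * M) & eta <= 1].
  by apply: pos_le2 => //; rewrite divr_gt0// mulr_gt0.
have [d1 d10 d1P] := D zv eta eta0.
have L1 : 0 < L + 1 by rewrite ltr_wpDl.
have [k [k0 kd kM]] : exists k : R, [/\ 0 < k, k <= de & k <= M * rho / (L + 1)].
  by apply: pos_le2 => //; rewrite divr_gt0// mulr_gt0.
have [d2 d20 d2P] := cl_cont cl z.1 z.2 k k0.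
have [d d0] := @pos_le_all R [:: d1; d2; rho / 16] ltac:(by rewrite /= d10 d20 divr_gt0).
rewrite /= andbT => /and3P[dd1 dd2 dd3]; exists d => // y yd; rewrite /=.
have [->|yz] := eqVneq y z.2.
  by rewrite !subrr normr0 mulr0 expr0n gtn_eqF ?(leq_trans _ l2).
have y0 : 0 < `|y - z.2| by rewrite normr_gt0 subr_eq0.
have [x xv xy] := d1P y ltac:(by rewrite y0 (lt_le_trans yd)).
have uyk : `|u z.1 y - v| < k.
  by rewrite -zv; apply: d2P; [rewrite subrr normr0|exact: lt_le_trans dd2].
have xy' : `|x - y| <= `|y - z.2|.
  by apply: (le_trans xy); rewrite -[leRHS]mul1r; apply: ler_wpM2r.
have near (a b s q : R) : `|a - xc| < rho / 4 -> `|b - a| < d -> `|s - b| <= q -> q < d ->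
    `|b - xc| <= rho / 2 /\ `|s - xc| <= rho / 2.
  rewrite !ltr_norml !ler_norml; move: dd3 rho0; clear => *.
  by split; apply/andP; split; lra.
have [yx xx] := near _ _ _ _ h2 yd xy' yd.
have := H u U V tc xc rho M L z.1 x y cl bal M0 rho0 HL
  ltac:(by apply: (le_trans (ltW h1)); move: rho0; clear; lra) xx yx xv
  (lt_le_trans uyk kd).
rewrite zv => h.
have {}h : cc * `|u z.1 y - v| ^+ l <= 8 * M * `|x - y|.
  by apply: h; rewrite -ler_pdivlMr//; exact: le_trans (ltW uyk) kM.
rewrite -(ler_pM2l cc0); apply: (le_trans h).
apply: (@le_trans _ _ (8 * M * (eta * `|y - z.2|))).
  by apply: ler_wpM2l => //; rewrite mulr_ge0// ltW.
rewrite !mulrA; apply: ler_wpM2r => //.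
apply: (@le_trans _ _ (8 * M * (e * cc / (8 * M)))).
  by apply: ler_wpM2l => //; rewrite mulr_ge0// ltW.
rewrite le_eqVlt; apply/orP; left; apply/eqP; field.
by rewrite gt_eqF.
Qed.
Definition convex_range (R : realType) (f1 : R -> R) (m m2 c de : R) : Prop :=
  [/\ 0 < m, 0 <= m2, 0 < de, strongly_increasing f1 m (c - 2 * de) (c + 2 * de) &
    forall a b, c - 2 * de < a < c + 2 * de -> c - 2 * de < b < c + 2 * de ->
      `|f1 a - f1 b| <= m2 * `|a - b|].

Lemma convex_range_ae (R : realType) (l : nat) (f f1 : R -> R) (w U V : R -> R -> R)
    (g : R * R -> R) (m m2 c de M0 tc xc rho : R) :
  (2 <= l)%N -> convex_range f1 m m2 c de -> conslaw f f1 w U V ->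
  (forall t x, `|w t x - c| < de) -> 0 < rho ->
  measurable_fun setT (g : plane R -> measurableTypeR R) ->
  (forall z, `|g z| <= M0) ->
  (forall t1 t2 a b, t1 < t2 -> a < b -> rect_in (box tc xc rho) t1 t2 a b ->
     excess U V t1 t2 a b = \int[leb2 R]_(z in rect t1 t2 a b) g z) ->
  {ae leb2 R, forall z : R * R, box tc xc (rho / 4) z.1 z.2 ->
    little_o_at l (fun p => w p.1 p.2) z}.
Proof.
move=> l2 [m0 m20 de0 inc lip] cl wcd rho0 mg gM exc.
pose L := `|f1 c| + m2 * de.
have L0 : 0 <= L by rewrite addr_ge0// mulr_ge0// ltW.
have ran t x : c - 2 * de < w t x < c + 2 * de.
  by have := wcd t x; rewrite ltr_norml; move: de0; clear; lra.
have HL t x : `|f1 (w t x)| <= L.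
  rewrite -[f1 (w t x)](subrK (f1 c)) addrC; apply: (le_trans (ler_normD _ _)).
  rewrite lerD2l; apply: (le_trans (lip _ _ (ran t x) _)); first by move: de0; clear; lra.
  by apply: ler_wpM2l => //; exact: ltW.
(* The bound on the source is enlarged by [k] precisely to ensure [cs_small]. *)
pose k := de * (L + 1) / rho.
have k0 : 0 < k by rewrite divr_gt0// mulr_gt0// ltr_wpDl.
have M00 : 0 <= M0 := le_trans (normr_ge0 _) (gM (0, 0)).
have bal : balance (box tc xc rho) U V (- (M0 + k)) (M0 + k) (fun=> 0).
  by apply: balance_bounded mg gM _ exc; rewrite lerDl ltW.
have cs : convex_sol tc xc rho (M0 + k) L m m2 c de f f1 w U V.
  split => //; first by rewrite ltr_wpDl.
  by rewrite mulrDl /k divfK ?gt_eqF// lerDr mulr_ge0// ltW.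
have [A [mA A0 AP]] := convex_ae cs m20 mg gM exc.
exists A; split => //; apply: subset_trans AP => z /=.
apply: contra_not => D bz e e0.
have [d1 d10 d1P] := D bz e e0.
have e1 : 0 < 1 / e by rewrite divr_gt0.
have [d [d0 dd1 dd2]] := pos_le2 d10 e1; exists d => // y yd /=.
(* As [d <= 1 / e], the increment is at most 1, so its power [l >= 2] is bounded by its square. *)
have pow (h : R) : 0 <= h -> h ^+ 2 <= e * `|y - z.2| -> h ^+ l <= e * `|y - z.2|.
  move=> h0 hh; apply: (le_trans _ hh).
  have h1 : h <= 1.
    rewrite -(@ler_pXn2r _ 2)// ?nnegrE// expr1n; apply: (le_trans hh).
    by rewrite mulrC -ler_pdivlMr//; apply: ltW; exact: lt_le_trans dd2.
  by apply: ler_wiXn2l => //; rewrite h0.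
by apply: pow => //; exact: d1P (lt_le_trans yd dd1).
Qed.

(** The lower bound of [flux_curvature] is positive on both sides of [v]. *)
Lemma derivable_isolated_zeros (R : realType) (f : R -> R) (l : nat) (v c : R) :
  (2 <= l)%N -> of_class_C l f -> 0 < c -> nonlinear_at l c f v ->
  exists2 d : R, 0 < d & forall v', `|v' - v| < d -> derive1n 2 f v' = 0 -> v' = v.
Proof.
move=> l2 fC c0 nl.
have [j [jl jv jmin]] := nonlinear_order l2 fC c0 nl.
have [t1 [c1 [d1 [ht1 c10 d10 H1]]]] := flux_curvature fC jl jv jmin (or_introl erefl).
have [t2 [c2 [d2 [ht2 c20 d20 H2]]]] := flux_curvature fC jl jv jmin (or_intror erefl).
have [d [d0 dd1 dd2]] := pos_le2 d10 d20; exists d => // v' vd f0.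
apply/eqP; apply: contraT => nv.
case: (ltgtP v v') nv => [lt _|lt _|//].
- have h : 0 < v' - v < d1.
    by rewrite subr_gt0 lt/=; apply: lt_le_trans dd1; exact: le_lt_trans (ler_norm _) vd.
  have := H1 _ h; rewrite (_ : v + 1 * (v' - v) = v'); last by ring.
  rewrite f0 mulr0.
  by rewrite leNgt mulr_gt0// exprn_gt0//; case/andP: h.
- have h : 0 < v - v' < d2.
    rewrite subr_gt0 lt/=; apply: lt_le_trans dd2.
    by rewrite distrC in vd; exact: le_lt_trans (ler_norm _) vd.
  have := H2 _ h; rewrite (_ : v + -1 * (v - v') = v'); last by ring.
  rewrite f0 mulr0.
  by rewrite leNgt mulr_gt0// exprn_gt0//; case/andP: h.
Qed.

Lemma convex_range_exists (R : realType) (f1 f2 : R -> R) (v : R) :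
  (forall w, der f1 w (f2 w)) -> continuous f2 -> 0 < f2 v ->
  exists m m2 de, convex_range f1 m m2 v de.
Proof.
move=> fd fc f0.
have := fc v => /cvgrPdist_lt /(_ _ (divr_gt0 f0 (ltr0n _ 2)))[d /= d0 dP].
have bd w : `|w - v| < d -> f2 v / 2 <= f2 w <= 2 * f2 v.
  move=> wd; have := dP w; rewrite /= distrC => /(_ wd); rewrite ltr_norml.
  by move: f0; clear; lra.
exists (f2 v / 2), (2 * f2 v), (d / 2).
have ran w : v - 2 * (d / 2) < w < v + 2 * (d / 2) -> `|w - v| < d.
  by rewrite ltr_norml; clear; lra.
split; rewrite ?divr_gt0 ?mulr_ge0 ?(ltW f0)//.
- move=> a b ha ab hb; apply: (@mono_der R f1 f2) => // y /andP[h1 h2].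
  have /bd/andP[] // : `|y - v| < d.
  by apply: ran; move: ha hb h1 h2; clear; lra.
- have K a b : a <= b -> v - 2 * (d / 2) < a -> b < v + 2 * (d / 2) ->
      `|f1 b - f1 a| <= 2 * f2 v * (b - a).
    move=> ab ha hb; have := @der_mvt R f1 f2 a b 0 (2 * f2 v) ab (fun y _ => fd y).
    rewrite mul0r subr0; apply => y /andP[h1 h2]; rewrite subr0.
    have /bd : `|y - v| < d by apply: ran; move: ha hb h1 h2; clear; lra.
    by rewrite ler_norml; move: f0; clear; lra.
  move=> a b /andP[a1 a2] /andP[b1 b2]; have [ab|/ltW ba] := leP a b.
    by rewrite distrC (distrC a) (ger0_norm (_ : 0 <= b - a)) ?subr_ge0//; exact: K.
  by rewrite (ger0_norm (_ : 0 <= a - b)) ?subr_ge0//; exact: K.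
Qed.
Lemma Linfty_bounded (R : realType) (D : set (R * R)) (g : R * R -> R) :
  Linfty D g -> exists (g0 : R * R -> R) (M : R),
  [/\ measurable_fun setT (g \_ D : plane R -> measurableTypeR R),
      measurable_fun setT (g0 : plane R -> measurableTypeR R),
      forall z, `|g0 z| <= M & {ae leb2 R, forall z, (g \_ D) z = g0 z}].
Proof.
rewrite /Linfty => /andP[mg fg].
have {}mg : measurable_fun setT
    (g \_ D : plane R -> measurableTypeR R).
  by move: mg; rewrite inE.
(* The norm of exponent [+oo] is the essential supremum only for a nonzero measure. *)
have pos : (0 < leb2 R setT)%E.
  apply: (@lt_le_trans _ _ (leb2 R (rect 0 1 0 1))).
    by rewrite leb2_rect_itv// !subr0 mulr1 lte_fin.
  by apply: le_measure; rewrite ?inE; [exact: measurable_rect|exact: measurableT|].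
move: fg; rewrite inE /= /finite_norm unlock pos.
set S := ess_sup _ _ => Soo.
have [M [M0 ae]] : exists M : R, 0 <= M /\ {ae leb2 R, forall z, `|(g \_ D) z| <= M}.
  exists `|fine S|; split; first exact: normr_ge0.
  have [A [mA A0 AP]] := ess_sup_ge (leb2 R) (abse \o (EFin \o g \_ D)).
  exists A; split => //; apply: subset_trans AP => z /=; apply: contra_not.
  rewrite -/S; case: S Soo => [s|//|] _ /=; last by rewrite leeNy_eq.
  by rewrite lee_fin => /le_trans; apply; exact: ler_norm.
(* Truncation at the essential bound makes the function bounded everywhere and changes it on a null
   set only. *)
exists (fun z => Num.max (- M) (Num.min M ((g \_ D) z))), M; split => //.
- apply: measurable_maxr; first exact: measurable_cst.
  by apply: measurable_minr => //; exact: measurable_cst.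
- by move=> z; rewrite ler_norml le_max lexx/= ge_max ge_min lexx/= andbT; move: M0; clear; lra.
- have [A [mA A0 AP]] := ae; exists A; split => //; apply: subset_trans AP => z /=.
  by apply: contra_not; rewrite ler_norml => /andP[h1 h2]; rewrite min_r// max_r.
Qed.

Lemma little_o_limsup (R : realType) (Omega : set (R * R)) (l : nat) (u : R * R -> R)
    (z : R * R) : (0 < l)%N -> open Omega -> Omega z -> little_o_at l u z ->
  limsup_quotient Omega l u z = 0%E.
Proof.
move=> l0 oO Oz lo; rewrite /limsup_quotient; apply/eqP; rewrite eq_le; apply/andP; split.
- apply/lee_addgt0Pr => e e0; rewrite add0e.
  have [d d0 dP] := lo (e ^+ l) (exprn_gt0 l e0).
  rewrite limf_esupE; apply: ge_ereal_inf.
  exists (ereal_sup [set (`|u (z.1, y) - u z| / `|y - z.2| `^ l%:R^-1)%:E |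
    y in [set y | y != z.2 /\ `|y - z.2| < d]]).
    exists [set y | y != z.2 /\ `|y - z.2| < d] => //.
    rewrite /within /=; exists d => // y /=; rewrite distrC => yd yz _.
    by split.
  apply/ereal_supP => _ [y [yz yd] <-]; rewrite lee_fin.
  have y0 : 0 < `|y - z.2| by rewrite normr_gt0 subr_eq0.
  rewrite ler_pdivrMr ?powR_gt0//.
  rewrite -(@ler_pXn2r _ l)// ?nnegrE ?mulr_ge0 ?powR_ge0 ?(ltW e0)//.
  rewrite exprMn (_ : (`|y - z.2| `^ l%:R^-1) ^+ l = `|y - z.2|); first exact: dP.
  by rewrite -powR_mulrn ?powR_ge0// -powRrM mulVf ?pnatr_eq0 -?lt0n// powRr1.
(* The quotients are nonnegative, but the limsup would be [-oo] along an improper filter; openness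
   of [Omega] provides admissible [y] arbitrarily close to [z.2]. *)
- apply: limf_esup_ge0; last by move=> y; rewrite lee_fin divr_ge0// powR_ge0.
  rewrite /within /= => -[d /= d0 dP].
  have [[A B] /= [nA nB] AB] : nbhs z Omega by apply: open_nbhs_nbhs.
  have [d' /= d'0 d'P] := nB.
  have [r [r0 rd rd']] := pos_le2 d0 d'0.
  have zr : `|z.2 - (z.2 + r / 2)| < r.
    by rewrite opprD addrA subrr sub0r normrN gtr0_norm ?divr_gt0//; move: r0; clear; lra.
  apply: (dP (z.2 + r / 2)) => /=.
  + exact: lt_le_trans rd.
  + by rewrite -subr_eq0 addrAC subrr add0r gt_eqF// divr_gt0.
  + apply: AB; split => /=; first exact: nbhs_singleton.
    by apply: d'P => /=; exact: lt_le_trans rd'.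
Qed.

(** * Reduction to countably many boxes *)

Lemma rational_box (R : realType) (z : R * R) (d : R) : 0 < d ->
  exists i : rat * rat * rat, [/\ 0 < ratr i.2 :> R,
    box (ratr i.1.1) (ratr i.1.2) (ratr i.2 / 4) z.1 z.2 &
    forall t x, `|t - ratr i.1.1| <= ratr i.2 -> `|x - ratr i.1.2| <= ratr i.2 ->
      `|t - z.1| < d /\ `|x - z.2| < d].
Proof.
move=> d0.
have [r] := @rat_in_itvoo R 0 (d / 2) ltac:(by rewrite divr_gt0).
rewrite in_itv/= => /andP[r0 rd].
have near (s : R) : exists q : rat, `|s - ratr q| < ratr r / 4.
  have [q] := @rat_in_itvoo R (s - ratr r / 4) (s + ratr r / 4)
    ltac:(by rewrite ltrD2l gtrN// divr_gt0).
  by rewrite in_itv/= => hq; exists q; rewrite ltr_norml; move: hq; clear; lra.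
have [p hp] := near z.1; have [q hq] := near z.2.
exists (p, q, r); split => // t x /=.
move: hp hq r0 rd; move: (ratr p) (ratr q) (ratr r) => p' q' r'.
rewrite !ltr_norml !ler_norml; clear => *; split; apply/andP; split; lra.
Qed.

Lemma little_o_at_local (R : realType) (l : nat) (u w : R * R -> R) (z : R * R) (r : R) :
  0 < r -> (forall y, `|y - z.2| < r -> w (z.1, y) = u (z.1, y)) ->
  little_o_at l w z -> little_o_at l u z.
Proof.
case: z => t x /= r0 wu lo e e0; have [d d0 dP] := lo e e0.
have [d' [d'0 dd dr]] := pos_le2 d0 r0; exists d' => // y /= yd.
have := dP y (lt_le_trans yd dd); rewrite /= !wu ?subrr ?normr0//.
exact: lt_le_trans dr.
Qed.

Lemma little_o_at_box (R : realType) (l : nat) (u : R * R -> R) (w : R -> R -> R)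
    (tc xc rho : R) (z : R * R) : 0 < rho ->
  (forall t x, `|t - tc| <= rho -> `|x - xc| <= rho -> w t x = u (t, x)) ->
  box tc xc (rho / 4) z.1 z.2 -> little_o_at l (fun p => w p.1 p.2) z -> little_o_at l u z.
Proof.
move=> rho0 wu [h1 h2]; apply: (@little_o_at_local R l u _ z (rho / 4)).
  by rewrite divr_gt0.
move=> y hy /=; apply: wu.
  by apply: ltW; apply: (lt_trans h1); move: rho0; clear; lra.
by move: h2 hy rho0; rewrite !ltr_norml ler_norml; clear; lra.
Qed.

Lemma box_quarter (R : realType) (tc xc rho t x : R) : box tc xc (rho / 4) t x ->
  `|t - tc| < rho /\ `|x - xc| < rho.
Proof.
move=> [h1 h2]; have := normr_ge0 (t - tc); move: h1 h2; clear => h1 h2 h3.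
by split; [apply: (lt_le_trans h1)|apply: (lt_le_trans h2)]; lra.
Qed.

Lemma ae_and d (T : measurableType d) (R : realType) (mu : {measure set T -> \bar R})
    (P Q : T -> Prop) :
  {ae mu, forall x, P x} -> {ae mu, forall x, Q x} -> {ae mu, forall x, P x /\ Q x}.
Proof.
move=> hP hQ; have := @ae_forall_count _ _ _ mu bool (fun b => if b then P else Q).
move=> /(_ (fun b => if b as b' return {ae mu, forall x, (if b' then P else Q) x} then hP else hQ)).
move=> [A [mA A0 AP]]; exists A; split => //; apply: subset_trans AP => x /=.
by apply: contra_not => h; split; [exact: h true|exact: h false].
Qed.

Section RegularPoints.
Variables (R : realType) (l : nat) (f : R -> R) (Omega : set (R * R)) (u g g0 : R * R -> R)
  (M : R).
Hypotheses (l_ge2 : (2 <= l)%N) (f_Cl : of_class_C l f) (f_nonlinear : nonlinear l f)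
  (Omega_open : open Omega) (u_cont : {within Omega, continuous u})
  (eq_u : weak_solution Omega f u g)
  (mg0 : measurable_fun setT (g0 : plane R -> measurableTypeR R))
  (mg : measurable_fun setT (g \_ Omega : plane R -> measurableTypeR R))
  (g0M : forall z, `|g0 z| <= M) (gg0 : {ae leb2 R, forall z, (g \_ Omega) z = g0 z}).

Let f1 := derive1 f.
Let f2 := derive1n 2 f.

Definition inner_box (tc xc rho : R) : Prop := 0 < rho /\
  forall t x, `|t - tc| <= rho -> `|x - xc| <= rho -> Omega (t, x).

Let fd1 v : der f v (f1 v).
Proof. by apply: (@derive1n_der R f l 0 v f_Cl); lia. Qed.

Let fd2 v : der f1 v (f2 v).
Proof. exact: (@derive1n_der R f l 1 v f_Cl). Qed.

Let f1c : continuous f1.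
Proof. by move=> v; exact: der_cont (fd2 v). Qed.

Let f2c : continuous f2.
Proof.
move: l_ge2 f_Cl; rewrite leq_eqVlt => /orP[/eqP <- [_ //]|l3 fC v].
exact: der_cont (@derive1n_der R f l 2 v fC l3).
Qed.

(** The conditions on the box stand under the almost-everywhere quantifier: for unsuitable boxes the
    claim is vacuous, and it can then be intersected over all rational boxes. *)
Lemma convex_points_ae (tc xc rho : R) :
  {ae leb2 R, forall z : R * R, inner_box tc xc rho -> box tc xc (rho / 4) z.1 z.2 ->
    (exists m m2 c de, convex_range f1 m m2 c de /\
      forall t x, `|t - tc| <= rho -> `|x - xc| <= rho -> `|u (t, x) - c| < de) ->
    little_o_at l u z}.
Proof.
have [[[rho0 inO] [m [m2 [c [de [cr ran]]]]]]|no] := pselect (inner_box tc xc rho /\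
  exists m m2 c de, convex_range f1 m m2 c de /\
      forall t x, `|t - tc| <= rho -> `|x - xc| <= rho -> `|u (t, x) - c| < de); last first.
  by apply: aeW => z h _ h'; exfalso; apply: no.
have [w [U [V [cl wu wran exc]]]] := local_solution fd1 f1c Omega_open u_cont eq_u mg0 mg g0M
  gg0 rho0 inO.
have wc t x : `|w t x - c| < de by have [t' [x' [h1 h2 ->]]] := wran t x; exact: ran.
have [A [mA A0 AP]] := convex_range_ae l_ge2 cr cl wc rho0 mg0 g0M exc.
exists A; split => //; apply: subset_trans AP => z /=.
by apply: contra_not => D _ bz _; apply: (little_o_at_box rho0 wu bz); exact: D.
Qed.

(** The passage to [- u] replaces the flux by [v -> - f (- v)], whose derivative is [f1 (- v)], and
    changes the sign of the source. *)
Lemma concave_points_ae (tc xc rho : R) :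
  {ae leb2 R, forall z : R * R, inner_box tc xc rho -> box tc xc (rho / 4) z.1 z.2 ->
    (exists m m2 c de, convex_range (fun v => f1 (- v)) m m2 c de /\
      forall t x, `|t - tc| <= rho -> `|x - xc| <= rho -> `|- u (t, x) - c| < de) ->
    little_o_at l u z}.
Proof.
have [[[rho0 inO] [m [m2 [c [de [cr ran]]]]]]|no] := pselect (inner_box tc xc rho /\
  exists m m2 c de, convex_range (fun v => f1 (- v)) m m2 c de /\
      forall t x, `|t - tc| <= rho -> `|x - xc| <= rho -> `|- u (t, x) - c| < de); last first.
  by apply: aeW => z h _ h'; exfalso; apply: no.
have [w [U [V [cl wu wran exc]]]] := local_solution fd1 f1c Omega_open u_cont eq_u mg0 mg g0M
  gg0 rho0 inO.
have wc t x : `|- w t x - c| < de by have [t' [x' [h1 h2 ->]]] := wran t x; exact: ran.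
have mg0N : measurable_fun setT
    ((fun z => - g0 z) : plane R -> measurableTypeR R).
  exact: measurable_funN.
have g0NM z : `|- g0 z| <= M by rewrite normrN.
have excN t1 t2 a b : t1 < t2 -> a < b -> rect_in (box tc xc rho) t1 t2 a b ->
    excess (fun t x => - U t x) (fun t x => - V t x) t1 t2 a b =
    \int[leb2 R]_(z in rect t1 t2 a b) (- g0 z).
  move=> t12 ab rin; rewrite excess_neg exc//.
  under [RHS]eq_Rintegral do rewrite -mulN1r.
  rewrite RintegralZl ?mulN1r//; first exact: measurable_rect.
  by apply: (@rect_integrable R _ _ _ _ M) => //; exact: ltW.
have [A [mA A0 AP]] := convex_range_ae l_ge2 cr (conslaw_neg cl) wc rho0 mg0N g0NM excN.
exists A; split => //; apply: subset_trans AP => z /=.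
apply: contra_not => D _ bz _; apply: (little_o_at_box rho0 wu bz) => e e0.
have [d d0 dP] := D bz e e0; exists d => // y /dP /=.
by rewrite -opprD normrN.
Qed.
(** The interval between [p] and [q] determines the zero of [f2] that it isolates, so pairs of
    rationals replace an enumeration of the zeros. *)
Lemma inflection_points_ae (tc xc rho p q : R) :
  {ae leb2 R, forall z : R * R, inner_box tc xc rho -> box tc xc (rho / 4) z.1 z.2 ->
    f2 (u z) = 0 -> p < u z < q -> (forall v, p < v < q -> f2 v = 0 -> v = u z) ->
    little_o_at l u z}.
Proof.
have [[[rho0 inO] [v [vpq v0 vuniq]]]|no] := pselect (inner_box tc xc rho /\
  exists v, [/\ p < v < q, f2 v = 0 & forall v', p < v' < q -> f2 v' = 0 -> v' = v]); last first.
  by apply: aeW => z h _ h0 hpq hu; exfalso; apply: no; split => //; exists (u z).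
have [w [U [V [cl wu wran exc]]]] := local_solution fd1 f1c Omega_open u_cont eq_u mg0 mg g0M
  gg0 rho0 inO.
have M0 : 0 <= M := le_trans (normr_ge0 _) (g0M (0, 0)).
have bal : balance (box tc xc rho) U V (- (M + 1)) (M + 1) (fun=> 0).
  by apply: balance_bounded mg0 g0M _ exc; rewrite lerDl.
have [L _ LP] : exists2 L : R, 0 < L & forall z,
    rect (tc - rho) (tc + rho) (xc - rho) (xc + rho) z -> `|f1 (w z.1 z.2)| <= L.
  apply: continuous_rect_bound => z.
  apply: (@continuous_comp _ _ _ (fun z : R * R => w z.1 z.2) f1); last exact: f1c.
  exact: (cont2_continuous (cl_cont cl)).
have HL t x : `|f1 (w t x)| <= L.
  have [t' [x' [h1 h2 wE]]] := wran t x.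
  rewrite wE -(wu t' x')//; apply: (LP (t', x')).
  by split; rewrite /= in_itv/= -ler_distl.
have [c c0 nl] := f_nonlinear v.
have M1 : 0 < M + 1 by rewrite ltr_wpDl.
have [A [mA A0 AP]] := degenerate_ae l_ge2 f_Cl c0 nl cl bal M1 rho0 HL.
exists A; split => //; apply: subset_trans AP => z /=.
apply: contra_not => D _ bz h0 hpq _; apply: (little_o_at_box rho0 wu bz); apply: D => //.
rewrite -(vuniq _ hpq h0) wu; first by case: z {bz h0 hpq}.
- exact: ltW (box_quarter bz).1.
- exact: ltW (box_quarter bz).2.
Qed.

Lemma regular_points_ae : {ae leb2 R, forall z : R * R, Omega z -> little_o_at l u z}.
Proof.
pose I := (rat * rat * rat)%type.
pose tc (i : I) : R := ratr i.1.1; pose xc (i : I) : R := ratr i.1.2; pose rho (i : I) : R := ratr i.2.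
have convex := ae_forall_count (fun i => convex_points_ae (tc i) (xc i) (rho i)).
have concave := ae_forall_count (fun i => concave_points_ae (tc i) (xc i) (rho i)).
have inflection := ae_forall_count (fun j : I * (rat * rat) =>
  inflection_points_ae (tc j.1) (xc j.1) (rho j.1) (ratr j.2.1) (ratr j.2.2)).
have [A [mA A0 AP]] := ae_and convex (ae_and concave inflection).
exists A; split => //; apply: subset_trans AP => z /=.
apply: contra_not => -[cvx [ccv infl]] Oz.
have cu : {for z, continuous u}.
  by move: u_cont; rewrite continuous_open_subspace// => /(_ _ (mem_set Oz)).
have small (e : R) : 0 < e -> exists i : I, [/\ inner_box (tc i) (xc i) (rho i),
    box (tc i) (xc i) (rho i / 4) z.1 z.2 &
    forall t x, `|t - tc i| <= rho i -> `|x - xc i| <= rho i -> `|u (t, x) - u z| < e].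
  move=> e0.
  have [[B1 B2] /= [nB1 nB2] B12] : nbhs z Omega by apply: open_nbhs_nbhs.
  move/cvgrPdist_lt: cu => /(_ e e0)[[C1 C2] /= [nC1 nC2] C12].
  have [d1 /= d10 d1P] := filterI nB1 nC1; have [d2 /= d20 d2P] := filterI nB2 nC2.
  have [d [d0 dd1 dd2]] := pos_le2 d10 d20.
  have [i [i0 ib iP]] := rational_box z d0.
  have key t x : `|t - tc i| <= rho i -> `|x - xc i| <= rho i ->
      Omega (t, x) /\ `|u (t, x) - u z| < e.
    move=> ht hx; have [h1 h2] := iP t x ht hx.
    have [b1 c1] : (B1 `&` C1) t by apply: d1P; rewrite /= distrC; exact: lt_le_trans dd1.
    have [b2 c2] : (B2 `&` C2) x by apply: d2P; rewrite /= distrC; exact: lt_le_trans dd2.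
    split; first exact: B12.
    by rewrite distrC; exact: (C12 (t, x)).
  exists i; split => //; first by split => // t x ht hx; have [] := key t x ht hx.
  by move=> t x ht hx; have [] := key t x ht hx.
(* For a nonzero sign, continuity of [u] gives a rational box on which its values stay in the range
   of uniform convexity or concavity; at a zero, isolation gives the rationals [p] and [q]. *)
have [fneg|fpos|f0] := ltgtP (f2 (u z)) 0.
- have fdN v : der (fun v => f1 (- v)) v (- f2 (- v)).
    move=> e e0; have [r r0 rP] := @fd2 (- v) e e0; exists r => // h hr.
    by have := rP (- h); rewrite !normrN mulrN mulNr -opprD; exact.
  have fcN : continuous (fun v => - f2 (- v)).
    move=> v; apply: cvgN; apply: (@continuous_comp _ _ _ (fun v => - v) f2); last exact: f2c.
    exact: cvgN cvg_id.
  have [|m [m2 [de cr]]] := @convex_range_exists R _ _ (- u z) fdN fcN.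
    by rewrite opprK oppr_gt0.
  have [_ _ de0 _ _] := cr.
  have [i [ii ib iu]] := small de de0; apply: (ccv i ii ib).
  exists m, m2, (- u z), de; split => // t x ht hx.
  by rewrite -opprD normrN; exact: iu.
- have [m [m2 [de cr]]] := convex_range_exists fd2 f2c fpos.
  have [_ _ de0 _ _] := cr.
  have [i [ii ib iu]] := small de de0; apply: (cvx i ii ib).
  by exists m, m2, (u z), de.
- have [c c0 nl] := f_nonlinear (u z).
  have [d d0 dP] := derivable_isolated_zeros l_ge2 f_Cl c0 nl.
  have [i [ii ib _]] := small 1 ltr01.
  have [p] := @rat_in_itvoo R (u z - d) (u z) ltac:(by rewrite gtrBl).
  rewrite in_itv/= => /andP[p1 p2].
  have [q] := @rat_in_itvoo R (u z) (u z + d) ltac:(by rewrite ltrDl).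
  rewrite in_itv/= => /andP[q1 q2].
  apply: (infl (i, (p, q))) => //=; first by rewrite p2 q1.
  move=> v /andP[pv vq]; apply: dP; rewrite ltr_distl (lt_trans p1 pv).
  exact: lt_trans q2.
Qed.
End RegularPoints.
Unset Implicit Arguments.

Theorem proposition4p1 (R : realType) (l : nat) (l_ge2 : (2 <= l)%N)
    (f : R -> R) (f_Cl : of_class_C l f) (f_nonlinear : nonlinear l f)
    (Omega : set (R * R)) (Omega_open : open Omega)
    (u : R * R -> R) (u_cont : {within Omega, continuous u})
    (g : R * R -> R) (g_Linfty : Linfty Omega g)
    (eq_u : weak_solution Omega f u g) :
  {ae leb2 R, forall z : R * R, Omega z ->
    limsup_quotient Omega l u z = 0%E}.
Proof.
have [g0 [M [mg mg0 g0M gg0]]] := Linfty_bounded g_Linfty.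
have [A [mA A0 AP]] := regular_points_ae l_ge2 f_Cl f_nonlinear Omega_open u_cont eq_u
  mg0 mg g0M gg0.
exists A; split => //; apply: subset_trans AP => z /=.
apply: contra_not => lo Oz; apply: little_o_limsup => //; last exact: lo.
exact: ltnW.
Qed.
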